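(* The function $\nabla = \cos^2 \tfrac{2}{3}\psi$ is not elliptic; that is, it does not admit an extension from a small disc about $0$ to an elliptic (doubly periodic meromorphic) function on $\mathbb{C}$.
   Context: Let $0<\kappa<1$ and $\lambda=\sqrt{1-\kappa^2}\in(0,1)$. Let $F(\tfrac16,\tfrac56;\tfrac12;\cdot)$ denote the Gauss hypergeometric function. Define $u$ as a function of $\phi$ near $0$ by $u=\int_0^{\sin\phi}F(\tfrac16,\tfrac56;\tfrac12;\kappa^2t^2)\,\frac{dt}{\sqrt{1-t^2}}$; near the origin (fixing $0$) this inverts to a holomorphic function $u\mapsto\phi(u)$ with $\phi(0)=0$. Let $\psi$ be the holomorphic function near $0$ with $\psi(0)=0$ and $\sin\psi=\kappa\sin\phi$. Set $\partial=\cos\tfrac23\psi$ and $\nabla=\partial^2$, regarded as functions of $u$ on a small disc about $0$. *)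

(* Defs.v *)
From Stdlib Require Import Reals Lra.
From Coquelicot Require Import Coquelicot.
Open Scope R_scope.

(* Sum of a complex series, taken componentwise (meaningful when convergent). *)
Definition csum (a : nat -> C) : C :=
  (Series (fun n => Re (a n)), Series (fun n => Im (a n))).

Definition csin (z : C) : C :=
  csum (fun n => Cmult (RtoC ((-1) ^ n / INR (Factorial.fact (2 * n + 1)))) (Cpow z (2 * n + 1))).
Definition ccos (z : C) : C :=
  csum (fun n => Cmult (RtoC ((-1) ^ n / INR (Factorial.fact (2 * n)))) (Cpow z (2 * n))).

Fixpoint poch (a : R) (n : nat) : R :=
  match n with O => 1 | S k => poch a k * (a + INR k) end.

Definition hyp2F1 (a b c : R) (z : C) : C :=
  csum (fun n => Cmult (RtoC (poch a n * poch b n / (poch c n * INR (Factorial.fact n)))) (Cpow z n)).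

Definition csqrt (z : C) : C :=
  (sqrt ((Cmod z + Re z) / 2),
   (if Rle_dec 0 (Im z) then 1 else -1) * sqrt ((Cmod z - Re z) / 2)).

(* Integral of g along the straight segment from 0 to s:
   int_0^s g(t) dt = s * int_0^1 g(tau s) dtau. *)
Definition seg_int (g : C -> C) (s : C) : C :=
  Cmult s (RInt (fun tau => Re (g (Cmult (RtoC tau) s))) 0 1,
           RInt (fun tau => Im (g (Cmult (RtoC tau) s))) 0 1).

Definition u_of (kappa : R) (phi : C) : C :=
  seg_int (fun t => Cdiv (hyp2F1 (1/6) (5/6) (1/2) (Cmult (RtoC (kappa ^ 2)) (Cmult t t)))
                         (csqrt (Cminus (RtoC 1) (Cmult t t))))
          (csin phi).

Definition holo_at (f : C -> C) (z : C) : Prop :=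
  @ex_derive C_AbsRing C_NormedModule f z.

(* Elliptic function: meromorphic on C (holomorphic off a closed discrete set P
   of poles, with |f| -> +oo at each point of P) and doubly periodic with two
   R-linearly independent periods. *)
Definition elliptic (f : C -> C) : Prop :=
  exists (P : C -> Prop) (w1 w2 : C),
    (forall z, exists e, 0 < e /\ forall w, Cmod (Cminus w z) < e -> P w -> w = z) /\
    (forall z, ~ P z -> holo_at f z) /\
    (forall p, P p ->
       filterlim (fun z => Cmod (f z)) (within (fun z => z <> p) (locally p))
                 (Rbar_locally p_infty)) /\
    (forall a b : R, Cplus (Cmult (RtoC a) w1) (Cmult (RtoC b) w2) = RtoC 0 ->
       a = 0 /\ b = 0) /\
    (forall z, (P (Cplus z w1) <-> P z) /\ (P (Cplus z w2) <-> P z)) /\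
    (forall z, ~ P z -> f (Cplus z w1) = f z /\ f (Cplus z w2) = f z).

(* Main.v *)
Require Import Defs.
From Stdlib Require Import Reals Lra Lia ZArith Classical ClassicalEpsilon.
From Coquelicot Require Import Coquelicot.
Open Scope R_scope.

(** Since F(1/6,5/6;1/2;sin^2 psi) cos psi = cos(2 psi/3), the function x = cos^2(2 psi/3) satisfies
    near 0 the algebraic differential equation
      (2 x'' + A)^2 x = Q(x)^2,  A = (8/9)(2 kappa^2 - 1),  Q(x) = (4/3)(1-x)(4x-1) - (8/9)(4x-3)x.
    An elliptic extension satisfies it off its poles, by the identity theorem; as Q(0) <> 0, it then
    has no zero, so its reciprocal attains its maximum modulus and is constant. The constant is 1,
    and the equation becomes A^2 = Q(1)^2, i.e. (2 kappa^2 - 1)^2 = 1, which 0 < kappa < 1 excludes.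

    The complex analysis rests on Goursat's theorem for rectangles. Applied to h(exp w) it gives the
    mean value property on circles, even if h is only continuous at the centre. For the difference
    quotient of f this expresses f' as a mean over a circle, whence f' is again holomorphic; and it
    gives the maximum principle, from which the identity theorem follows as in Schwarz's lemma. *)

(** * Complex differentiability *)

(** Put theta = 2 psi/3, d = cos theta and x = d^2. Differentiating the defining integral gives d
    psi' = kappa cos phi, hence x' = -(4/3) kappa sin theta cos phi. Since 2 psi = 3 theta, the
    doubles of sin^2 psi and sin psi cos psi are 1 - cos 3 theta and sin 3 theta, so x'' closes up
    as (2 x'' + A) d = Q(d^2). An extension of x need not carry a single-valued root d; squaring
    leaves an equation in x alone.

    The order two matters. Evaluated at a zero of x, the first-order relation (x')^2 = (8/9)(1 -
    x)(2 kappa^2 - 1 + (4x - 3) d) gives no contradiction. Differentiating it brings in 1/d, and the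
    resulting term Q(0)/d with Q(0) = -4/3 cannot be balanced by a finite x''. *)

Lemma Cmod_sub_sym (z w : C) : Cmod (z - w) = Cmod (w - z).
Proof. rewrite <- (Cmod_opp (z - w)). f_equal; ring. Qed.

Lemma Cmod_sub_triangle (z w v : C) : Cmod (z - v) <= Cmod (z - w) + Cmod (w - v).
Proof. replace (z - v)%C with ((z - w) + (w - v))%C by ring. apply Cmod_triangle. Qed.

Lemma Cmod_reverse_triangle (z w : C) : Cmod z - Cmod w <= Cmod (z - w).
Proof.
  assert (H := Cmod_triangle (z - w) w).
  replace (z - w + w)%C with z in H by ring. lra.
Qed.

Lemma Im_le_Cmod (z : C) : Rabs (Im z) <= Cmod z.
Proof. eapply Rle_trans; [apply Rmax_r | apply Rmax_Cmod]. Qed.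

Lemma Cmod_le_Re_Im (z : C) : Cmod z <= Rabs (Re z) + Rabs (Im z).
Proof.
  destruct z as [x y]. simpl.
  replace ((x, y) : C) with (RtoC x + Ci * RtoC y)%C
    by (apply injective_projections; simpl; ring).
  eapply Rle_trans; [apply Cmod_triangle|].
  rewrite Cmod_mult, Cmod_Ci, !Cmod_R. lra.
Qed.

(** The balls of [C_UniformSpace] are squares, as C is a product; the factor [sqrt 2] compares them
    with discs. *)
Lemma locally_Cmod (z : C) (P : C -> Prop) :
  @locally C_UniformSpace z P <->
  exists d, 0 < d /\ forall w, Cmod (w - z) < d -> P w.
Proof.
  split.
  - intros [d H]. exists d. split; [apply cond_pos|]. intros w Hw.
    apply H. now apply C_NormedModule_mixin_compat1.
  - intros (d & Hd & H).
    assert (Hs : 0 < sqrt 2) by (apply sqrt_lt_R0; lra).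
    assert (Hd' : 0 < d / sqrt 2) by (apply Rdiv_lt_0_compat; lra).
    exists (mkposreal _ Hd'). intros w Hw. apply H.
    assert (K := C_NormedModule_mixin_compat2 z w _ Hw). simpl in K.
    replace (sqrt 2 * (d / sqrt 2)) with d in K by (field; lra). exact K.
Qed.

(** The domain is an arbitrary uniform space, so that the same closure lemmas serve curves [R -> C]
    and functions [C -> C]. *)
Definition cont {U : UniformSpace} (f : U -> C) (x : U) : Prop :=
  forall eps, 0 < eps -> locally x (fun u => Cmod (f u - f x) < eps).

Lemma cont_C (f : C -> C) (z : C) :
  @cont C_UniformSpace f z <->
  forall eps, 0 < eps -> exists d, 0 < d /\
    forall w, Cmod (w - z) < d -> Cmod (f w - f z) < eps.
Proof.
  split; intros H eps He; specialize (H eps He).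
  - now apply locally_Cmod in H.
  - now apply locally_Cmod.
Qed.

Lemma cont_iff {U : UniformSpace} (f : U -> C) (x : U) :
  cont f x <-> continuous (fun u => Re (f u)) x /\ continuous (fun u => Im (f u)) x.
Proof.
  split.
  - intros H; split; apply filterlim_locally; intros eps;
      apply (filter_imp (fun u => Cmod (f u - f x) < eps)); try apply H; try apply cond_pos;
      intros u Hu; eapply Rle_lt_trans; try apply Hu.
    + change (Rabs (Re (f u - f x)) <= Cmod (f u - f x)). apply re_le_Cmod.
    + change (Rabs (Im (f u - f x)) <= Cmod (f u - f x)). apply Im_le_Cmod.
  - intros [H1 H2] eps He.
    assert (He2 : 0 < eps / 2) by lra.
    generalize (proj1 (filterlim_locally _ _) H1 (mkposreal _ He2)).
    generalize (proj1 (filterlim_locally _ _) H2 (mkposreal _ He2)).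
    intros K2 K1. generalize (filter_and _ _ K1 K2). apply filter_imp.
    intros u [L1 L2].
    change (Rabs (Re (f u - f x)) < eps / 2) in L1.
    change (Rabs (Im (f u - f x)) < eps / 2) in L2.
    eapply Rle_lt_trans; [apply Cmod_le_Re_Im|]. lra.
Qed.

Lemma cont_const {U : UniformSpace} (c : C) (x : U) : cont (fun _ => c) x.
Proof. apply cont_iff; split; apply continuous_const. Qed.

Lemma cont_plus {U : UniformSpace} (f g : U -> C) (x : U) :
  cont f x -> cont g x -> cont (fun u => f u + g u)%C x.
Proof.
  rewrite !cont_iff; intros [] []; simpl; split;
    apply @continuous_plus; assumption.
Qed.

Lemma cont_mult {U : UniformSpace} (f g : U -> C) (x : U) :
  cont f x -> cont g x -> cont (fun u => f u * g u)%C x.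
Proof.
  rewrite !cont_iff; intros [] []; simpl; split.
  - apply @continuous_minus; apply @continuous_mult; assumption.
  - apply @continuous_plus; apply @continuous_mult; assumption.
Qed.

Lemma cont_opp {U : UniformSpace} (f : U -> C) (x : U) :
  cont f x -> cont (fun u => - f u)%C x.
Proof. rewrite !cont_iff; intros []; simpl; split; apply @continuous_opp; assumption. Qed.

Lemma cont_minus {U : UniformSpace} (f g : U -> C) (x : U) :
  cont f x -> cont g x -> cont (fun u => f u - g u)%C x.
Proof. intros Hf Hg. apply cont_plus; [|apply cont_opp]; assumption. Qed.

Lemma cont_inv {U : UniformSpace} (f : U -> C) (x : U) :
  cont f x -> f x <> 0%C -> cont (fun u => / f u)%C x.
Proof.
  rewrite !cont_iff; intros [H1 H2] H0; simpl.
  assert (Hn : fst (f x) ^ 2 + snd (f x) ^ 2 <> 0).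
  { intro K. apply H0. apply injective_projections; simpl; nra. }
  assert (Hc : continuous (fun u => / (fst (f u) ^ 2 + snd (f u) ^ 2)) x).
  { apply (continuous_comp (fun u => fst (f u) ^ 2 + snd (f u) ^ 2) Rinv);
      [|now apply continuous_Rinv].
    apply @continuous_plus; simpl; repeat apply @continuous_mult;
      try assumption; apply continuous_const. }
  split; apply @continuous_mult; try assumption.
  now apply @continuous_opp.
Qed.

Lemma cont_comp {U : UniformSpace} (g : U -> C) (f : C -> C) (x : U) :
  cont g x -> @cont C_UniformSpace f (g x) -> cont (fun u => f (g u)) x.
Proof.
  intros Hg Hf eps He. apply cont_C with (eps := eps) in Hf; [|exact He].
  destruct Hf as (d & Hd & Hf). generalize (Hg d Hd). apply filter_imp.
  intros u. apply Hf.
Qed.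

Lemma cont_ext_loc {U : UniformSpace} (f g : U -> C) (x : U) :
  locally x (fun u => f u = g u) -> cont f x -> cont g x.
Proof.
  intros H Hf eps He. generalize (filter_and _ _ H (Hf eps He)).
  apply filter_imp. intros u [E K]. rewrite <- E.
  now rewrite <- (locally_singleton _ _ H).
Qed.

Lemma cont_RtoC {U : UniformSpace} (h : U -> R) (x : U) :
  continuous h x -> cont (fun u => RtoC (h u)) x.
Proof. intro H. apply cont_iff; split; simpl; [exact H | apply continuous_const]. Qed.

Lemma cont_id (z : C) : @cont C_UniformSpace (fun w => w) z.
Proof. apply cont_C. intros eps He. exists eps. now split. Qed.

(** Carathéodory's form of the derivative: the difference quotient, filled in at [z], is continuous
    there. Product and chain rule become algebraic identities between quotients, and the quotient
    itself is what the mean value property is later applied to. *)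
Definition cderiv (f : C -> C) (z l : C) : Prop :=
  exists q : C -> C, @cont C_UniformSpace q z /\ q z = l /\
    forall w, f w = (f z + (w - z) * q w)%C.

Lemma cderiv_eps (f : C -> C) (z l : C) :
  cderiv f z l <->
  forall eps, 0 < eps -> exists d, 0 < d /\ forall w, Cmod (w - z) < d ->
    Cmod (f w - f z - (w - z) * l) <= eps * Cmod (w - z).
Proof.
  split.
  - intros (q & Hq & Hl & E) eps He.
    destruct (proj1 (cont_C q z) Hq eps He) as (d & Hd & K).
    exists d; split; [exact Hd|]. intros w Hw.
    rewrite (E w), <- Hl.
    replace (f z + (w - z) * q w - f z - (w - z) * q z)%C
      with ((q w - q z) * (w - z))%C by ring.
    rewrite Cmod_mult. apply Rmult_le_compat_r; [apply Cmod_ge_0|].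
    left. now apply K.
  - intros H.
    exists (fun w => if excluded_middle_informative (w = z) then l
                     else (f w - f z) / (w - z))%C.
    split; [|split].
    + apply cont_C. intros eps He.
      destruct (H (eps / 2)) as (d & Hd & K); [lra|].
      exists d; split; [exact Hd|]. intros w Hw.
      destruct (excluded_middle_informative (z = z)) as [_|n]; [|now destruct n].
      destruct (excluded_middle_informative (w = z)) as [->|n].
      * replace (l - l)%C with (RtoC 0) by ring. rewrite Cmod_0. exact He.
      * specialize (K w Hw).
        assert (N : (w - z)%C <> 0%C) by (intro N; apply n; rewrite <- (Cplus_0_r z), <- N; ring).
        assert (Np := proj1 (Cmod_gt_0 _) N).
        replace ((f w - f z) / (w - z) - l)%C
          with ((f w - f z - (w - z) * l) / (w - z))%C by (field; exact N).
        rewrite Cmod_div by exact N.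
        apply Rle_lt_trans with (eps / 2); [|lra].
        apply Rmult_le_reg_r with (Cmod (w - z)); [exact Np|].
        unfold Rdiv at 1. rewrite Rmult_assoc, Rinv_l by lra. lra.
    + destruct (excluded_middle_informative (z = z)) as [_|n]; [reflexivity|now destruct n].
    + intro w. destruct (excluded_middle_informative (w = z)) as [->|n].
      * ring.
      * field. intro N; apply n; rewrite <- (Cplus_0_r z), <- N; ring.
Qed.

Lemma is_derive_cderiv (f : C -> C) (z l : C) :
  @is_derive C_AbsRing C_NormedModule f z l <-> cderiv f z l.
Proof.
  rewrite cderiv_eps. split.
  - intros [_ H] eps He.
    assert (Hl := H z (fun P HP => HP) (mkposreal _ He)).
    destruct Hl as [d Hl]. exists d. split; [apply cond_pos|]. exact Hl.
  - intros H. split; [apply is_linear_scal_l|].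
    intros x Hx eps. 
    assert (x = z) as ->.
    { symmetry. apply (@is_filter_lim_locally_unique C_AbsRing (AbsRing_NormedModule C_AbsRing)). exact Hx. }
    destruct (H eps (cond_pos eps)) as (d & Hd & K).
    exists (mkposreal d Hd). exact K.
Qed.

Lemma holo_at_cderiv (f : C -> C) (z : C) : holo_at f z <-> exists l, cderiv f z l.
Proof.
  split; intros [l H]; exists l; apply is_derive_cderiv; exact H.
Qed.

Lemma cderiv_unique (f : C -> C) (z l l' : C) : cderiv f z l -> cderiv f z l' -> l = l'.
Proof.
  intros H1 H2. apply is_derive_cderiv in H1, H2.
  apply is_C_derive_unique in H1, H2. congruence.
Qed.

Lemma cderiv_cont (f : C -> C) (z l : C) : cderiv f z l -> @cont C_UniformSpace f z.
Proof.
  intros (q & Hq & _ & E).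
  apply cont_ext_loc with (fun w => f z + (w - z) * q w)%C.
  { apply locally_Cmod. exists 1. split; [lra|]. intros; symmetry; apply E. }
  apply cont_plus; [apply cont_const|]. apply cont_mult; [|exact Hq].
  apply cont_minus; [apply cont_id|apply cont_const].
Qed.

Lemma cderiv_const (c z : C) : cderiv (fun _ => c) z 0.
Proof. exists (fun _ => RtoC 0). split; [apply cont_const|]. split; [reflexivity|]. intros; ring. Qed.

Lemma cderiv_id (z : C) : cderiv (fun w => w) z 1.
Proof. exists (fun _ => RtoC 1). split; [apply cont_const|]. split; [reflexivity|]. intros; ring. Qed.

Lemma cderiv_plus (f g : C -> C) (z l m : C) :
  cderiv f z l -> cderiv g z m -> cderiv (fun w => f w + g w)%C z (l + m).
Proof.
  intros (p & Hp & Lp & Ep) (q & Hq & Lq & Eq). exists (fun w => p w + q w)%C.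
  split; [now apply cont_plus|]. split; [congruence|]. intro w. rewrite (Ep w), (Eq w). ring.
Qed.

Lemma cderiv_mult (f g : C -> C) (z l m : C) :
  cderiv f z l -> cderiv g z m -> cderiv (fun w => f w * g w)%C z (l * g z + f z * m).
Proof.
  intros Hf (q & Hq & Lq & Eq). assert (Cf := cderiv_cont _ _ _ Hf).
  destruct Hf as (p & Hp & Lp & Ep).
  exists (fun w => p w * g z + f w * q w)%C.
  split; [|split].
  - apply cont_plus; apply cont_mult; trivial using cont_const.
  - congruence.
  - intro w. rewrite (Eq w). rewrite (Ep w). ring.
Qed.

Lemma cderiv_opp (f : C -> C) (z l : C) : cderiv f z l -> cderiv (fun w => - f w)%C z (- l).
Proof.
  intros (p & Hp & Lp & Ep). exists (fun w => - p w)%C.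
  split; [now apply cont_opp|]. split; [congruence|]. intro w. rewrite (Ep w). ring.
Qed.

Lemma cderiv_minus (f g : C -> C) (z l m : C) :
  cderiv f z l -> cderiv g z m -> cderiv (fun w => f w - g w)%C z (l - m).
Proof. intros Hf Hg. apply cderiv_plus; [exact Hf | now apply cderiv_opp]. Qed.

Lemma cderiv_comp (f g : C -> C) (z l m : C) :
  cderiv f (g z) l -> cderiv g z m -> cderiv (fun w => f (g w)) z (l * m).
Proof.
  intros (p & Hp & Lp & Ep) Hg. assert (Cg := cderiv_cont _ _ _ Hg).
  destruct Hg as (q & Hq & Lq & Eq).
  exists (fun w => p (g w) * q w)%C. split; [|split].
  - apply cont_mult; [|exact Hq]. now apply (cont_comp g p).
  - congruence.
  - intro w. rewrite (Ep (g w)). rewrite (Eq w) at 1. ring.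
Qed.

Lemma cderiv_ext_loc (f g : C -> C) (z l : C) d :
  0 < d -> (forall w, Cmod (w - z) < d -> f w = g w) -> cderiv f z l -> cderiv g z l.
Proof.
  rewrite !cderiv_eps. intros Hd E H eps He. destruct (H eps He) as (e & He' & K).
  exists (Rmin d e). split; [now apply Rmin_glb_lt|]. intros w Hw.
  rewrite <- !E.
  - apply K. eapply Rlt_le_trans; [exact Hw|apply Rmin_r].
  - replace (z - z)%C with (RtoC 0) by ring. now rewrite Cmod_0.
  - eapply Rlt_le_trans; [exact Hw|apply Rmin_l].
Qed.

Lemma cderiv_inv (f : C -> C) (z l : C) :
  cderiv f z l -> f z <> 0%C -> cderiv (fun w => / f w)%C z (- l / (f z * f z)).
Proof.
  intros Hf N. assert (Cf := cderiv_cont _ _ _ Hf).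
  destruct Hf as (p & Hp & Lp & Ep).
  (* away from [z], where [f] may vanish and [/ 0] is a junk value, only the germ matters *)
  assert (Npos := proj1 (Cmod_gt_0 _) N).
  destruct (proj1 (cont_C f z) Cf _ Npos) as (d & Hd & K).
  assert (Nw : forall w, Cmod (w - z) < d -> f w <> 0%C).
  { intros w Hw E. specialize (K w Hw). rewrite E in K.
    replace (0 - f z)%C with (- f z)%C in K by ring. rewrite Cmod_opp in K. lra. }
  apply (cderiv_ext_loc (fun w => / f z + (w - z) * (- p w / (f z * f w)))%C _ _ _ d Hd).
  - intros w Hw. specialize (Nw w Hw). rewrite (Ep w). rewrite (Ep w) in Nw. field.
    split; assumption.
  - exists (fun w => - p w / (f z * f w))%C. split; [|split].
    + apply cont_mult; [now apply cont_opp|]. apply cont_inv.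
      * apply cont_mult; [apply cont_const|exact Cf].
      * intro E. apply N. destruct (Ceq_dec (f z) 0) as [E'|E']; [exact E'|].
        exfalso. now apply (Cmult_neq_0 _ _ E' E').
    + congruence.
    + intro w. ring.
Qed.

Lemma cderiv_eq (f : C -> C) (z l l' : C) : cderiv f z l -> l = l' -> cderiv f z l'.
Proof. now intros H <-. Qed.

(** * Bisection and its consequences *)

(** One nested-rectangle argument serves both compactness and Goursat's theorem. A rectangle is
    given by its lower left corner and the stage [n], which fixes its sides as L/2^n and H/2^n; the
    successive choices are made by [epsilon]. *)
Lemma bisection (B : R -> R -> nat -> Prop) (x0 y0 L H : R) :
  0 <= L -> 0 <= H -> B x0 y0 0%nat ->
  (forall x y n, B x y n ->
     exists x' y', B x' y' (S n) /\
       (x' = x \/ x' = x + L * (1/2) ^ S n) /\ (y' = y \/ y' = y + H * (1/2) ^ S n)) ->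
  exists p q, forall n, exists x y, B x y n /\
    x <= p <= x + L * (1/2) ^ n /\ y <= q <= y + H * (1/2) ^ n.
Proof.
  intros HL HH B0 Hstep.
  pose (step := fun n (s : R * R) =>
    epsilon (inhabits s) (fun s' : R * R => B (fst s') (snd s') (S n) /\
       (fst s' = fst s \/ fst s' = fst s + L * (1/2) ^ S n) /\
       (snd s' = snd s \/ snd s' = snd s + H * (1/2) ^ S n))).
  pose (u := fix u n := match n with O => (x0, y0) | S k => step k (u k) end).
  assert (HB : forall n, B (fst (u n)) (snd (u n)) n).
  { induction n as [|n IH]; [exact B0|]. simpl. unfold step.
    destruct (Hstep _ _ _ IH) as (x' & y' & K).
    apply (epsilon_spec (inhabits (u n))
      (fun s' : R * R => B (fst s') (snd s') (S n) /\
       (fst s' = fst (u n) \/ fst s' = fst (u n) + L * (1/2) ^ S n) /\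
       (snd s' = snd (u n) \/ snd s' = snd (u n) + H * (1/2) ^ S n))).
    now exists (x', y'). }
  assert (HS : forall n, (fst (u (S n)) = fst (u n) \/ fst (u (S n)) = fst (u n) + L * (1/2) ^ S n) /\
       (snd (u (S n)) = snd (u n) \/ snd (u (S n)) = snd (u n) + H * (1/2) ^ S n)).
  { intro n. destruct (Hstep _ _ _ (HB n)) as (x' & y' & K).
    apply (epsilon_spec (inhabits (u n))
      (fun s' : R * R => B (fst s') (snd s') (S n) /\
       (fst s' = fst (u n) \/ fst s' = fst (u n) + L * (1/2) ^ S n) /\
       (snd s' = snd (u n) \/ snd s' = snd (u n) + H * (1/2) ^ S n))).
    now exists (x', y'). }
  (* In each coordinate the left ends increase ([G]) and the right ends decrease ([D]), so the limit
     of the left ends lies in every interval. *)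
  assert (Hlim : forall (a : nat -> R) M, 0 <= M ->
    (forall n, a (S n) = a n \/ a (S n) = a n + M * (1/2) ^ S n) ->
    exists p, forall n, a n <= p <= a n + M * (1/2) ^ n).
  { intros a M HM Ha.
    assert (Hpos : forall n, 0 < (1/2) ^ n) by (intro; apply pow_lt; lra).
    assert (G : Un_growing a).
    { intro n. specialize (Hpos (S n)). destruct (Ha n) as [-> | ->]; nra. }
    assert (D : forall n m, a (n + m)%nat + M * (1/2) ^ (n + m) <= a n + M * (1/2) ^ n).
    { intros n m. induction m as [|m IH].
      - rewrite Nat.add_0_r. lra.
      - rewrite Nat.add_succ_r. specialize (Hpos (n + m)%nat).
        destruct (Ha (n + m)%nat) as [-> | ->]; simpl; nra. }
    assert (Hub : has_ub a).
    { exists (a 0%nat + M). intros x [n ->]. specialize (D 0%nat n). simpl in D.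
      specialize (Hpos n). nra. }
    destruct (growing_cv a G Hub) as [p Hp].
    exists p. intro n. split.
    - exact (growing_ineq a p G Hp n).
    - destruct (Rle_or_lt p (a n + M * (1/2) ^ n)) as [|K]; [assumption|exfalso].
      destruct (Hp (p - (a n + M * (1/2) ^ n))) as [N HN]; [lra|].
      specialize (HN (n + N)%nat ltac:(lia)). unfold Rdist in HN.
      apply Rabs_def2 in HN. specialize (D n N). specialize (Hpos (n + N)%nat). nra. }
  destruct (Hlim (fun n => fst (u n)) L HL (fun n => proj1 (HS n))) as [p Hp].
  destruct (Hlim (fun n => snd (u n)) H HH (fun n => proj2 (HS n))) as [q Hq].
  exists p, q. intro n. exists (fst (u n)), (snd (u n)). auto.
Qed.

Lemma half_pow_small (M eps : R) : 0 < eps -> exists n, M * (1/2) ^ n < eps.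
Proof.
  intros He. destruct (Rle_or_lt M 0) as [HM|HM].
  - exists 0%nat. simpl. lra.
  - destruct (pow_lt_1_zero (1/2)) with (y := eps / M) as [N HN].
    + rewrite Rabs_pos_eq; lra.
    + now apply Rdiv_lt_0_compat.
    + exists N. specialize (HN N (Nat.le_refl N)).
      rewrite Rabs_pos_eq in HN by (apply pow_le; lra).
      apply Rmult_lt_compat_l with (r := M) in HN; [|exact HM].
      replace (M * (eps / M)) with eps in HN by (field; lra). exact HN.
Qed.

(** The bisected property of a square is that every value of [phi] on [K] is equalled or exceeded at
    some point of [K] in it. If all four quarters failed, each would have a witness exceeding all
    its values; the largest of the four witnesses contradicts the property of the whole square.
    Upper semicontinuity at the limit point concludes. *)
Lemma compact_max (K : C -> Prop) (phi : C -> R) (M : R) (k : C) :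
  K k -> (forall z, K z -> Cmod z <= M) ->
  (forall z, (forall d, 0 < d -> exists w, K w /\ Cmod (w - z) < d) -> K z) ->
  (forall z eps, K z -> 0 < eps -> exists d, 0 < d /\
     forall w, K w -> Cmod (w - z) < d -> phi w < phi z + eps) ->
  exists z, K z /\ forall w, K w -> phi w <= phi z.
Proof.
  intros Kk HM Hcl Husc.
  assert (M0 : 0 <= M) by (eapply Rle_trans; [apply Cmod_ge_0|apply (HM k Kk)]).
  pose (inr := fun (v : C) x y n => x <= Re v <= x + 2 * M * (1/2) ^ n /\
                          y <= Im v <= y + 2 * M * (1/2) ^ n).
  pose (B := fun x y n => forall w, K w -> exists v, K v /\ phi w <= phi v /\ inr v x y n).
  destruct (bisection B (- M) (- M) (2 * M) (2 * M)) as (p & q & Hpq); try lra.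
  - intros w Kw. exists w. split; [exact Kw|]. split; [lra|]. unfold inr. simpl.
    assert (H1 := re_le_Cmod w). assert (H2 := Im_le_Cmod w). specialize (HM w Kw).
    apply Rabs_le_between in H1, H2. lra.
  - intros x y n HB. apply NNPP. intro N.
    assert (Hq : forall a b, (a = x \/ a = x + 2 * M * (1/2) ^ S n) ->
               (b = y \/ b = y + 2 * M * (1/2) ^ S n) ->
               exists w, K w /\ forall v, K v -> inr v a b (S n) -> phi v < phi w).
    { intros a b Ha Hb. apply NNPP. intro N'. apply N. exists a, b. split; [|now split].
      intros w Kw. apply NNPP. intro N''. apply N'. exists w. split; [exact Kw|].
      intros v Kv Hv. apply Rnot_le_lt. intro Hle. apply N''. now exists v. }
    destruct (Hq _ _ (or_introl eq_refl) (or_introl eq_refl)) as (w1 & K1 & H1).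
    destruct (Hq _ _ (or_introl eq_refl) (or_intror eq_refl)) as (w2 & K2 & H2).
    destruct (Hq _ _ (or_intror eq_refl) (or_introl eq_refl)) as (w3 & K3 & H3).
    destruct (Hq _ _ (or_intror eq_refl) (or_intror eq_refl)) as (w4 & K4 & H4).
    assert (W : exists w, K w /\ phi w1 <= phi w /\ phi w2 <= phi w /\
                               phi w3 <= phi w /\ phi w4 <= phi w).
    { destruct (Rle_or_lt (phi w1) (phi w2)) as [a|a];
      destruct (Rle_or_lt (phi w3) (phi w4)) as [b|b];
      [ destruct (Rle_or_lt (phi w2) (phi w4)); [exists w4|exists w2]
      | destruct (Rle_or_lt (phi w2) (phi w3)); [exists w3|exists w2]
      | destruct (Rle_or_lt (phi w1) (phi w4)); [exists w4|exists w1]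
      | destruct (Rle_or_lt (phi w1) (phi w3)); [exists w3|exists w1] ];
      repeat split; trivial; lra. }
    destruct W as (w & Kw & L1 & L2 & L3 & L4).
    destruct (HB w Kw) as (v & Kv & Hle & [Hx Hy]).
    assert (E : (1/2) ^ n = (1/2) ^ S n + (1/2) ^ S n) by (simpl; lra).
    rewrite E in Hx, Hy. unfold inr in *.
    destruct (Rle_or_lt (Re v) (x + 2 * M * (1/2) ^ S n)) as [a|a];
    destruct (Rle_or_lt (Im v) (y + 2 * M * (1/2) ^ S n)) as [b|b].
    + specialize (H1 v Kv). lra.
    + specialize (H2 v Kv). lra.
    + specialize (H3 v Kv). lra.
    + specialize (H4 v Kv). lra.
  - assert (Hnear : forall d, 0 < d -> forall w, K w ->
        exists v, K v /\ phi w <= phi v /\ Cmod (v - (p, q)) < d).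
    { intros d Hd w Kw. destruct (half_pow_small (4 * M) d Hd) as [n Hn].
      destruct (Hpq n) as (x & y & HB & Hp & Hq).
      destruct (HB w Kw) as (v & Kv & Hle & Hx & Hy). exists v. split; [exact Kv|].
      split; [exact Hle|]. eapply Rle_lt_trans; [apply Cmod_le_Re_Im|].
      eapply Rle_lt_trans; [|exact Hn]. unfold Re, Im in *. simpl.
      assert (Rabs (fst v + - p) <= 2 * M * (1/2) ^ n) by (apply Rabs_le; lra).
      assert (Rabs (snd v + - q) <= 2 * M * (1/2) ^ n) by (apply Rabs_le; lra).
      lra. }
    assert (Kpq : K (p, q)).
    { apply Hcl. intros d Hd. destruct (Hnear d Hd k Kk) as (v & Kv & _ & Hv). now exists v. }
    exists (p, q). split; [exact Kpq|].
    intros w Kw. apply Rnot_lt_le. intro Hlt.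
    destruct (Husc _ (phi w - phi (p, q)) Kpq) as (d & Hd & Hd'); [lra|].
    destruct (Hnear d Hd w Kw) as (v & Kv & Hle & Hv).
    specialize (Hd' v Kv Hv). lra.
Qed.

(** Connectedness of [0,1], in the form that carries a property along a segment: the supremum of the
    initial stretch on which [Q] holds belongs to it by closedness, and is 1 by openness. *)
Lemma clopen_interval (Q : R -> Prop) :
  Q 0 ->
  (forall t, 0 <= t <= 1 -> Q t -> exists d, 0 < d /\
     forall s, 0 <= s <= 1 -> Rabs (s - t) < d -> Q s) ->
  (forall t, 0 <= t <= 1 ->
     (forall d, 0 < d -> exists s, 0 <= s <= 1 /\ Rabs (s - t) < d /\ Q s) -> Q t) ->
  Q 1.
Proof.
  intros Q0 Hop Hcl.
  pose (E := fun t => 0 <= t <= 1 /\ forall s, 0 <= s <= t -> Q s).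
  destruct (completeness E) as [m [Hub Hlub]].
  - exists 1. intros t [Ht _]. lra.
  - exists 0. split; [lra|]. intros s Hs. now replace s with 0 by lra.
  - assert (E0 : E 0) by (split; [lra|]; intros s Hs; now replace s with 0 by lra).
    assert (m01 : 0 <= m <= 1).
    { split; [now apply Hub|]. apply Hlub. intros t [Ht _]. lra. }
    assert (below : forall s, 0 <= s < m -> Q s).
    { intros s Hs. apply NNPP. intro N.
      assert (is_upper_bound E s).
      { intros t [Ht Ht']. apply Rnot_lt_le. intro K. apply N, Ht'. lra. }
      specialize (Hlub s H). lra. }
    assert (Qm : Q m).
    { apply Hcl; [exact m01|]. intros d Hd.
      destruct (Req_dec m 0) as [->|Nm].
      - exists 0. split; [lra|]. split; [|exact Q0]. rewrite Rminus_0_r, Rabs_R0. exact Hd.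
      - exists (Rmax 0 (m - d / 2)). assert (Rmax 0 (m - d/2) < m) by (apply Rmax_lub_lt; lra).
        assert (A1 := Rmax_l 0 (m - d/2)). assert (A2 := Rmax_r 0 (m - d/2)).
        split; [lra|]. split; [|apply below; lra].
        apply Rabs_lt_between. lra. }
    destruct (Hop m m01 Qm) as (d & Hd & K).
    assert (Em : E (Rmin 1 (m + d / 2))).
    { split.
      - split; [apply Rmin_glb; lra|apply Rmin_l].
      - intros s Hs. assert (A1 := Rmin_l 1 (m + d/2)). assert (A2 := Rmin_r 1 (m + d/2)).
        destruct (Rlt_or_le s m) as [Hlt|Hle]; [apply below; lra|].
        apply K; [lra|]. apply Rabs_lt_between. lra. }
    specialize (Hub _ Em).
    destruct (Rle_or_lt 1 m) as [|Hlt].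
    + now replace 1 with m by lra.
    + exfalso. unfold Rmin in Hub. destruct (Rle_dec 1 (m + d/2)); lra.
Qed.

(** * Mean value inequality along segments *)

Lemma cderiv_along_segment (f : C -> C) (z h l : C) (t : R) :
  cderiv f (z + RtoC t * h)%C l ->
  is_derive (fun s : R => Re (f (z + RtoC s * h)%C)) t (Re (h * l)) /\
  is_derive (fun s : R => Im (f (z + RtoC s * h)%C)) t (Im (h * l)).
Proof.
  intro Hf. rewrite cderiv_eps in Hf.
  assert (Key : forall eps, 0 < eps -> exists d, 0 < d /\ forall s, Rabs (s - t) < d ->
    Cmod (f (z + RtoC s * h)%C - f (z + RtoC t * h)%C - RtoC (s - t) * (h * l)) <= eps * Rabs (s - t)).
  { intros eps He.
    (* The summand 1 allows for [h = 0]. *)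
    assert (Hh : 0 < Cmod h + 1) by (assert (K := Cmod_ge_0 h); lra).
    destruct (Hf (eps / (Cmod h + 1))) as (d & Hd & K); [now apply Rdiv_lt_0_compat|].
    exists (d / (Cmod h + 1)). split; [now apply Rdiv_lt_0_compat|]. intros s Hs.
    assert (E : (z + RtoC s * h - (z + RtoC t * h))%C = (RtoC (s - t) * h)%C)
      by (rewrite RtoC_minus; ring).
    specialize (K (z + RtoC s * h)%C). rewrite E in K.
    replace (RtoC (s - t) * h * l)%C with (RtoC (s - t) * (h * l))%C in K by ring.
    assert (HA := Rabs_pos (s - t)). assert (HC := Cmod_ge_0 h).
    rewrite Cmod_mult, Cmod_R in K. eapply Rle_trans; [apply K|].
    - apply Rmult_lt_compat_r with (r := Cmod h + 1) in Hs; [|exact Hh].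
      unfold Rdiv in Hs. rewrite Rmult_assoc, Rinv_l in Hs by lra. nra.
    - unfold Rdiv. assert (0 < / (Cmod h + 1)) by now apply Rinv_0_lt_compat.
      assert (/ (Cmod h + 1) * Cmod h <= 1).
      { apply Rmult_le_reg_l with (Cmod h + 1); [exact Hh|]. rewrite <- Rmult_assoc, Rinv_r by lra. lra. }
      replace (eps * / (Cmod h + 1) * (Rabs (s - t) * Cmod h))
        with (eps * Rabs (s - t) * (/ (Cmod h + 1) * Cmod h)) by ring.
      rewrite <- (Rmult_1_r (eps * Rabs (s - t))) at 2. apply Rmult_le_compat_l; nra. }
  split; (split; [apply is_linear_scal_l|]); intros x Hx eps;
    (assert (x = t) as -> by
      (symmetry; apply (@is_filter_lim_locally_unique R_AbsRing (AbsRing_NormedModule R_AbsRing)), Hx));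
    destruct (Key eps (cond_pos eps)) as (d & Hd & K);
    exists (mkposreal d Hd); intros s Hs; specialize (K s Hs);
    (eapply Rle_trans; [|exact K]).
  - eapply Rle_trans; [|apply re_le_Cmod]. apply Req_le.
    set (a := f (z + RtoC s * h)%C). set (b := f (z + RtoC t * h)%C). set (c := (h * l)%C).
    change (Rabs (Re a - Re b - (s - t) * Re c) = Rabs (Re (a - b - RtoC (s - t) * c))).
    f_equal. unfold Re, Im. simpl. ring.
  - eapply Rle_trans; [|apply Im_le_Cmod]. apply Req_le.
    set (a := f (z + RtoC s * h)%C). set (b := f (z + RtoC t * h)%C). set (c := (h * l)%C).
    change (Rabs (Im a - Im b - (s - t) * Im c) = Rabs (Im (a - b - RtoC (s - t) * c))).
    f_equal. unfold Re, Im. simpl. ring.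
Qed.

Lemma increment_bound (u du : R -> R) (D : R) :
  (forall t, 0 <= t <= 1 -> is_derive u t (du t) /\ Rabs (du t) <= D) ->
  Rabs (u 1 - u 0) <= D.
Proof.
  intros H. destruct (MVT_gen u 0 1 du) as (c & Hc & E).
  - rewrite Rmin_left, Rmax_right by lra. intros x Hx. apply H. lra.
  - rewrite Rmin_left, Rmax_right by lra. intros x Hx.
    apply continuity_pt_filterlim, (@ex_derive_continuous R_AbsRing R_NormedModule).
    exists (du x). now apply H.
  - rewrite Rmin_left, Rmax_right in Hc by lra.
    rewrite E, Rminus_0_r, Rmult_1_r. now apply H.
Qed.

(** The real mean value theorem is applied to the real and the imaginary part separately; this costs
    the factor 2, which is harmless in the estimates below. *)
Lemma mean_value_ineq (f f1 : C -> C) (z w : C) (D : R) :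
  (forall t, 0 <= t <= 1 -> cderiv f (z + RtoC t * (w - z))%C (f1 (z + RtoC t * (w - z))%C) /\
     Cmod (f1 (z + RtoC t * (w - z))%C) <= D) ->
  Cmod (f w - f z) <= 2 * D * Cmod (w - z).
Proof.
  intros H. eapply Rle_trans; [apply Cmod_le_Re_Im|].
  assert (E0 : (z + RtoC 0 * (w - z))%C = z) by ring.
  assert (E1 : (z + RtoC 1 * (w - z))%C = w) by ring.
  assert (HD : forall t, 0 <= t <= 1 ->
    Cmod ((w - z) * f1 (z + RtoC t * (w - z))%C) <= D * Cmod (w - z)).
  { intros t Ht. rewrite Cmod_mult, Rmult_comm.
    apply Rmult_le_compat_r; [apply Cmod_ge_0|apply H, Ht]. }
  assert (H1 := increment_bound (fun s => Re (f (z + RtoC s * (w - z))%C))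
       (fun t => Re ((w - z) * f1 (z + RtoC t * (w - z))%C)) (D * Cmod (w - z))).
  assert (H2 := increment_bound (fun s => Im (f (z + RtoC s * (w - z))%C))
       (fun t => Im ((w - z) * f1 (z + RtoC t * (w - z))%C)) (D * Cmod (w - z))).
  cbv beta in H1, H2. rewrite E0, E1 in H1, H2.
  change (Re (f w - f z)) with (Re (f w) - Re (f z)).
  change (Im (f w - f z)) with (Im (f w) - Im (f z)).
  assert (K1 : Rabs (Re (f w) - Re (f z)) <= D * Cmod (w - z)).
  { apply H1. intros t Ht. split.
    - exact (proj1 (cderiv_along_segment f z (w - z) _ t (proj1 (H t Ht)))).
    - eapply Rle_trans; [apply re_le_Cmod|now apply HD]. }
  assert (K2 : Rabs (Im (f w) - Im (f z)) <= D * Cmod (w - z)).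
  { apply H2. intros t Ht. split.
    - exact (proj2 (cderiv_along_segment f z (w - z) _ t (proj1 (H t Ht)))).
    - eapply Rle_trans; [apply Im_le_Cmod|now apply HD]. }
  lra.
Qed.

Lemma cderiv_zero_const (f : C -> C) (z w : C) :
  (forall t, 0 <= t <= 1 -> cderiv f (z + RtoC t * (w - z))%C 0) -> f w = f z.
Proof.
  intros H. assert (K := mean_value_ineq f (fun _ => RtoC 0) z w 0).
  assert (E : (f w - f z)%C = 0%C).
  { apply Cmod_eq_0. assert (K1 := Cmod_ge_0 (f w - f z)).
    assert (Cmod (f w - f z) <= 2 * 0 * Cmod (w - z)).
    { apply K. intros t Ht. split; [now apply H|]. rewrite Cmod_0. lra. }
    lra. }
  replace (f w) with (f z + (f w - f z))%C by ring. rewrite E. ring.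
Qed.

(** * Goursat's theorem *)

(** Taken componentwise, as in [seg_int], so that the two are convertible in [cderiv_seg_int]. *)
Definition CInt (g : R -> C) (a b : R) : C :=
  (RInt (fun t => Re (g t)) a b, RInt (fun t => Im (g t)) a b).

Definition cont_on (g : R -> C) (a b : R) : Prop := forall t, a <= t <= b -> cont g t.

Lemma cont_on_ex_RInt (g : R -> C) (a b : R) : a <= b -> cont_on g a b ->
  ex_RInt (fun t => Re (g t)) a b /\ ex_RInt (fun t => Im (g t)) a b.
Proof.
  intros Hab H; split; apply (@ex_RInt_continuous R_CompleteNormedModule);
    rewrite Rmin_left, Rmax_right by lra; intros t Ht; apply H, cont_iff in Ht; apply Ht.
Qed.

Lemma CInt_ext (f g : R -> C) (a b : R) : a <= b ->
  (forall t, a <= t <= b -> f t = g t) -> CInt f a b = CInt g a b.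
Proof.
  intros Hab H. apply injective_projections; simpl; apply RInt_ext;
    rewrite Rmin_left, Rmax_right by lra; intros t Ht; rewrite H; trivial; lra.
Qed.

Lemma CInt_plus (f g : R -> C) (a b : R) : a <= b -> cont_on f a b -> cont_on g a b ->
  CInt (fun t => f t + g t)%C a b = (CInt f a b + CInt g a b)%C.
Proof.
  intros Hab Hf Hg. apply cont_on_ex_RInt in Hf, Hg; trivial. destruct Hf, Hg.
  apply injective_projections; simpl;
    apply (@RInt_plus R_CompleteNormedModule); assumption.
Qed.

Lemma CInt_scal (c : C) (g : R -> C) (a b : R) : a <= b -> cont_on g a b ->
  CInt (fun t => c * g t)%C a b = (c * CInt g a b)%C.
Proof.
  intros Hab Hg. apply cont_on_ex_RInt in Hg; trivial. destruct Hg as [H1 H2].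
  assert (S : forall k u, ex_RInt u a b -> ex_RInt (fun t => k * u t) a b)
    by (intros k u; apply (@ex_RInt_scal R_NormedModule)).
  assert (E : forall k u, ex_RInt u a b -> RInt (fun t => k * u t) a b = k * RInt u a b)
    by (intros k u; apply (@RInt_scal R_CompleteNormedModule)).
  apply injective_projections; simpl; rewrite <- !E by assumption.
  - apply (@RInt_minus R_CompleteNormedModule (fun t => fst c * Re (g t)) (fun t => snd c * Im (g t)));
      now apply S.
  - apply (@RInt_plus R_CompleteNormedModule (fun t => fst c * Im (g t)) (fun t => snd c * Re (g t)));
      now apply S.
Qed.

Lemma CInt_const (c : C) (a b : R) : CInt (fun _ => c) a b = (RtoC (b - a) * c)%C.
Proof.
  unfold CInt. rewrite !RInt_const. apply injective_projections; simpl;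
  unfold scal; simpl; unfold mult; simpl; unfold Re, Im; ring.
Qed.

Lemma CInt_Chasles (g : R -> C) (a b c : R) : a <= b <= c -> cont_on g a c ->
  CInt g a c = (CInt g a b + CInt g b c)%C.
Proof.
  intros Habc H.
  destruct (cont_on_ex_RInt g a b) as [A1 A2]; [lra|intros t Ht; apply H; lra|].
  destruct (cont_on_ex_RInt g b c) as [B1 B2]; [lra|intros t Ht; apply H; lra|].
  apply injective_projections; simpl; symmetry;
    apply (@RInt_Chasles R_CompleteNormedModule); assumption.
Qed.

Lemma CInt_bound (g : R -> C) (a b M : R) : a <= b -> cont_on g a b ->
  (forall t, a <= t <= b -> Cmod (g t) <= M) -> Cmod (CInt g a b) <= 2 * M * (b - a).
Proof.
  intros Hab Hg HM. apply cont_on_ex_RInt in Hg; trivial. destruct Hg as [H1 H2].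
  eapply Rle_trans; [apply Cmod_le_Re_Im|]. simpl.
  assert (Rabs (RInt (fun t => Re (g t)) a b) <= (b - a) * M).
  { apply abs_RInt_le_const; trivial. intros t Ht.
    eapply Rle_trans; [apply re_le_Cmod|auto]. }
  assert (Rabs (RInt (fun t => Im (g t)) a b) <= (b - a) * M).
  { apply abs_RInt_le_const; trivial. intros t Ht.
    eapply Rle_trans; [apply Im_le_Cmod|auto]. }
  lra.
Qed.

Lemma CInt_minus (f g : R -> C) (a b : R) : a <= b -> cont_on f a b -> cont_on g a b ->
  CInt (fun t => f t - g t)%C a b = (CInt f a b - CInt g a b)%C.
Proof.
  intros Hab Hf Hg.
  transitivity (CInt (fun t => f t + (- (1)) * g t)%C a b).
  { apply CInt_ext; trivial. intros; ring. }
  rewrite CInt_plus; trivial.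
  - rewrite CInt_scal; trivial. ring.
  - intros t Ht. apply cont_mult; [apply cont_const|now apply Hg].
Qed.

Lemma cont_hor (y t : R) : cont (fun t : R => (t, y) : C) t.
Proof. apply cont_iff; split; simpl; [apply continuous_id|apply continuous_const]. Qed.

Lemma cont_ver (x t : R) : cont (fun t : R => (x, t) : C) t.
Proof. apply cont_iff; split; simpl; [apply continuous_const|apply continuous_id]. Qed.

(* The integral of [g] along the boundary of [x,x+l] x [y,y+h], opposite sides being paired. *)
Definition rect_int (g : C -> C) (x y l h : R) : C :=
  (CInt (fun t => g (t, y) - g (t, y + h)%R) x (x + l)
   + Ci * CInt (fun t => g (x + l, t)%R - g (x, t)) y (y + h))%C.

Definition in_rect (x y l h : R) (z : C) : Prop :=
  x <= Re z <= x + l /\ y <= Im z <= y + h.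

(** Each inner edge is traversed twice in opposite directions. Once the outer sides are cut at their
    midpoints, the cancellation is an identity for [ring]. *)
Lemma rect_int_split (g : C -> C) (x y l h : R) : 0 <= l -> 0 <= h ->
  (forall z, in_rect x y (l + l) (h + h) z -> @cont C_UniformSpace g z) ->
  rect_int g x y (l + l) (h + h) =
  (rect_int g x y l h + rect_int g (x + l) y l h
   + rect_int g x (y + h) l h + rect_int g (x + l) (y + h) l h)%C.
Proof.
  intros Hl Hh Hg.
  assert (Hor : forall v a b, y <= v <= y + (h + h) -> x <= a -> b <= x + (l + l) ->
            cont_on (fun t => g (t, v)) a b).
  { intros v a b Hv Ha Hb t Ht. apply (cont_comp (fun t => (t, v) : C)); [apply cont_hor|].
    apply Hg. unfold in_rect; simpl; lra. }
  assert (Ver : forall v a b, x <= v <= x + (l + l) -> y <= a -> b <= y + (h + h) ->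
            cont_on (fun t => g (v, t)) a b).
  { intros v a b Hv Ha Hb t Ht. apply (cont_comp (fun t => (v, t) : C)); [apply cont_ver|].
    apply Hg. unfold in_rect; simpl; lra. }
  unfold rect_int.
  rewrite !(CInt_minus (fun t => g (t, _))) by (first [lra | apply Hor; lra]).
  rewrite !(CInt_minus (fun t => g (_, t))) by (first [lra | apply Ver; lra]).
  replace (x + (l + l)) with (x + l + l) by ring.
  replace (y + (h + h)) with (y + h + h) by ring.
  rewrite !(CInt_Chasles (fun t => g (t, _)) x (x + l) (x + l + l)) by (first [lra | apply Hor; lra]).
  rewrite !(CInt_Chasles (fun t => g (_, t)) y (y + h) (y + h + h)) by (first [lra | apply Ver; lra]).
  ring.
Qed.

(** Only the remainder [e] of the affine approximation counts. The affine part changes by -i h b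
    between the horizontal sides and by l b between the vertical ones, and these integrate to -i h l
    b and i l h b. On the rectangle [e] is at most eps (l + h); the pairing of sides and
    [CInt_bound] each contribute a factor 2. *)
Lemma rect_int_small (g : C -> C) (x y l h : R) (p a b : C) (eps : R) :
  0 <= l -> 0 <= h -> 0 <= eps -> in_rect x y l h p ->
  (forall z, in_rect x y l h z -> @cont C_UniformSpace g z) ->
  (forall z, in_rect x y l h z -> Cmod (g z - a - (z - p) * b) <= eps * Cmod (z - p)) ->
  Cmod (rect_int g x y l h) <= 4 * eps * (l + h) ^ 2.
Proof.
  intros Hl Hh He Hp Hc Hg.
  assert (Hd : forall z, in_rect x y l h z -> Cmod (g z - a - (z - p) * b) <= eps * (l + h)).
  { intros z Hz. eapply Rle_trans; [now apply Hg|]. apply Rmult_le_compat_l; [exact He|].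
    eapply Rle_trans; [apply Cmod_le_Re_Im|]. destruct Hz as [Z1 Z2], Hp as [P1 P2].
    unfold Re, Im in *. simpl.
    assert (Rabs (fst z + - fst p) <= l) by (apply Rabs_le; lra).
    assert (Rabs (snd z + - snd p) <= h) by (apply Rabs_le; lra). lra. }
  set (e := fun z => (g z - a - (z - p) * b)%C) in *.
  assert (Ce : forall z, in_rect x y l h z -> @cont C_UniformSpace e z).
  { intros z Hz. unfold e. apply cont_minus; [apply cont_minus|].
    - now apply Hc. - apply cont_const.
    - apply cont_mult; [apply cont_minus; [apply cont_id|]|]; apply cont_const. }
  assert (Hor : forall v, y <= v <= y + h -> cont_on (fun t => e (t, v)) x (x + l)).
  { intros v Hv t Ht. apply (cont_comp (fun t => (t, v) : C)); [apply cont_hor|].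
    apply Ce. unfold in_rect; simpl; lra. }
  assert (Ver : forall v, x <= v <= x + l -> cont_on (fun t => e (v, t)) y (y + h)).
  { intros v Hv t Ht. apply (cont_comp (fun t => (v, t) : C)); [apply cont_ver|].
    apply Ce. unfold in_rect; simpl; lra. }
  assert (E : rect_int g x y l h =
    (CInt (fun t => e (t, y) - e (t, y + h)%R) x (x + l)
     + Ci * CInt (fun t => e (x + l, t)%R - e (x, t)) y (y + h))%C).
  { unfold rect_int.
    rewrite (CInt_ext (fun t => g (t, y) - g (t, y + h)%R)%C
               (fun t => (e (t, y) - e (t, y + h)%R) + - (Ci * RtoC h * b))%C); [|lra|].
    2:{ intros t Ht. unfold e.
        replace ((t, y + h)%R : C) with (((t, y) : C) + Ci * RtoC h)%C
          by (apply injective_projections; simpl; ring). ring. }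
    rewrite (CInt_ext (fun t => g (x + l, t)%R - g (x, t))%C
               (fun t => (e (x + l, t)%R - e (x, t)) + RtoC l * b)%C); [|lra|].
    2:{ intros t Ht. unfold e.
        replace ((x + l, t)%R : C) with (((x, t) : C) + RtoC l)%C
          by (apply injective_projections; simpl; ring). ring. }
    rewrite (CInt_plus (fun t => e (t, y) - e (t, y + h)%R)%C), (CInt_plus (fun t => e (x + l, t)%R - e (x, t))%C), !CInt_const.
    - replace (x + l - x) with l by ring. replace (y + h - y) with h by ring. ring.
    - lra.
    - intros t Ht; apply cont_minus; apply Ver; lra.
    - intros t Ht; apply cont_const.
    - lra.
    - intros t Ht; apply cont_minus; apply Hor; lra.
    - intros t Ht; apply cont_const. }
  rewrite E. eapply Rle_trans; [apply Cmod_triangle|]. rewrite Cmod_mult, Cmod_Ci.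
  assert (B1 : Cmod (CInt (fun t => e (t, y) - e (t, y + h)%R)%C x (x + l)) <= 2 * (2 * eps * (l + h)) * (x + l - x)).
  { apply CInt_bound; [lra| |].
    - intros t Ht; apply cont_minus; apply Hor; lra.
    - intros t Ht. unfold Cminus. eapply Rle_trans; [apply Cmod_triangle|]. rewrite Cmod_opp.
      assert (Cmod (e (t, y)) <= eps * (l + h)) by (apply Hd; unfold in_rect; simpl; lra).
      assert (Cmod (e (t, y + h)) <= eps * (l + h)) by (apply Hd; unfold in_rect; simpl; lra).
      lra. }
  assert (B2 : Cmod (CInt (fun t => e (x + l, t)%R - e (x, t))%C y (y + h)) <= 2 * (2 * eps * (l + h)) * (y + h - y)).
  { apply CInt_bound; [lra| |].
    - intros t Ht; apply cont_minus; apply Ver; lra.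
    - intros t Ht. unfold Cminus. eapply Rle_trans; [apply Cmod_triangle|]. rewrite Cmod_opp.
      assert (Cmod (e (x + l, t)) <= eps * (l + h)) by (apply Hd; unfold in_rect; simpl; lra).
      assert (Cmod (e (x, t)) <= eps * (l + h)) by (apply Hd; unfold in_rect; simpl; lra).
      lra. }
  nra.
Qed.

Lemma goursat (g : C -> C) (x y l h : R) : 0 <= l -> 0 <= h ->
  (forall z, in_rect x y l h z -> exists m, cderiv g z m) -> rect_int g x y l h = 0%C.
Proof.
  intros Hl Hh Hg. apply Cmod_eq_0, Rle_antisym; [|apply Cmod_ge_0].
  apply Rnot_lt_le. intro Hpos. set (K := Cmod (rect_int g x y l h)) in *.
  pose (s := fun n => (1/2) ^ n).
  assert (s_pos : forall n, 0 < s n) by (intro n; apply pow_lt; lra).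
  assert (s_S : forall n, s n = s (S n) + s (S n)) by (intro n; unfold s; simpl; lra).
  (* Some quarter carries at least a quarter of the integral while the sides are halved, so the
     integral at stage n is at least K s_n^2. Near a point of differentiability it is smaller than
     any fixed multiple of s_n^2. *)
  pose (B := fun x' y' n => x <= x' /\ x' + l * s n <= x + l /\ y <= y' /\ y' + h * s n <= y + h /\
     K * s n ^ 2 <= Cmod (rect_int g x' y' (l * s n) (h * s n))).
  assert (Hc : forall z, in_rect x y l h z -> @cont C_UniformSpace g z).
  { intros z Hz. destruct (Hg z Hz) as [m Hm]. exact (cderiv_cont _ _ _ Hm). }
  destruct (bisection B x y l h Hl Hh) as (p & q & Hpq).
  - unfold B, s. simpl. rewrite !Rmult_1_r. fold K. lra.
  - intros x' y' n (H1 & H2 & H3 & H4 & H5).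
    assert (Hs := s_pos (S n)).
    rewrite (s_S n), !Rmult_plus_distr_l in H5.
    rewrite rect_int_split in H5.
    + apply NNPP. intro N.
      assert (Hq : forall a b, (a = x' \/ a = x' + l * (1/2) ^ S n) ->
               (b = y' \/ b = y' + h * (1/2) ^ S n) ->
               Cmod (rect_int g a b (l * s (S n)) (h * s (S n))) < K * s (S n) ^ 2).
      { intros a b Ha Hb. apply Rnot_le_lt. intro N'. apply N. exists a, b.
        split; [|now split]. unfold B. 
        rewrite (s_S n) in H2, H4. fold (s (S n)) in Ha, Hb.
        assert (0 <= l * s (S n)) by nra. assert (0 <= h * s (S n)) by nra.
        repeat split; try exact N'; destruct Ha as [-> | ->], Hb as [-> | ->]; lra. }
      assert (Q1 := Hq _ _ (or_introl eq_refl) (or_introl eq_refl)).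
      assert (Q2 := Hq _ _ (or_introl eq_refl) (or_intror eq_refl)).
      assert (Q3 := Hq _ _ (or_intror eq_refl) (or_introl eq_refl)).
      assert (Q4 := Hq _ _ (or_intror eq_refl) (or_intror eq_refl)).
      fold (s (S n)) in *.
      set (r1 := rect_int g x' y' (l * s (S n)) (h * s (S n))) in *.
      set (r2 := rect_int g x' (y' + h * s (S n)) (l * s (S n)) (h * s (S n))) in *.
      set (r3 := rect_int g (x' + l * s (S n)) y' (l * s (S n)) (h * s (S n))) in *.
      set (r4 := rect_int g (x' + l * s (S n)) (y' + h * s (S n)) (l * s (S n)) (h * s (S n))) in *.
      assert (T1 := Cmod_triangle (r1 + r3 + r2) r4).
      assert (T2 := Cmod_triangle (r1 + r3) r2).
      assert (T3 := Cmod_triangle r1 r3). nra.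
    + nra.
    + nra.
    + intros z [Z1 Z2]. apply Hc. unfold in_rect.
      rewrite (s_S n) in H2, H4. lra.
  - assert (Hin : in_rect x y l h (p, q)).
    { destruct (Hpq 0%nat) as (x' & y' & (H1 & H2 & H3 & H4 & _) & Hp & Hq).
      unfold in_rect. unfold s in *. simpl in *. lra. }
    destruct (Hg _ Hin) as [m Hm]. rewrite cderiv_eps in Hm.
    (* With this tolerance [rect_int_small] gives less than K s_n^2 / 2. The summand 1 keeps the
       denominator positive for a degenerate rectangle. *)
    assert (Hden : 0 < 8 * (l + h + 1) ^ 2) by nra.
    destruct (Hm (K / (8 * (l + h + 1) ^ 2))) as (d & Hd & Hm').
    { now apply Rdiv_lt_0_compat. }
    destruct (half_pow_small (l + h) d Hd) as [n Hn]. fold (s n) in Hn.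
    destruct (Hpq n) as (x' & y' & (H1 & H2 & H3 & H4 & H5) & Hp & Hq).
    fold (s n) in Hp, Hq. assert (Hs := s_pos n).
    assert (Hb := rect_int_small g x' y' (l * s n) (h * s n) (p, q) (g (p, q)) m (K / (8 * (l + h + 1) ^ 2))).
    assert (Hle : 0 < K / (8 * (l + h + 1) ^ 2)) by now apply Rdiv_lt_0_compat.
    assert (F : Cmod (rect_int g x' y' (l * s n) (h * s n)) <=
        4 * (K / (8 * (l + h + 1) ^ 2)) * (l * s n + h * s n) ^ 2).
    { apply Hb; try nra.
      - unfold in_rect; simpl. lra.
      - intros z [Z1 Z2]. apply Hc. unfold in_rect. lra.
      - intros z [Z1 Z2]. apply Hm'.
        eapply Rle_lt_trans; [apply Cmod_le_Re_Im|]. eapply Rle_lt_trans; [|exact Hn].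
        unfold Re, Im in *. simpl.
        assert (Rabs (fst z + - p) <= l * s n) by (apply Rabs_le; lra).
        assert (Rabs (snd z + - q) <= h * s n) by (apply Rabs_le; lra). lra. }
    assert (Hfin : 4 * (K / (8 * (l + h + 1) ^ 2)) * (l * s n + h * s n) ^ 2 < K * s n ^ 2).
    { replace (4 * (K / (8 * (l + h + 1) ^ 2)) * (l * s n + h * s n) ^ 2)
        with (K * s n ^ 2 * ((l + h) ^ 2 / (2 * (l + h + 1) ^ 2))) by (field; lra).
      rewrite <- (Rmult_1_r (K * s n ^ 2)) at 2. apply Rmult_lt_compat_l.
      { apply Rmult_lt_0_compat; [exact Hpos|now apply pow_lt]. }
      apply Rmult_lt_reg_r with (2 * (l + h + 1) ^ 2); [nra|].
      unfold Rdiv. rewrite Rmult_assoc, Rinv_l by nra. nra. }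
    lra.
Qed.

(** * The mean value property *)

Definition cis (t : R) : C := (cos t, sin t).

(** Built from the real functions and independent of the series [csin] and [ccos]; it serves to
    unroll annuli into rectangles. *)
Definition cexp (w : C) : C := (RtoC (exp (Re w)) * cis (Im w))%C.

Lemma Cmod_cis (t : R) : Cmod (cis t) = 1.
Proof.
  unfold Cmod, cis. simpl. replace (cos t * (cos t * 1) + sin t * (sin t * 1)) with 1.
  - apply sqrt_1.
  - assert (H := sin2_cos2 t). unfold Rsqr in H. lra.
Qed.

Lemma Cmod_cexp (w : C) : Cmod (cexp w) = exp (Re w).
Proof.
  unfold cexp. rewrite Cmod_mult, Cmod_cis, Cmod_R, Rabs_pos_eq; [ring|].
  left. apply exp_pos.
Qed.

Lemma cexp_plus (z w : C) : cexp (z + w) = (cexp z * cexp w)%C.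
Proof.
  unfold cexp, cis. simpl. rewrite exp_plus, cos_plus, sin_plus.
  apply injective_projections; simpl; unfold Re, Im; ring.
Qed.

Lemma derivable_pt_lim_remainder (u : R -> R) (l eps : R) :
  derivable_pt_lim u 0 l -> 0 < eps ->
  exists d, 0 < d /\ forall h, Rabs h < d -> Rabs (u h - u 0 - l * h) <= eps * Rabs h.
Proof.
  intros H He. destruct (H eps He) as [d Hd]. exists d. split; [apply cond_pos|].
  intros h Hh. destruct (Req_dec h 0) as [->|N].
  - replace (u 0 - u 0 - l * 0) with 0 by ring. rewrite Rabs_R0. lra.
  - specialize (Hd h N Hh). rewrite Rplus_0_l in Hd.
    replace (u h - u 0 - l * h) with (((u h - u 0) / h - l) * h) by (field; exact N).
    rewrite Rabs_mult. apply Rmult_le_compat_r; [apply Rabs_pos|lra].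
Qed.

(** The functional equation reduces the claim to the point 0, where the first-order remainders of
    the real [exp], [cos] and [sin] suffice. *)
Lemma cderiv_cexp (w : C) : cderiv cexp w (cexp w).
Proof.
  assert (H0 : cderiv cexp 0 1).
  { apply cderiv_eps. intros eps He.
    (* The error terms below add up to at most 7 e |h|, so 10 leaves room; e <= 1/10 also keeps
       [exp x] below 2. *)
    set (e := Rmin 1 eps / 10).
    assert (He' : 0 < e) by (unfold e; assert (0 < Rmin 1 eps) by (apply Rmin_glb_lt; lra); lra).
    assert (He1 : e <= 1/10) by (unfold e; assert (K := Rmin_l 1 eps); lra).
    assert (He2 : 10 * e <= eps) by (unfold e; assert (K := Rmin_r 1 eps); lra).
    destruct (derivable_pt_lim_remainder exp 1 e) as (d1 & Hd1 & K1); trivial.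
    { apply derivable_pt_lim_exp_0. }
    destruct (derivable_pt_lim_remainder cos (- sin 0) e) as (d2 & Hd2 & K2); trivial.
    { apply derivable_pt_lim_cos. }
    destruct (derivable_pt_lim_remainder sin (cos 0) e) as (d3 & Hd3 & K3); trivial.
    { apply derivable_pt_lim_sin. }
    rewrite exp_0 in K1. rewrite sin_0, cos_0 in K2. rewrite sin_0, cos_0 in K3.
    exists (Rmin (Rmin d1 d2) (Rmin d3 e)). split.
    { repeat apply Rmin_glb_lt; assumption. }
    intros h Hh. replace (h - 0)%C with h in * by ring.
    assert (Hx := re_le_Cmod h). assert (Hy := Im_le_Cmod h).
    set (x := Re h) in *. set (y := Im h) in *.
    assert (M1 := Rmin_l (Rmin d1 d2) (Rmin d3 e)). assert (M2 := Rmin_r (Rmin d1 d2) (Rmin d3 e)).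
    assert (M3 := Rmin_l d1 d2). assert (M4 := Rmin_r d1 d2).
    assert (M5 := Rmin_l d3 e). assert (M6 := Rmin_r d3 e).
    specialize (K1 x ltac:(lra)). specialize (K2 y ltac:(lra)). specialize (K3 y ltac:(lra)).
    assert (E : (cexp h - cexp 0 - h * 1)%C =
       (exp x * cos y - 1 - x, exp x * sin y - y)).
    { unfold cexp, cis. replace (Re 0) with 0 by reflexivity. replace (Im 0) with 0 by reflexivity.
      rewrite exp_0, cos_0, sin_0. apply injective_projections; unfold x, y, Re, Im; simpl; ring. }
    rewrite E. eapply Rle_trans; [apply Cmod_le_Re_Im|]. simpl.
    replace (exp x * cos y - 1 - x) with ((exp x - 1 - 1 * x) + exp x * (cos y - 1 - - 0 * y)) by ring.
    replace (exp x * sin y - y) with (exp x * (sin y - 0 - 1 * y) + (exp x - 1) * y) by ring.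
    assert (Px := Rabs_pos x). assert (Py := Rabs_pos y).
    assert (X1 : Rabs (exp x - 1) <= 2 * e).
    { replace (exp x - 1) with ((exp x - 1 - 1 * x) + x) by ring.
      eapply Rle_trans; [apply Rabs_triang|]. nra. }
    assert (X2 : 0 < exp x <= 2).
    { split; [apply exp_pos|]. apply Rabs_le_between in X1. lra. }
    eapply Rle_trans; [apply Rplus_le_compat; apply Rabs_triang|].
    rewrite !Rabs_mult, (Rabs_pos_eq (exp x)) by lra.
    assert (P2 := Rabs_pos (cos y - 1 - - 0 * y)). assert (P3 := Rabs_pos (sin y - 0 - 1 * y)).
    assert (exp x * Rabs (cos y - 1 - - 0 * y) <= 2 * (e * Rabs y)) by (apply Rmult_le_compat; lra).
    assert (exp x * Rabs (sin y - 0 - 1 * y) <= 2 * (e * Rabs y)) by (apply Rmult_le_compat; lra).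
    assert (Rabs (exp x - 1) * Rabs y <= 2 * e * Rabs y) by (apply Rmult_le_compat_r; lra).
    assert (e * Rabs x <= e * Cmod h) by (apply Rmult_le_compat_l; lra).
    assert (e * Rabs y <= e * Cmod h) by (apply Rmult_le_compat_l; lra).
    assert (10 * e * Cmod h <= eps * Cmod h) by (apply Rmult_le_compat_r; [apply Cmod_ge_0|lra]).
    assert (0 <= e * Cmod h) by (apply Rmult_le_pos; [lra|apply Cmod_ge_0]).
    lra. }
  apply (cderiv_ext_loc (fun v => cexp w * cexp (v - w))%C _ _ _ 1); [lra| |].
  - intros v _. rewrite <- cexp_plus. f_equal. ring.
  - eapply cderiv_eq.
    + apply (cderiv_mult (fun _ => cexp w) (fun v => cexp (v - w)%C) w 0 (1 * (1 - 0))).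
      * apply cderiv_const.
      * apply (cderiv_comp cexp (fun v => v - w)%C).
        -- replace (w - w)%C with (RtoC 0) by ring. exact H0.
        -- apply cderiv_minus; [apply cderiv_id|apply cderiv_const].
    + cbv beta. replace (w - w)%C with (RtoC 0) by ring. ring.
Qed.

Definition circ (c : C) (r t : R) : C := (c + RtoC r * cis t)%C.

Lemma Cmod_circ (c : C) (r t : R) : 0 <= r -> Cmod (circ c r t - c) = r.
Proof.
  intro Hr. unfold circ. replace (c + RtoC r * cis t - c)%C with (RtoC r * cis t)%C by ring.
  rewrite Cmod_mult, Cmod_cis, Cmod_R, Rabs_pos_eq; lra.
Qed.

Lemma cont_circ (c : C) (r t : R) : cont (circ c r) t.
Proof.
  unfold circ. apply cont_plus; [apply cont_const|]. apply cont_mult; [apply cont_const|].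
  apply cont_iff; split; simpl; [apply continuous_cos|apply continuous_sin].
Qed.

Lemma Cmod_small_eq (z w : C) : (forall eps, 0 < eps -> Cmod (z - w) <= eps) -> z = w.
Proof.
  intro H. assert (E : (z - w)%C = 0%C).
  { apply Cmod_eq_0, Rle_antisym; [|apply Cmod_ge_0].
    apply Rnot_lt_le. intro K. specialize (H (Cmod (z - w) / 2)). lra. }
  replace z with (w + (z - w))%C by ring. rewrite E. ring.
Qed.

(* Under [z = c + exp w] concentric circles become vertical segments, and by periodicity
   the horizontal sides of the rectangle in Goursat's theorem cancel. *)
Lemma mean_value_property (f : C -> C) (c : C) (r R0 : R) :
  0 < r < R0 ->
  (forall z, 0 < Cmod (z - c) < R0 -> exists m, cderiv f z m) ->
  @cont C_UniformSpace f c ->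
  CInt (fun t => f (circ c r t)) 0 (2 * PI) = (RtoC (2 * PI) * f c)%C.
Proof.
  intros Hr Hf Hc. assert (HPI := PI_RGT_0).
  assert (Cf : forall z, Cmod (z - c) < R0 -> @cont C_UniformSpace f z).
  { intros z Hz. destruct (Ceq_dec z c) as [->|N]; [exact Hc|].
    destruct (Hf z) as [m Hm].
    - split; [|exact Hz]. apply Cmod_gt_0. intro E. apply N.
      replace z with (c + (z - c))%C by ring. rewrite E. ring.
    - exact (cderiv_cont _ _ _ Hm). }
  assert (Con : forall s, 0 <= s < R0 -> cont_on (fun t => f (circ c s t)) 0 (2 * PI)).
  { intros s Hs t _. apply (cont_comp (circ c s)); [apply cont_circ|].
    apply Cf. rewrite Cmod_circ; lra. }
  assert (Step : forall s, 0 < s < r ->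
     CInt (fun t => f (circ c r t)) 0 (2 * PI) = CInt (fun t => f (circ c s t)) 0 (2 * PI)).
  { intros s Hs.
    assert (Hln : ln s < ln r) by (apply ln_increasing; lra).
    assert (G := goursat (fun w => f (c + cexp w)%C) (ln s) 0 (ln r - ln s) (2 * PI)).
    rewrite <- (Cplus_0_r (CInt (fun t => f (circ c s t)) 0 (2 * PI))), <- Cmult_0_r with (x := (- Ci)%C).
    rewrite <- G; [clear G| lra | lra |].
    - unfold rect_int.
      replace (ln s + (ln r - ln s)) with (ln r) by ring. rewrite !Rplus_0_l.
      rewrite (CInt_ext (fun t => f (c + cexp (t, 0%R))%C - f (c + cexp (t, (2 * PI)%R))%C)%C (fun _ => RtoC 0)); [|lra|].
      2:{ intros t _. unfold cexp, cis. cbn [Re Im fst snd]. rewrite ?Rplus_0_l.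
          rewrite cos_2PI, sin_2PI, cos_0, sin_0. ring. }
      rewrite (CInt_ext (fun t => f (c + cexp (ln r, t))%C - f (c + cexp (ln s, t))%C)%C
                 (fun t => f (circ c r t) - f (circ c s t))%C); [|lra|].
      2:{ intros t _. unfold cexp, circ. cbn [Re Im fst snd]. rewrite !exp_ln by lra. reflexivity. }
      rewrite CInt_const, CInt_minus; try lra; try (apply Con; lra).
      set (u := CInt _ _ _). set (v := CInt _ _ _).
      replace (- Ci * (RtoC (ln r - ln s) * 0 + Ci * (u - v)))%C with (- (Ci * Ci) * (u - v))%C by ring.
      replace (Ci * Ci)%C with (- (1))%C by (apply injective_projections; simpl; ring). ring.
    - intros z [[_ Hz] _].
      destruct (Hf (c + cexp z)%C) as [m Hm].
      + replace (c + cexp z - c)%C with (cexp z) by ring. rewrite Cmod_cexp.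
        split; [apply exp_pos|]. apply Rle_lt_trans with r; [|lra].
        rewrite <- (exp_ln r) by lra.
        destruct (Rle_lt_or_eq_dec (Re z) (ln r)) as [K|K]; [lra| |].
        * left. now apply exp_increasing.
        * rewrite K. lra.
      + eexists. apply (cderiv_comp f (fun w => c + cexp w)%C z m (0 + cexp z)%C); [exact Hm|].
        apply cderiv_plus; [apply cderiv_const|apply cderiv_cexp]. }
  apply Cmod_small_eq. intros eps He.
  (* The integral does not depend on the radius, so the circle is shrunk until [f] is close to [f c]
     on it. Here 4 pi is the length 2 pi times the factor 2 of [CInt_bound]. *)
  destruct (proj1 (cont_C f c) Hc (eps / (4 * PI))) as (d & Hd & K).
  { apply Rdiv_lt_0_compat; lra. }
  pose (s := Rmin d r / 2).
  assert (Hs : 0 < s /\ s < d /\ s < r).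
  { unfold s. assert (0 < Rmin d r) by (apply Rmin_glb_lt; lra).
    assert (Rmin d r <= d) by apply Rmin_l. assert (Rmin d r <= r) by apply Rmin_r. lra. }
  rewrite (Step s) by lra.
  replace (RtoC (2 * PI) * f c)%C with (CInt (fun _ => f c) 0 (2 * PI))
    by (rewrite CInt_const; f_equal; f_equal; ring).
  rewrite <- CInt_minus.
  - replace eps with (2 * (eps / (4 * PI)) * (2 * PI - 0)) by (field; lra).
    apply CInt_bound; [lra| |].
    + intros t Ht. apply cont_minus; [apply Con; lra|apply cont_const].
    + intros t _. left. apply K. rewrite Cmod_circ; lra.
  - lra.
  - apply Con; lra.
  - intros t _. apply cont_const.
Qed.

Lemma Cminus_neq_0 (z w : C) : z <> w -> (z - w)%C <> 0%C.
Proof. intros N E. apply N. replace z with (w + (z - w))%C by ring. rewrite E. ring. Qed.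

Lemma Cmod_sub_pos (z w : C) : z <> w -> 0 < Cmod (z - w).
Proof. intro N. now apply Cmod_gt_0, Cminus_neq_0. Qed.

(* The mean value property, applied to the difference quotient. *)
Lemma derivative_mean_formula (f : C -> C) (c m : C) (r R0 : R) :
  0 < r < R0 ->
  (forall z, Cmod (z - c) < R0 -> exists l, cderiv f z l) ->
  cderiv f c m ->
  CInt (fun t => (f (circ c r t) - f c) / (RtoC r * cis t))%C 0 (2 * PI) = (RtoC (2 * PI) * m)%C.
Proof.
  intros Hr Hf (q & Hq & Lq & Eq).
  assert (HPI := PI_RGT_0).
  assert (Eqq : forall w, w <> c -> q w = ((f w - f c) / (w - c))%C).
  { intros w N. rewrite (Eq w) at 1. field. now apply Cminus_neq_0. }
  rewrite <- Lq, <- (mean_value_property q c r R0 Hr); [| |exact Hq].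
  - apply CInt_ext; [lra|]. intros t _. rewrite Eqq.
    + replace (circ c r t - c)%C with (RtoC r * cis t)%C by (unfold circ; ring). reflexivity.
    + intro E. assert (K := Cmod_circ c r t). rewrite E in K.
      replace (c - c)%C with (RtoC 0) in K by ring. rewrite Cmod_0 in K. lra.
  - intros z [Hz1 Hz2]. destruct (Hf z Hz2) as [l Hl].
    eexists. apply (cderiv_ext_loc (fun w => (f w - f c) * / (w - c))%C _ _ _ (Cmod (z - c)) Hz1).
    + intros w Hw. rewrite Eqq; [reflexivity|]. intros ->.
      rewrite Cmod_sub_sym in Hw. lra.
    + apply cderiv_mult.
      * apply cderiv_minus; [exact Hl|apply cderiv_const].
      * apply (cderiv_inv (fun w => w - c)%C z (1 - 0)).
        -- apply cderiv_minus; [apply cderiv_id|apply cderiv_const].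
        -- now apply Cmod_gt_0.
Qed.

(** * The derivative of a holomorphic function *)

Lemma disc_max (f : C -> C) (c : C) (r : R) :
  0 <= r -> (forall z, Cmod (z - c) <= r -> @cont C_UniformSpace f z) ->
  exists z, Cmod (z - c) <= r /\ forall w, Cmod (w - c) <= r -> Cmod (f w) <= Cmod (f z).
Proof.
  intros Hr Hc.
  apply (compact_max (fun z => Cmod (z - c) <= r) (fun z => Cmod (f z)) (Cmod c + r) c).
  - replace (c - c)%C with (RtoC 0) by ring. now rewrite Cmod_0.
  - intros z Hz. assert (K := Cmod_reverse_triangle z c). lra.
  - intros z Hz. apply Rnot_lt_le. intro K.
    destruct (Hz (Cmod (z - c) - r)) as (w & Hw1 & Hw2); [lra|].
    assert (T := Cmod_sub_triangle z w c). rewrite (Cmod_sub_sym z w) in T. lra.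
  - intros z eps Hz He. destruct (proj1 (cont_C f z) (Hc z Hz) eps He) as (d & Hd & K).
    exists d. split; [exact Hd|]. intros w _ Hw. specialize (K w Hw).
    assert (T := Cmod_reverse_triangle (f w) (f z)). lra.
Qed.

Lemma disc_convex (c z w : C) (r t : R) :
  Cmod (z - c) <= r -> Cmod (w - c) <= r -> 0 <= t <= 1 ->
  Cmod (z + RtoC t * (w - z) - c) <= r.
Proof.
  intros Hz Hw Ht.
  replace (z + RtoC t * (w - z) - c)%C with (RtoC (1 - t) * (z - c) + RtoC t * (w - c))%C
    by (rewrite RtoC_minus; ring).
  eapply Rle_trans; [apply Cmod_triangle|]. rewrite !Cmod_mult, !Cmod_R, !Rabs_pos_eq by lra. nra.
Qed.

Lemma Cmod_cis_scale (r t : R) : 0 <= r -> Cmod (RtoC r * cis t) = r.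
Proof. intro. rewrite Cmod_mult, Cmod_cis, Cmod_R, Rabs_pos_eq; lra. Qed.

Lemma cis_scale_neq_0 (r t : R) : 0 < r -> (RtoC r * cis t)%C <> 0%C.
Proof. intro Hr. apply Cmod_gt_0. rewrite Cmod_cis_scale; lra. Qed.

Lemma cont_div_circ (g : R -> C) (r t : R) : 0 < r -> cont g t -> cont (fun t => g t / (RtoC r * cis t))%C t.
Proof.
  intros Hr Hg. apply cont_mult; [exact Hg|]. apply cont_inv; [|now apply cis_scale_neq_0].
  assert (K := cont_circ 0 r t). apply (cont_ext_loc (circ 0 r)); [|exact K].
  apply filter_forall. intro s. unfold circ. ring.
Qed.

(** Cauchy's estimate, for any quantity [m] given as a circular mean. It is applied to [f1], to
    differences of [f1], and to the first-order remainder of [f1]. *)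
Lemma circ_mean_bound (g : R -> C) (r M : R) (m : C) : 0 < r ->
  (forall t, cont g t) -> (forall t, Cmod (g t) <= M) ->
  CInt (fun t => g t / (RtoC r * cis t))%C 0 (2 * PI) = (RtoC (2 * PI) * m)%C ->
  Cmod m <= 2 * M / r.
Proof.
  intros Hr Hg HM E. assert (HPI := PI_RGT_0).
  assert (K : Cmod (RtoC (2 * PI) * m) <= 2 * (M / r) * (2 * PI - 0)).
  { rewrite <- E. apply CInt_bound; [lra| |].
    - intros t _. apply cont_div_circ; trivial.
    - intros t _. rewrite Cmod_div, Cmod_cis_scale by (try apply cis_scale_neq_0; lra).
      apply Rmult_le_compat_r; [left; now apply Rinv_0_lt_compat|apply HM]. }
  rewrite Cmod_mult, Cmod_R, Rabs_pos_eq in K by lra.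
  apply Rmult_le_reg_l with (2 * PI); [lra|]. eapply Rle_trans; [exact K|]. apply Req_le. unfold Rdiv. ring.
Qed.

Section HoloDisc.
Context (f f1 : C -> C) (c : C) (R0 : R) (R0_pos : 0 < R0)
  (Hf : forall z, Cmod (z - c) < R0 -> cderiv f z (f1 z)).

Let f_cont z : Cmod (z - c) < R0 -> @cont C_UniformSpace f z.
Proof. intro Hz. exact (cderiv_cont _ _ _ (Hf z Hz)). Qed.

Let f_circ_cont z r t : 0 <= r -> Cmod (z - c) + r < R0 -> cont (fun t => f (circ z r t)) t.
Proof.
  intros Hr H. apply (cont_comp (circ z r)); [apply cont_circ|]. apply f_cont.
  assert (T := Cmod_sub_triangle (circ z r t) z c). rewrite Cmod_circ in T; lra.
Qed.

Let formula z r : 0 < r -> Cmod (z - c) + r < R0 ->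
  CInt (fun t => (f (circ z r t) - f z) / (RtoC r * cis t))%C 0 (2 * PI) = (RtoC (2 * PI) * f1 z)%C.
Proof.
  intros Hr H. apply derivative_mean_formula with (R0 := R0 - Cmod (z - c)).
  - lra.
  - intros w Hw. exists (f1 w). apply Hf. assert (T := Cmod_sub_triangle w z c). lra.
  - apply Hf. lra.
Qed.

(** With R0 = 4 r the bounds follow one another on shrinking discs: [f] is bounded on radius 3r, so
    its derivative is bounded on radius 2r by Cauchy's estimate, so [f] is Lipschitz there. On
    radius r a difference of values of [f1] is a circular mean of differences of [f], so [f1] is
    Lipschitz. The second bound is the mean value inequality for [f v - v * f1 z], whose derivative
    is [f1 v - f1 z]. *)
Lemma holo_second_order_bound : exists L, 0 <= L /\
  (forall z w, Cmod (z - c) <= R0 / 4 -> Cmod (w - c) <= R0 / 4 ->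
     Cmod (f1 w - f1 z) <= L * Cmod (w - z)) /\
  (forall z w, Cmod (z - c) <= R0 / 4 -> Cmod (w - c) <= R0 / 4 ->
     Cmod (f w - f z - (w - z) * f1 z) <= L * Cmod (w - z) ^ 2).
Proof.
  set (r := R0 / 4). assert (Hr : 0 < r) by (unfold r; lra). assert (E4 : R0 = 4 * r) by (unfold r; lra).
  destruct (disc_max f c (3 * r)) as (z0 & Hz0 & HM); [lra|intros z Hz; apply f_cont; lra|].
  set (M := Cmod (f z0)) in *. assert (M0 : 0 <= M) by apply Cmod_ge_0.
  assert (Ht3 : forall z t, Cmod (z - c) <= 2 * r -> Cmod (circ z r t - c) <= 3 * r).
  { intros z t Hz. assert (T := Cmod_sub_triangle (circ z r t) z c). rewrite Cmod_circ in T; lra. }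
  assert (Ha : forall z, Cmod (z - c) <= 2 * r -> Cmod (f1 z) <= 2 * (2 * M) / r).
  { intros z Hz. apply circ_mean_bound with (g := fun t => (f (circ z r t) - f z)%C); trivial.
    - intro t. apply cont_minus; [apply f_circ_cont; lra|apply cont_const].
    - intro t. unfold Cminus. eapply Rle_trans; [apply Cmod_triangle|]. rewrite Cmod_opp.
      assert (Cmod (f (circ z r t)) <= M) by (apply HM, Ht3, Hz).
      assert (Cmod (f z) <= M) by (apply HM; lra). lra.
    - apply formula; lra. }
  set (L := 2 * (2 * M) / r) in *.
  assert (L0 : 0 <= L) by (unfold L, Rdiv; apply Rmult_le_pos; [lra|left; now apply Rinv_0_lt_compat]).
  assert (Hb : forall z w, Cmod (z - c) <= 2 * r -> Cmod (w - c) <= 2 * r ->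
     Cmod (f w - f z) <= 2 * L * Cmod (w - z)).
  { intros z w Hz Hw. apply mean_value_ineq with (f1 := f1). intros t Ht.
    assert (K := disc_convex c z w (2 * r) t Hz Hw Ht). split; [apply Hf; lra|now apply Ha]. }
  assert (Hc : forall z w, Cmod (z - c) <= r -> Cmod (w - c) <= r ->
     Cmod (f1 w - f1 z) <= 2 * (4 * L * Cmod (w - z)) / r).
  { intros z w Hz Hw.
    assert (Cc : forall v t, Cmod (v - c) <= r -> cont (fun t => f (circ v r t) - f v)%C t).
    { intros v t Hv. apply cont_minus; [apply f_circ_cont; lra|apply cont_const]. }
    apply circ_mean_bound with (g := fun t => ((f (circ w r t) - f w) - (f (circ z r t) - f z))%C); trivial.
    - intro t. apply cont_minus; apply Cc; trivial.
    - intro t.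
      replace ((f (circ w r t) - f w) - (f (circ z r t) - f z))%C
        with ((f (circ w r t) - f (circ z r t)) + - (f w - f z))%C by ring.
      eapply Rle_trans; [apply Cmod_triangle|]. rewrite Cmod_opp.
      assert (K1 := Hb z w ltac:(lra) ltac:(lra)).
      assert (K2 := Hb (circ z r t) (circ w r t)).
      replace (circ w r t - circ z r t)%C with (w - z)%C in K2 by (unfold circ; ring).
      assert (T1 := Cmod_sub_triangle (circ z r t) z c). rewrite Cmod_circ in T1 by lra.
      assert (T2 := Cmod_sub_triangle (circ w r t) w c). rewrite Cmod_circ in T2 by lra.
      specialize (K2 ltac:(lra) ltac:(lra)). lra.
    - transitivity (CInt (fun t => (f (circ w r t) - f w) / (RtoC r * cis t)
                                 - (f (circ z r t) - f z) / (RtoC r * cis t))%C 0 (2 * PI)).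
      { apply CInt_ext; [assert (K := PI_RGT_0); lra|]. intros t _. field. split.
        - assert (K := cis_scale_neq_0 1 t ltac:(lra)). intro E. apply K. rewrite E. ring.
        - intro E. apply RtoC_inj in E. lra. }
      rewrite CInt_minus.
      + rewrite !formula by lra. ring.
      + assert (K := PI_RGT_0); lra.
      + intros t _. apply cont_div_circ; [exact Hr|now apply Cc].
      + intros t _. apply cont_div_circ; [exact Hr|now apply Cc]. }
  set (L1 := 8 * L / r).
  assert (L10 : 0 <= L1) by (unfold L1, Rdiv; apply Rmult_le_pos; [lra|left; now apply Rinv_0_lt_compat]).
  assert (Hc' : forall z w, Cmod (z - c) <= r -> Cmod (w - c) <= r ->
     Cmod (f1 w - f1 z) <= L1 * Cmod (w - z)).
  { intros z w Hz Hw. eapply Rle_trans; [now apply Hc|]. apply Req_le. unfold L1, Rdiv. ring. }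
  exists (2 * L1). split; [lra|]. split.
  - intros z w Hz Hw. eapply Rle_trans; [now apply Hc'|].
    assert (K := Cmod_ge_0 (w - z)). nra.
  - intros z w Hz Hw.
    replace (f w - f z - (w - z) * f1 z)%C with ((f w - w * f1 z) - (f z - z * f1 z))%C by ring.
    replace (2 * L1 * Cmod (w - z) ^ 2) with (2 * (L1 * Cmod (w - z)) * Cmod (w - z)) by ring.
    apply (mean_value_ineq (fun v => f v - v * f1 z)%C (fun v => f1 v - f1 z)%C).
    intros t Ht. assert (K := disc_convex c z w r t Hz Hw Ht). split.
    + eapply cderiv_eq.
      * apply (cderiv_minus f (fun v => v * f1 z)%C).
        -- apply Hf. lra.
        -- apply (cderiv_mult (fun v => v) (fun _ => f1 z)); [apply cderiv_id|apply cderiv_const].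
      * ring.
    + eapply Rle_trans; [now apply Hc'|]. apply Rmult_le_compat_l; [exact L10|].
      replace (z + RtoC t * (w - z) - z)%C with (RtoC t * (w - z))%C by ring.
      rewrite Cmod_mult, Cmod_R, Rabs_pos_eq by lra.
      assert (K' := Cmod_ge_0 (w - z)). nra.
Qed.

(** The candidate for the derivative of [f1] is the mean formula written formally for [f1]. The
    formula is linear, so the first-order remainder of [f1] at [c] is a circular mean of first-order
    remainders of [f] at translated points, and these are quadratic in [w - c] by the preceding
    bounds. *)
Lemma holo_derivative : exists m, cderiv f1 c m.
Proof.
  destruct holo_second_order_bound as (L & L0 & HL & HQ).
  set (r := R0 / 8). assert (Hr : 0 < r) by (unfold r; lra). assert (E8 : R0 = 8 * r) by (unfold r; lra).
  replace (R0 / 4) with (2 * r) in * by (unfold r; lra).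
  assert (HPI := PI_RGT_0).
  assert (Hcc : Cmod (c - c) = 0) by (replace (c - c)%C with (RtoC 0) by ring; apply Cmod_0).
  exists (CInt (fun t => (f1 (circ c r t) - f1 c) / (RtoC r * cis t))%C 0 (2 * PI) / RtoC (2 * PI))%C.
  set (J := CInt _ _ _).
  assert (N2 : RtoC (2 * PI) <> 0%C) by (intro E; apply RtoC_inj in E; lra).
  assert (Key : forall w, Cmod (w - c) <= r ->
    Cmod (f1 w - f1 c - (w - c) * (J / RtoC (2 * PI))) <= 2 * (2 * L * Cmod (w - c) ^ 2) / r).
  { intros w Hw.
    assert (C1 : forall v t, Cmod (v - c) <= r -> cont (fun t => f (circ v r t) - f v)%C t).
    { intros v t Hv. apply cont_minus; [apply f_circ_cont; lra|apply cont_const]. }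
    assert (C2 : forall t, cont (fun t => f1 (circ c r t) - f1 c)%C t).
    { intro t. apply cont_minus; [|apply cont_const].
      apply (cont_comp (circ c r)); [apply cont_circ|]. apply cont_C. intros eps He.
      exists (Rmin r (eps / (L + 1))). assert (0 < eps / (L + 1)) by (apply Rdiv_lt_0_compat; lra).
      split; [now apply Rmin_glb_lt|]. intros v Hv.
      assert (A1 := Rmin_l r (eps / (L + 1))). assert (A2 := Rmin_r r (eps / (L + 1))).
      assert (T := Cmod_sub_triangle v (circ c r t) c). assert (T' := Cmod_circ c r t ltac:(lra)).
      eapply Rle_lt_trans; [apply HL; lra|].
      assert (Hv' : Cmod (v - circ c r t) < eps / (L + 1)) by lra.
      assert (K := Cmod_ge_0 (v - circ c r t)).
      apply Rmult_lt_compat_l with (r := L + 1) in Hv'; [|lra].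
      replace ((L + 1) * (eps / (L + 1))) with eps in Hv' by (field; lra). nra. }
    apply circ_mean_bound with (g := fun t => ((f (circ w r t) - f w) - (f (circ c r t) - f c)
        - (w - c) * (f1 (circ c r t) - f1 c))%C); trivial.
    - intro t. apply cont_minus; [apply cont_minus; apply C1; lra|].
      apply cont_mult; [apply cont_const|apply C2].
    - intro t.
      replace ((f (circ w r t) - f w) - (f (circ c r t) - f c) - (w - c) * (f1 (circ c r t) - f1 c))%C
        with ((f (circ w r t) - f (circ c r t) - (w - c) * f1 (circ c r t))
           + - (f w - f c - (w - c) * f1 c))%C by ring.
      eapply Rle_trans; [apply Cmod_triangle|]. rewrite Cmod_opp.
      assert (K1 := HQ c w ltac:(lra) ltac:(lra)).
      assert (K2 := HQ (circ c r t) (circ w r t)).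
      replace (circ w r t - circ c r t)%C with (w - c)%C in K2 by (unfold circ; ring).
      assert (T1 := Cmod_sub_triangle (circ w r t) w c). rewrite Cmod_circ in T1 by lra.
      assert (T2 := Cmod_circ c r t ltac:(lra)).
      specialize (K2 ltac:(lra) ltac:(lra)). lra.
    - transitivity (CInt (fun t => ((f (circ w r t) - f w) / (RtoC r * cis t)
                                 - (f (circ c r t) - f c) / (RtoC r * cis t))
                    - (w - c) * ((f1 (circ c r t) - f1 c) / (RtoC r * cis t)))%C 0 (2 * PI)).
      { apply CInt_ext; [lra|]. intros t _. field. split.
        - assert (K := cis_scale_neq_0 1 t ltac:(lra)). intro E. apply K. rewrite E. ring.
        - intro E. apply RtoC_inj in E. lra. }
      assert (D1 : forall v, Cmod (v - c) <= r ->
         cont_on (fun t => (f (circ v r t) - f v) / (RtoC r * cis t))%C 0 (2 * PI)).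
      { intros v Hv t _. apply cont_div_circ; [exact Hr|now apply C1]. }
      assert (D2 : cont_on (fun t => (f1 (circ c r t) - f1 c) / (RtoC r * cis t))%C 0 (2 * PI)).
      { intros t _. apply cont_div_circ; [exact Hr|apply C2]. }
      rewrite CInt_minus; [rewrite CInt_minus; [rewrite CInt_scal|..]|..]; try lra.
      + rewrite !formula by lra. fold J. field. exact N2.
      + exact D2.
      + apply D1; lra.
      + apply D1; lra.
      + intros t Ht. apply cont_minus; apply D1; trivial; lra.
      + intros t Ht. apply cont_mult; [apply cont_const|now apply D2]. }
  apply cderiv_eps. intros eps He.
  exists (Rmin r (eps * r / (4 * L + 1))).
  assert (Hd : 0 < eps * r / (4 * L + 1)) by (apply Rdiv_lt_0_compat; nra).
  split; [now apply Rmin_glb_lt|]. intros w Hw.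
  assert (A1 := Rmin_l r (eps * r / (4 * L + 1))). assert (A2 := Rmin_r r (eps * r / (4 * L + 1))).
  eapply Rle_trans; [apply Key; lra|].
  assert (K := Cmod_ge_0 (w - c)). set (x := Cmod (w - c)) in *.
  apply Rmult_le_reg_r with r; [exact Hr|].
  replace (2 * (2 * L * x ^ 2) / r * r) with (4 * L * x * x) by (field; lra).
  replace (eps * x * r) with (eps * r * x) by ring.
  apply Rmult_le_compat_r; [exact K|].
  assert (Hx : x < eps * r / (4 * L + 1)) by lra.
  apply Rmult_lt_compat_l with (r := 4 * L + 1) in Hx; [|lra].
  replace ((4 * L + 1) * (eps * r / (4 * L + 1))) with (eps * r) in Hx by (field; lra). lra.
Qed.

End HoloDisc.

(** * Maximum principle and identity theorem *)

Lemma RInt_zero_nonneg (v : R -> R) (a b t : R) :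
  a < b -> a <= t <= b -> (forall s, continuous v s) -> (forall s, 0 <= v s) ->
  RInt v a b = 0 -> v t = 0.
Proof.
  intros Hab Ht Hc Hp H0. apply NNPP. intro N.
  assert (Hv : 0 < v t) by (specialize (Hp t); lra).
  assert (Hv2 : 0 < v t / 2) by lra.
  destruct (proj1 (filterlim_locally _ _) (Hc t) (mkposreal _ Hv2)) as [d Hd].
  assert (Hdp := cond_pos d).
  set (p := Rmax a (t - d / 2)). set (q := Rmin b (t + d / 2)).
  assert (P1 : a <= p) by apply Rmax_l. assert (P2 : t - d / 2 <= p) by apply Rmax_r.
  assert (Q1 : q <= b) by apply Rmin_l. assert (Q2 : q <= t + d / 2) by apply Rmin_r.
  assert (Hpq : p < q) by (apply Rmax_lub_lt; apply Rmin_glb_lt; lra).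
  assert (I : forall x y, ex_RInt v x y)
    by (intros; apply (@ex_RInt_continuous R_CompleteNormedModule); intros; apply Hc).
  assert (E : RInt v a p + (RInt v p q + RInt v q b) = RInt v a b).
  { assert (C1 := RInt_Chasles v a p b (I _ _) (I _ _)).
    assert (C2 := RInt_Chasles v p q b (I _ _) (I _ _)).
    change (RInt v a p + RInt v p b = RInt v a b) in C1.
    change (RInt v p q + RInt v q b = RInt v p b) in C2. lra. }
  assert (K1 : 0 <= RInt v a p) by (apply RInt_ge_0; auto).
  assert (K3 : 0 <= RInt v q b) by (apply RInt_ge_0; auto).
  assert (K2 : 0 < RInt v p q).
  { apply RInt_gt_0; [exact Hpq| |intros; apply Hc].
    intros x Hx. assert (B : ball t d x).
    { unfold ball; simpl; unfold AbsRing_ball, abs, minus, plus, opp; simpl.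
      apply Rabs_lt_between. lra. }
    specialize (Hd x B). unfold ball in Hd; simpl in Hd.
    unfold AbsRing_ball, abs, minus, plus, opp in Hd; simpl in Hd.
    apply Rabs_lt_between in Hd. lra. }
  lra.
Qed.

Lemma polar (z : C) : exists t, 0 <= t <= 2 * PI /\ z = (RtoC (Cmod z) * cis t)%C.
Proof.
  assert (HPI := PI_RGT_0).
  destruct (Ceq_dec z 0) as [->|N].
  { exists 0. split; [lra|]. rewrite Cmod_0. ring. }
  assert (Hr := proj1 (Cmod_gt_0 _) N). set (r := Cmod z) in *.
  assert (E2 : Re z ^ 2 + Im z ^ 2 = r ^ 2) by (unfold r; symmetry; apply Cmod2_alt).
  assert (Hu : -1 <= Re z / r <= 1).
  { assert (K := re_le_Cmod z). fold r in K. apply Rabs_le_between in K.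
    split; apply Rmult_le_reg_r with r; trivial; unfold Rdiv; rewrite Rmult_assoc, Rinv_l; lra. }
  assert (Ec := cos_acos _ Hu). assert (Es := sin_acos _ Hu).
  assert (B := acos_bound (Re z / r)).
  assert (Esq : sqrt (1 - Rsqr (Re z / r)) = Rabs (Im z) / r).
  { rewrite <- (sqrt_Rsqr (Rabs (Im z) / r)).
    - f_equal. unfold Rsqr. apply Rmult_eq_reg_r with (r * r); [|nra].
      replace ((1 - Re z / r * (Re z / r)) * (r * r)) with (r ^ 2 - Re z ^ 2) by (field; lra).
      replace (Rabs (Im z) / r * (Rabs (Im z) / r) * (r * r)) with (Rabs (Im z) * Rabs (Im z)) by (field; lra).
      rewrite <- Rabs_mult, Rabs_pos_eq by nra. lra.
    - unfold Rdiv. apply Rmult_le_pos; [apply Rabs_pos|left; now apply Rinv_0_lt_compat]. }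
  rewrite Esq in Es.
  destruct (Rle_or_lt 0 (Im z)) as [K|K].
  - exists (acos (Re z / r)). split; [lra|]. rewrite Rabs_pos_eq in Es by lra.
    unfold cis. rewrite Ec, Es. apply injective_projections; simpl; unfold Re, Im; field; lra.
  - exists (2 * PI - acos (Re z / r)). split; [lra|]. rewrite Rabs_left in Es by lra.
    unfold cis. rewrite cos_minus, sin_minus, cos_2PI, sin_2PI, Ec, Es.
    apply injective_projections; simpl; unfold Re, Im; field; lra.
Qed.

(** After division by [f c] the function has modulus at most 1 and circular mean 1, so 1 - Re g is
    continuous, nonnegative and of integral 0. Working with the real part alone is sharp, whereas
    [CInt_bound] would lose a factor 2. *)
Lemma local_max_const (f : C -> C) (c : C) (R0 : R) :
  (forall z, Cmod (z - c) < R0 -> exists l, cderiv f z l) ->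
  (forall z, Cmod (z - c) < R0 -> Cmod (f z) <= Cmod (f c)) ->
  forall z, Cmod (z - c) < R0 -> f z = f c.
Proof.
  intros Hf HM z Hz.
  destruct (Ceq_dec z c) as [->|N]; [reflexivity|].
  assert (Hr := Cmod_sub_pos z c N). set (r := Cmod (z - c)) in *.
  destruct (Ceq_dec (f c) 0) as [E0|N0].
  { specialize (HM z Hz). rewrite E0 in *. rewrite Cmod_0 in HM.
    apply Cmod_eq_0. assert (K := Cmod_ge_0 (f z)). lra. }
  assert (HPI := PI_RGT_0).
  assert (Cf : forall t, cont (fun t => f (circ c r t)) t).
  { intro t. apply (cont_comp (circ c r)); [apply cont_circ|].
    destruct (Hf (circ c r t)) as [l Hl]; [rewrite Cmod_circ; lra|]. exact (cderiv_cont _ _ _ Hl). }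
  assert (Hcc : Cmod (c - c) = 0) by (replace (c - c)%C with (RtoC 0) by ring; apply Cmod_0).
  assert (MV := mean_value_property f c r R0 (conj Hr Hz)).
  assert (MV' : CInt (fun t => / f c * f (circ c r t))%C 0 (2 * PI) = RtoC (2 * PI)).
  { rewrite CInt_scal by (try lra; intros t _; apply Cf). rewrite MV.
    - field. exact N0.
    - intros w Hw. apply Hf. lra.
    - destruct (Hf c) as [l Hl]; [lra|]. exact (cderiv_cont _ _ _ Hl). }
  set (g := fun t => (/ f c * f (circ c r t))%C) in *.
  assert (Cg : forall t, cont g t) by (intro t; apply cont_mult; [apply cont_const|apply Cf]).
  assert (Bg : forall t, Cmod (g t) <= 1).
  { intro t. unfold g. rewrite Cmod_mult, Cmod_inv by exact N0.
    assert (Np := proj1 (Cmod_gt_0 _) N0).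
    apply Rmult_le_reg_l with (Cmod (f c)); [exact Np|].
    rewrite <- Rmult_assoc, Rinv_r by lra. rewrite Rmult_1_l, Rmult_1_r.
    apply HM. rewrite Cmod_circ; lra. }
  destruct (polar (z - c)) as (t & Ht & Et). fold r in Et.
  assert (Ez : z = circ c r t) by (unfold circ; rewrite <- Et; ring).
  assert (Re1 : 1 - Re (g t) = 0).
  { apply (RInt_zero_nonneg (fun s => 1 - Re (g s)) 0 (2 * PI) t); try lra.
    - intro s. apply @continuous_minus; [apply continuous_const|]. apply cont_iff, Cg.
    - intro s. assert (K := re_le_Cmod (g s)). apply Rabs_le_between in K. specialize (Bg s). lra.
    - assert (E := f_equal Re MV').
      change (RInt (fun s => Re (g s)) 0 (2 * PI) = 2 * PI) in E.
      assert (Em := @RInt_minus R_CompleteNormedModule (fun _ => 1) (fun s => Re (g s)) 0 (2 * PI)).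
      change (ex_RInt (fun _ : R => 1) 0 (2 * PI) -> ex_RInt (fun s => Re (g s)) 0 (2 * PI) ->
        RInt (fun s => 1 - Re (g s)) 0 (2 * PI) = RInt (fun _ => 1) 0 (2 * PI) - RInt (fun s => Re (g s)) 0 (2 * PI)) in Em.
      rewrite Em.
      + rewrite E, RInt_const. unfold scal; simpl; unfold mult; simpl. ring.
      + apply (@ex_RInt_const R_NormedModule).
      + apply (cont_on_ex_RInt g 0 (2 * PI)); [lra|]. intros s _. apply Cg. }
  assert (Im0 : Im (g t) = 0).
  { assert (K := Cmod2_alt (g t)). replace (Re (g t)) with 1 in K by lra.
    specialize (Bg t). assert (K' := Cmod_ge_0 (g t)).
    apply Rsqr_0_uniq, Rle_antisym; [unfold Rsqr; nra|apply Rle_0_sqr]. }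
  assert (Eg : g t = 1%C) by (apply injective_projections; [change (Re (g t) = 1); lra|exact Im0]).
  rewrite Ez. replace (f (circ c r t)) with (f c * g t)%C by (unfold g; field; exact N0).
  rewrite Eg. ring.
Qed.

(** If the maximum is attained at an interior point [z0], then [f] is constant on the disc about
    [z0] that touches the circle at the point [b] on the ray through [z0]. Points [w] of that disc
    tend to [b], so one disc and continuity at [b] suffice. *)
Lemma max_modulus_disc (f : C -> C) (c : C) (r R0 M : R) :
  0 < r < R0 -> (forall z, Cmod (z - c) < R0 -> exists l, cderiv f z l) ->
  (forall z, Cmod (z - c) = r -> Cmod (f z) <= M) ->
  forall z, Cmod (z - c) <= r -> Cmod (f z) <= M.
Proof.
  intros Hr Hf HM z Hz.
  assert (Cf : forall z, Cmod (z - c) < R0 -> @cont C_UniformSpace f z).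
  { intros w Hw. destruct (Hf w Hw) as [l Hl]. exact (cderiv_cont _ _ _ Hl). }
  destruct (disc_max f c r) as (z0 & Hz0 & Hmax); [lra|intros w Hw; apply Cf; lra|].
  apply Rle_trans with (Cmod (f z0)); [now apply Hmax|].
  destruct (Req_dec (Cmod (z0 - c)) r) as [E|N]; [now apply HM|].
  destruct (polar (z0 - c)) as (t & _ & Et). set (s := Cmod (z0 - c)) in *.
  assert (S0 : 0 <= s) by apply Cmod_ge_0.
  set (b := circ c r t).
  assert (Hb : Cmod (b - c) = r) by (apply Cmod_circ; lra).
  apply le_epsilon. intros eps He.
  destruct (proj1 (cont_C f b) (Cf b ltac:(lra)) eps He) as (d & Hd & K).
  set (e := Rmin d (r - s) / 2).
  assert (He' : 0 < e /\ e < d /\ e < r - s).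
  { unfold e. assert (0 < Rmin d (r - s)) by (apply Rmin_glb_lt; lra).
    assert (A1 := Rmin_l d (r - s)). assert (A2 := Rmin_r d (r - s)). lra. }
  set (w := circ c (r - e) t).
  assert (Ew : f w = f z0).
  { apply (local_max_const f z0 (r - s)).
    - intros v Hv. apply Hf. assert (T := Cmod_sub_triangle v z0 c). fold s in T. lra.
    - intros v Hv. apply Hmax. assert (T := Cmod_sub_triangle v z0 c). fold s in T. lra.
    - replace (w - z0)%C with (RtoC (r - e - s) * cis t)%C.
      + rewrite Cmod_cis_scale; lra.
      + unfold w, circ. replace z0 with (c + (z0 - c))%C at 1 by ring. rewrite Et.
        rewrite !RtoC_minus. ring. }
  assert (Hw : Cmod (w - b) < d).
  { replace (w - b)%C with (RtoC (- e) * cis t)%C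
      by (unfold w, b, circ; rewrite RtoC_minus, RtoC_opp; ring).
    rewrite Cmod_mult, Cmod_cis, Cmod_R, Rabs_Ropp, Rabs_pos_eq; lra. }
  specialize (K w Hw). rewrite Ew in K. specialize (HM b Hb).
  assert (T := Cmod_reverse_triangle (f z0) (f b)). lra.
Qed.

Lemma cderiv_pow (f : C -> C) (z l : C) (n : nat) : cderiv f z l -> exists m, cderiv (fun w => f w ^ n)%C z m.
Proof.
  intros Hf. induction n as [|n [m IH]].
  - exists 0%C. simpl. apply cderiv_const.
  - eexists. simpl. apply (cderiv_mult f (fun w => f w ^ n)%C); eassumption.
Qed.

(* Schwarz's lemma argument: [f / (z - c)^n] is holomorphic for every [n]. *)
Lemma identity_disc (f : C -> C) (c : C) (R0 e : R) :
  (forall z, Cmod (z - c) < R0 -> exists l, cderiv f z l) ->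
  0 < e -> (forall z, Cmod (z - c) < e -> f z = 0%C) ->
  forall z, Cmod (z - c) < R0 -> f z = 0%C.
Proof.
  intros Hf He H0 z Hz.
  destruct (Rlt_or_le (Cmod (z - c)) e) as [|Hze]; [now apply H0|].
  set (x := Cmod (z - c)) in *. set (r := (x + R0) / 2).
  assert (Hr : x < r < R0) by (unfold r; lra).
  destruct (disc_max f c r) as (z0 & _ & Hmax); [lra| |].
  { intros w Hw. destruct (Hf w) as [l Hl]; [lra|]. exact (cderiv_cont _ _ _ Hl). }
  set (M := Cmod (f z0)) in *. assert (M0 : 0 <= M) by apply Cmod_ge_0.
  assert (Key : forall n, Cmod (f z) <= M * (x / r) ^ n).
  { intro n.
    assert (Pn : forall w, w <> c -> ((w - c) ^ n)%C <> 0%C).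
    { intros w Nw. apply Cpow_nz. now apply Cminus_neq_0. }
    assert (K : Cmod (f z / (z - c) ^ n) <= M / r ^ n).
    { apply (max_modulus_disc (fun w => f w / (w - c) ^ n)%C c r R0); try lra.
      - intros w Hw. destruct (Ceq_dec w c) as [->|Nw].
        (* Near [c] the numerator is 0, so the quotient is 0 whatever value division by zero
           returns. *)
        + exists 0%C. apply (cderiv_ext_loc (fun _ => RtoC 0) _ _ _ e He).
          * intros v Hv. rewrite (H0 v Hv). unfold Cdiv. ring.
          * apply cderiv_const.
        + destruct (Hf w Hw) as [l Hl].
          destruct (cderiv_pow (fun w => w - c)%C w (1 - 0) n) as [m Hm].
          { apply cderiv_minus; [apply cderiv_id|apply cderiv_const]. }
          eexists. apply cderiv_mult; [exact Hl|]. apply cderiv_inv; [exact Hm|now apply Pn].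
      - intros w Hw. assert (Nw : w <> c).
        { intros ->. replace (c - c)%C with (RtoC 0) in Hw by ring. rewrite Cmod_0 in Hw. lra. }
        rewrite Cmod_div by now apply Pn. rewrite Cmod_pow, Hw.
        apply Rmult_le_compat_r; [left; apply Rinv_0_lt_compat, pow_lt; lra|apply Hmax; lra].
      - fold x. lra. }
    assert (Nz : z <> c).
    { intros ->. unfold x in Hze. replace (c - c)%C with (RtoC 0) in Hze by ring. rewrite Cmod_0 in Hze. lra. }
    rewrite Cmod_div, Cmod_pow in K by now apply Pn. fold x in K.
    assert (Px : 0 < x ^ n) by (apply pow_lt; lra).
    apply Rmult_le_compat_r with (r := x ^ n) in K; [|lra].
    unfold Rdiv in K at 1. rewrite Rmult_assoc, Rinv_l, Rmult_1_r in K by lra.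
    eapply Rle_trans; [exact K|]. apply Req_le. unfold Rdiv. rewrite Rpow_mult_distr, pow_inv. ring. }
  apply Cmod_eq_0, Rle_antisym; [|apply Cmod_ge_0]. apply le_epsilon. intros eps Heps.
  assert (Hq : 0 <= x / r < 1).
  { split; [unfold Rdiv; apply Rmult_le_pos; [lra|left; apply Rinv_0_lt_compat; lra]|].
    apply Rmult_lt_reg_r with r; [lra|]. unfold Rdiv. rewrite Rmult_assoc, Rinv_l; lra. }
  destruct (pow_lt_1_zero (x / r)) with (y := eps / (M + 1)) as [N HN].
  { rewrite Rabs_pos_eq; lra. }
  { apply Rdiv_lt_0_compat; lra. }
  specialize (HN N (Nat.le_refl N)). specialize (Key N).
  rewrite Rabs_pos_eq in HN by (apply pow_le; lra).
  assert (P := pow_le (x / r) N ltac:(lra)).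
  apply Rmult_lt_compat_l with (r := M + 1) in HN; [|lra].
  replace ((M + 1) * (eps / (M + 1))) with eps in HN by (field; lra). nra.
Qed.

Section IdentityTheorem.
Context (P : C -> Prop) (G : C -> C).
Context (HP : forall z, exists e, 0 < e /\ forall w, Cmod (w - z) < e -> P w -> w = z).
Context (HG : forall z, ~ P z -> exists l, cderiv G z l).

(** Vanishing is asked only off [P], so that the property makes sense at poles too and a path may
    run through them. *)
Let vanishes_near z := exists e, 0 < e /\ forall w, Cmod (w - z) < e -> ~ P w -> G w = 0%C.

Let seg (a b : C) (t : R) : C := (a + RtoC t * (b - a))%C.

Let seg_dist a b s t : Cmod (seg a b s - seg a b t) = Rabs (s - t) * Cmod (b - a).
Proof.
  unfold seg. replace (a + RtoC s * (b - a) - (a + RtoC t * (b - a)))%C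
    with (RtoC (s - t) * (b - a))%C by (rewrite RtoC_minus; ring).
  now rewrite Cmod_mult, Cmod_R.
Qed.

Let seg_near a b d t : 0 < d -> exists d', 0 < d' /\
  forall s, Rabs (s - t) < d' -> Cmod (seg a b s - seg a b t) < d.
Proof.
  intro Hd. assert (K := Cmod_ge_0 (b - a)). exists (d / (Cmod (b - a) + 1)).
  split; [apply Rdiv_lt_0_compat; lra|]. intros s Hs. rewrite seg_dist.
  apply Rmult_lt_compat_r with (r := Cmod (b - a) + 1) in Hs; [|lra].
  replace (d / (Cmod (b - a) + 1) * (Cmod (b - a) + 1)) with d in Hs by (field; lra).
  assert (K' := Rabs_pos (s - t)). lra.
Qed.

Let vanishes_open z : vanishes_near z -> exists d, 0 < d /\
  forall w, Cmod (w - z) < d -> vanishes_near w.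
Proof.
  intros (e & He & H). exists (e / 2). split; [lra|]. intros w Hw. exists (e / 2).
  split; [lra|]. intros v Hv. apply H. assert (T := Cmod_sub_triangle v w z). lra.
Qed.

Let vanishes_closed z : ~ P z -> (forall d, 0 < d -> exists a, Cmod (a - z) < d /\ vanishes_near a) ->
  vanishes_near z.
Proof.
  intros Hz H. destruct (HP z) as (e & He & HPe).
  assert (NP : forall w, Cmod (w - z) < e -> ~ P w).
  { intros w Hw Pw. apply Hz. now rewrite <- (HPe w Hw Pw). }
  (* The disc of radius e/2 about [a] avoids [P] and contains the disc of radius e/4 about [z]. *)
  destruct (H (e / 4)) as (a & Ha & ea & Hea & HZ); [lra|].
  exists (e / 4). split; [lra|]. intros w Hw _.
  apply (identity_disc G a (e / 2) (Rmin ea (e / 2))).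
  - intros v Hv. apply HG, NP. assert (T := Cmod_sub_triangle v a z). lra.
  - apply Rmin_glb_lt; lra.
  - intros v Hv. assert (A1 := Rmin_l ea (e / 2)). assert (A2 := Rmin_r ea (e / 2)).
    apply HZ; [lra|]. apply NP. assert (T := Cmod_sub_triangle v a z). lra.
  - assert (T := Cmod_sub_triangle w z a). rewrite (Cmod_sub_sym z a) in T. lra.
Qed.

Let vanishes_segment a b : (forall t, 0 <= t <= 1 -> ~ P (seg a b t)) ->
  vanishes_near a -> vanishes_near b.
Proof.
  intros Hab Ha.
  replace b with (seg a b 1) by (unfold seg; ring).
  apply (clopen_interval (fun t => vanishes_near (seg a b t))).
  - now replace (seg a b 0) with a by (unfold seg; ring).
  - intros t _ Ht. destruct (vanishes_open _ Ht) as (d & Hd & K).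
    destruct (seg_near a b d t Hd) as (d' & Hd' & K'). exists d'. split; [exact Hd'|]. auto.
  - intros t Ht Hlim. apply vanishes_closed; [now apply Hab|]. intros d Hd.
    destruct (seg_near a b d t Hd) as (d' & Hd' & K').
    destruct (Hlim d' Hd') as (s & _ & Hs & Zs). exists (seg a b s). auto.
Qed.

(* A segment through the puncture is replaced by a two-segment detour. *)
Let vanishes_punctured p e a b : 0 < e ->
  (forall w, Cmod (w - p) < e -> P w -> w = p) ->
  Cmod (a - p) < e -> Cmod (b - p) < e -> a <> p -> b <> p ->
  vanishes_near a -> vanishes_near b.
Proof.
  intros He Hp Ha Hb Na Nb Za.
  assert (Avoid : forall u v, Cmod (u - p) < e -> Cmod (v - p) < e ->
     (forall t, 0 <= t <= 1 -> seg u v t <> p) -> forall t, 0 <= t <= 1 -> ~ P (seg u v t)).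
  { intros u v Hu Hv Hn t Ht Pt. apply (Hn t Ht), Hp; [|exact Pt].
    eapply Rle_lt_trans; [apply (disc_convex p u v (Rmax (Cmod (u - p)) (Cmod (v - p))) t)|].
    - apply Rmax_l. - apply Rmax_r. - exact Ht. - now apply Rmax_lub_lt. }
  destruct (classic (exists s, 0 <= s <= 1 /\ seg a b s = p)) as [(s & Hs & Es)|N].
  2:{ apply (vanishes_segment a b); [|exact Za]. apply Avoid; trivial.
      intros t Ht Et. apply N. now exists t. }
  assert (Nab : b <> a).
  { intros ->. apply Na. rewrite <- Es. unfold seg. ring. }
  assert (Nab' := Cminus_neq_0 _ _ Nab). assert (Lab := Cmod_sub_pos _ _ Nab).
  (* The corner [m] of the detour is [p] displaced at right angles to the segment, by a distance
     e/2. *)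
  set (eta := e / (2 * Cmod (b - a))).
  assert (Heta : 0 < eta) by (apply Rdiv_lt_0_compat; lra).
  set (m := (p + Ci * RtoC eta * (b - a))%C).
  assert (Hm : Cmod (m - p) < e).
  { replace (m - p)%C with (Ci * RtoC eta * (b - a))%C by (unfold m; ring).
    rewrite !Cmod_mult, Cmod_Ci, Cmod_R, Rabs_pos_eq by lra.
    unfold eta. replace (1 * (e / (2 * Cmod (b - a))) * Cmod (b - a)) with (e / 2) by (field; lra). lra. }
  assert (Cancel : forall u, (u * (b - a))%C = 0%C -> u = 0%C).
  { intros u Hu. destruct (Ceq_dec u 0) as [|Nu]; [assumption|].
    now destruct (Cmult_neq_0 _ _ Nu Nab'). }
  apply (vanishes_segment m b); [|apply (vanishes_segment a m); [|exact Za]]; apply Avoid; trivial;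
    intros t Ht Et.
  (* Coordinates relative to [b - a]: the imaginary part lets this leg meet [p] only at its end t =
     1, and the real part then forces s = 1, that is [p = b]. The other leg similarly gives
     [p = a]. *)
  - assert (E : ((RtoC t * (RtoC (1 - s) - Ci * RtoC eta) + Ci * RtoC eta) * (b - a))%C = 0%C).
    { replace (RtoC 0) with (seg m b t - p)%C by (rewrite Et; ring).
      unfold m, seg in *. rewrite <- Es. rewrite RtoC_minus. ring. }
    apply Cancel in E. assert (E1 := f_equal fst E). assert (E2 := f_equal snd E). simpl in E1, E2.
    assert (F1 : t * (1 - s) = 0) by lra. assert (F2 : (1 - t) * eta = 0) by lra.
    apply Rmult_integral in F1. apply Rmult_integral in F2.
    assert (s = 1) as -> by (destruct F1, F2; lra).
    apply Nb. rewrite <- Es. unfold seg. ring.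
  - assert (E : ((RtoC t * (RtoC s + Ci * RtoC eta) - RtoC s) * (b - a))%C = 0%C).
    { replace (RtoC 0) with (seg a m t - p)%C by (rewrite Et; ring).
      unfold m, seg in *. rewrite <- Es. ring. }
    apply Cancel in E. assert (E1 := f_equal fst E). assert (E2 := f_equal snd E). simpl in E1, E2.
    assert (F2 : t * eta = 0) by lra. apply Rmult_integral in F2.
    assert (s = 0) as -> by (destruct F2 as [-> |]; lra).
    apply Na. rewrite <- Es. unfold seg. ring.
Qed.

(** No path avoiding [P] has to be chosen: the straight segment is followed, and a pole [p] on it is
    passed by spreading the vanishing from a nearby point of the segment over the whole punctured
    disc about [p]. *)
Lemma identity_theorem (a : C) (e : R) : 0 < e ->
  (forall w, Cmod (w - a) < e -> ~ P w -> G w = 0%C) ->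
  forall z, ~ P z -> G z = 0%C.
Proof.
  intros He Ha z Hz.
  assert (Q : vanishes_near z).
  { replace z with (seg a z 1) by (unfold seg; ring).
    apply (clopen_interval (fun t => vanishes_near (seg a z t))).
    - replace (seg a z 0) with a by (unfold seg; ring). now exists e.
    - intros t _ Ht. destruct (vanishes_open _ Ht) as (d & Hd & K).
      destruct (seg_near a z d t Hd) as (d' & Hd' & K'). exists d'. split; [exact Hd'|]. auto.
    - intros t Ht Hlim. set (p := seg a z t) in *.
      destruct (HP p) as (ep & Hep & Hp).
      destruct (seg_near a z ep t Hep) as (d' & Hd' & K').
      destruct (Hlim d' Hd') as (s & _ & Hs & Zs). specialize (K' s Hs). fold p in K'.
      destruct (Ceq_dec (seg a z s) p) as [<-|Ns]; [exact Zs|].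
      destruct (classic (P p)) as [Pp|Np].
      + exists ep. split; [exact Hep|]. intros w Hw Nw.
        assert (Nwp : w <> p) by (intros ->; contradiction).
        destruct (vanishes_punctured p ep (seg a z s) w) as (d & Hd & K); trivial.
        apply K; [|exact Nw]. replace (w - w)%C with (RtoC 0) by ring. now rewrite Cmod_0.
      + apply vanishes_closed; [exact Np|]. intros d Hd.
        destruct (seg_near a z d t Hd) as (d'' & Hd'' & K'').
        destruct (Hlim d'' Hd'') as (s' & _ & Hs' & Zs'). exists (seg a z s'). auto. }
  destruct Q as (d & Hd & K). apply K; [|exact Hz].
  replace (z - z)%C with (RtoC 0) by ring. now rewrite Cmod_0.
Qed.

End IdentityTheorem.

(** * Elliptic functions without zeros *)

Lemma Zperiodic (g : C -> C) (w : C) : (forall z, g (z + w)%C = g z) ->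
  forall (n : Z) z, g (z + RtoC (IZR n) * w)%C = g z.
Proof.
  intros H.
  assert (Hn : forall (n : nat) z, g (z + RtoC (INR n) * w)%C = g z).
  { induction n as [|n IH]; intro z.
    - simpl. f_equal. ring.
    - rewrite S_INR, RtoC_plus. transitivity (g (z + RtoC (INR n) * w + w)%C).
      + f_equal. ring.
      + now rewrite H. }
  intros n z. destruct (Z_le_gt_dec 0 n) as [L|L].
  - rewrite <- (Z2Nat.id n L), <- INR_IZR_INZ. apply Hn.
  - rewrite <- (Hn (Z.to_nat (- n)) (z + RtoC (IZR n) * w)%C). f_equal.
    rewrite INR_IZR_INZ, Z2Nat.id, opp_IZR, RtoC_opp by lia. ring.
Qed.

Lemma lattice_reduction (w1 w2 : C) :
  (forall a b : R, (RtoC a * w1 + RtoC b * w2)%C = RtoC 0 -> a = 0 /\ b = 0) ->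
  forall z, exists (m n : Z) z', z = (z' + RtoC (IZR m) * w1 + RtoC (IZR n) * w2)%C /\
    Cmod z' <= Cmod w1 + Cmod w2.
Proof.
  intros Hind z. destruct w1 as [x1 y1] eqn:E1, w2 as [x2 y2] eqn:E2, z as [x y].
  set (D := x1 * y2 - x2 * y1).
  assert (HD : D <> 0).
  (* With a vanishing determinant, the relations with coefficients (y2, -y1) and (x2, -x1) force
     both periods to be 0, and then the coefficients (1, 1) refute independence. *)
  { intro HD. unfold D in HD.
    destruct (Hind y2 (- y1)) as [Y2 Y1]; [apply injective_projections; simpl; lra|].
    destruct (Hind x2 (- x1)) as [X2 X1]; [apply injective_projections; simpl; lra|].
    destruct (Hind 1 1) as [K _]; [apply injective_projections; simpl; lra|]. lra. }
  (* Cramer's rule; the fractional parts of the coordinates lie in [0,1), which bounds [z']. *)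
  set (a := (x * y2 - x2 * y) / D). set (b := (x1 * y - x * y1) / D).
  exists (Int_part a), (Int_part b), (RtoC (frac_part a) * w1 + RtoC (frac_part b) * w2)%C.
  rewrite E1, E2. split.
  - unfold frac_part. apply injective_projections; simpl; unfold a, b, D in *; field; exact HD.
  - eapply Rle_trans; [apply Cmod_triangle|]. rewrite !Cmod_mult, !Cmod_R.
    destruct (base_fp a) as [A1 A2]. destruct (base_fp b) as [B1 B2].
    rewrite !Rabs_pos_eq by lra.
    assert (K1 := Cmod_ge_0 (x1, y1)). assert (K2 := Cmod_ge_0 (x2, y2)). nra.
Qed.

(* [1/f], extended by [0] at the poles, is continuous and doubly periodic, so its modulus has a
   maximum; the maximum principle then applies away from the poles. *)
Lemma nonvanishing_elliptic_constant (f : C -> C) (P : C -> Prop) (w1 w2 : C) :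
  (forall z, exists e, 0 < e /\ forall w, Cmod (w - z) < e -> P w -> w = z) ->
  (forall z, ~ P z -> holo_at f z) ->
  (forall p, P p -> filterlim (fun z => Cmod (f z))
     (within (fun z => z <> p) (@locally C_UniformSpace p)) (Rbar_locally p_infty)) ->
  (forall a b : R, (RtoC a * w1 + RtoC b * w2)%C = RtoC 0 -> a = 0 /\ b = 0) ->
  (forall z, (P (z + w1)%C <-> P z) /\ (P (z + w2)%C <-> P z)) ->
  (forall z, ~ P z -> f (z + w1)%C = f z /\ f (z + w2)%C = f z) ->
  (forall z, ~ P z -> f z <> 0%C) ->
  exists v, forall z, f z = v.
Proof.
  intros HP Hf Hpole Hind HPper Hfper Hnz.
  set (g := fun z => if excluded_middle_informative (P z) then RtoC 0 else (/ f z)%C).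
  assert (gP : forall z, P z -> g z = 0%C).
  { intros z Hz. unfold g. destruct (excluded_middle_informative (P z)); [reflexivity|contradiction]. }
  assert (gN : forall z, ~ P z -> g z = (/ f z)%C).
  { intros z Hz. unfold g. destruct (excluded_middle_informative (P z)); [contradiction|reflexivity]. }
  assert (gNz : forall z, ~ P z -> g z <> 0%C).
  { intros z Hz E. rewrite gN in E by exact Hz. specialize (Hnz z Hz).
    apply C1_nz. rewrite <- (Cinv_r (f z) Hnz), E. ring. }
  assert (gPz : forall z, g z <> 0%C -> ~ P z) by (intros z Hz Pz; apply Hz, gP, Pz).
  assert (Open : forall z, ~ P z -> exists e, 0 < e /\ forall w, Cmod (w - z) < e -> ~ P w).
  { intros z Hz. destruct (HP z) as (e & He & K). exists e. split; [exact He|].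
    intros w Hw Pw. apply Hz. now rewrite <- (K w Hw Pw). }
  assert (gholo : forall z, ~ P z -> exists l, cderiv g z l).
  { intros z Hz. destruct (proj1 (holo_at_cderiv f z) (Hf z Hz)) as [l Hl].
    destruct (Open z Hz) as (e & He & K). eexists.
    apply (cderiv_ext_loc (fun w => / f w)%C _ _ _ e He).
    - intros w Hw. symmetry. apply gN, K, Hw.
    - apply cderiv_inv; [exact Hl|now apply Hnz]. }
  assert (gcont : forall z, @cont C_UniformSpace g z).
  { intro z. destruct (classic (P z)) as [Pz|Nz].
    - apply cont_C. intros eps He. rewrite (gP z Pz).
      assert (K := Hpole z Pz (fun y => / eps < y)).
      destruct (proj1 (locally_Cmod z _) (K ltac:(exists (/ eps); trivial))) as (d & Hd & Hd').
      exists d. split; [exact Hd|]. intros w Hw.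
      replace (g w - 0)%C with (g w) by ring.
      destruct (classic (P w)) as [Pw|Nw]; [rewrite (gP w Pw), Cmod_0; exact He|].
      assert (Hbig : / eps < Cmod (f w)) by (apply Hd'; [exact Hw|intros ->; contradiction]).
      rewrite (gN w Nw), Cmod_inv by (now apply Hnz).
      rewrite <- (Rinv_inv eps). apply Rinv_lt_contravar; [|exact Hbig].
      assert (0 < / eps) by now apply Rinv_0_lt_compat. apply Rmult_lt_0_compat; lra.
    - destruct (gholo z Nz) as [l Hl]. exact (cderiv_cont _ _ _ Hl). }
  assert (gper1 : forall z, g (z + w1)%C = g z).
  { intro z. destruct (classic (P z)) as [Pz|Nz].
    - rewrite !gP; trivial. now apply (proj1 (HPper z)).
    - rewrite !gN; trivial; [now rewrite (proj1 (Hfper z Nz))|].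
      intro K. apply Nz. now apply (proj1 (HPper z)). }
  assert (gper2 : forall z, g (z + w2)%C = g z).
  { intro z. destruct (classic (P z)) as [Pz|Nz].
    - rewrite !gP; trivial. now apply (proj2 (HPper z)).
    - rewrite !gN; trivial; [now rewrite (proj2 (Hfper z Nz))|].
      intro K. apply Nz. now apply (proj2 (HPper z)). }
  destruct (disc_max g 0 (Cmod w1 + Cmod w2)) as (z0 & _ & Hmax0).
  { assert (K1 := Cmod_ge_0 w1). assert (K2 := Cmod_ge_0 w2). lra. }
  { intros; apply gcont. }
  assert (Hmax : forall z, Cmod (g z) <= Cmod (g z0)).
  { intro z. destruct (lattice_reduction w1 w2 Hind z) as (m & n & z' & -> & Hz').
    rewrite (Zperiodic g w2 gper2), (Zperiodic g w1 gper1). apply Hmax0.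
    now replace (z' - 0)%C with z' by ring. }
  assert (g0 : g z0 <> 0%C).
  (* The maximum is not 0, because discreteness of [P] provides a regular point near the origin. *)
  { destruct (HP 0%C) as (e & He & K).
    assert (Np : ~ P (RtoC (e / 2))).
    { intro Pe. assert (E : RtoC (e / 2) = 0%C).
      { apply K; [|exact Pe]. replace (RtoC (e / 2) - 0)%C with (RtoC (e / 2)) by ring.
        rewrite Cmod_R, Rabs_pos_eq; lra. }
      apply RtoC_inj in E. lra. }
    assert (L := proj1 (Cmod_gt_0 _) (gNz _ Np)). apply Cmod_gt_0.
    specialize (Hmax (RtoC (e / 2))). lra. }
  (* Where [g] equals its nonzero maximal value the point is not a pole, so the maximum principle
     applies around it: the coincidence set on a segment is open, and continuity of [g] closes it.
     Afterwards [g] is nowhere 0, hence [P] is empty and [f] is constant on all of C. *)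
  assert (gconst : forall z, g z = g z0).
  { intro z.
    pose (seg := fun t => (z0 + RtoC t * (z - z0))%C).
    assert (Cs : forall t, cont seg t).
    { intro t. apply cont_plus; [apply cont_const|]. apply cont_mult; [|apply cont_const].
      apply cont_RtoC, continuous_id. }
    assert (Near : forall t d, 0 < d -> exists d', 0 < d' /\
       forall s, Rabs (s - t) < d' -> Cmod (seg s - seg t) < d).
    { intros t d Hd. destruct (Cs t d Hd) as [d' K]. exists d'. split; [apply cond_pos|exact K]. }
    replace z with (seg 1) by (unfold seg; ring).
    apply (clopen_interval (fun t => g (seg t) = g z0)).
    - f_equal. unfold seg. ring.
    - intros t _ Et. assert (Nt : ~ P (seg t)) by (apply gPz; now rewrite Et).
      destruct (Open _ Nt) as (e & He & K).
      destruct (Near t e He) as (d & Hd & Kd). exists d. split; [exact Hd|].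
      intros s _ Hs. rewrite <- Et. apply (local_max_const g (seg t) e).
      + intros w Hw. now apply gholo, K.
      + intros w _. rewrite Et. apply Hmax.
      + now apply Kd.
    - intros t _ Hlim. apply Cmod_small_eq. intros eps He.
      destruct (proj1 (cont_C g _) (gcont (seg t)) eps He) as (d & Hd & K).
      destruct (Near t d Hd) as (d' & Hd' & Kd).
      destruct (Hlim d' Hd') as (s & _ & Hs & Es). rewrite <- Es, Cmod_sub_sym.
      left. now apply K, Kd. }
  exists (/ g z0)%C. intro z. rewrite <- (gconst z).
  assert (Nz : ~ P z) by (apply gPz; now rewrite gconst).
  rewrite gN by exact Nz. field. now apply Hnz.
Qed.

(** * Power series with real coefficients *)

Lemma csum_ext (u v : nat -> C) : (forall n, u n = v n) -> csum u = csum v.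
Proof. intro H. unfold csum. f_equal; apply Series_ext; intro n; now rewrite H. Qed.

Lemma ex_series_Re_Im (u : nat -> C) : ex_series (fun n => Cmod (u n)) ->
  ex_series (fun n => Rabs (Re (u n))) /\ ex_series (fun n => Rabs (Im (u n))).
Proof.
  intro H; split; apply (@ex_series_le R_AbsRing R_CompleteNormedModule) with (2 := H); intro n;
    change norm with Rabs; simpl; rewrite Rabs_Rabsolu; [apply re_le_Cmod|apply Im_le_Cmod].
Qed.

Lemma csum_bound (u : nat -> C) (v : nat -> R) : ex_series v ->
  (forall n, Cmod (u n) <= v n) -> Cmod (csum u) <= 2 * Series v.
Proof.
  intros Hv H.
  assert (Hu : ex_series (fun n => Cmod (u n))).
  { apply (@ex_series_le R_AbsRing R_CompleteNormedModule) with (2 := Hv). intro n.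
    change norm with Rabs. rewrite Rabs_pos_eq; [apply H|apply Cmod_ge_0]. }
  destruct (ex_series_Re_Im u Hu) as [H1 H2].
  eapply Rle_trans; [apply Cmod_le_Re_Im|]. unfold csum; simpl.
  assert (K1 : Rabs (Series (fun n => Re (u n))) <= Series v).
  { eapply Rle_trans; [now apply Series_Rabs|]. apply Series_le; [|exact Hv].
    intro n. split; [apply Rabs_pos|]. eapply Rle_trans; [apply re_le_Cmod|apply H]. }
  assert (K2 : Rabs (Series (fun n => Im (u n))) <= Series v).
  { eapply Rle_trans; [now apply Series_Rabs|]. apply Series_le; [|exact Hv].
    intro n. split; [apply Rabs_pos|]. eapply Rle_trans; [apply Im_le_Cmod|apply H]. }
  lra.
Qed.

Lemma csum_plus (u v : nat -> C) :
  ex_series (fun n => Cmod (u n)) -> ex_series (fun n => Cmod (v n)) ->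
  csum (fun n => u n + v n)%C = (csum u + csum v)%C.
Proof.
  intros Hu Hv. destruct (ex_series_Re_Im u Hu) as [U1 U2]. destruct (ex_series_Re_Im v Hv) as [V1 V2].
  apply injective_projections; simpl; apply Series_plus; now apply ex_series_Rabs.
Qed.

Lemma csum_scal (c : C) (u : nat -> C) : ex_series (fun n => Cmod (u n)) ->
  csum (fun n => c * u n)%C = (c * csum u)%C.
Proof.
  intros Hu. destruct (ex_series_Re_Im u Hu) as [U1 U2].
  apply ex_series_Rabs in U1, U2.
  assert (S : forall k (x : nat -> R), ex_series x -> ex_series (fun n => k * x n))
    by (intros k x; apply (@ex_series_scal R_AbsRing R_NormedModule)).
  apply injective_projections; simpl.
  - rewrite (Series_minus (fun n => fst c * fst (u n)) (fun n => snd c * snd (u n))) by (now apply S).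
    now rewrite !Series_scal_l.
  - rewrite (Series_plus (fun n => fst c * snd (u n)) (fun n => snd c * fst (u n))) by (now apply S).
    now rewrite !Series_scal_l.
Qed.

Definition psum (a : nat -> R) (z : C) : C := csum (fun n => RtoC (a n) * z ^ n)%C.

Definition abs_conv (a : nat -> R) (z : C) : Prop := ex_series (fun n => Rabs (a n) * Cmod z ^ n).

(** Coefficients of the derived series. Together with [sseq], for multiplication by the variable, it
    turns coefficient recurrences into differential equations. *)
Definition dseq (a : nat -> R) (n : nat) : R := INR (S n) * a (S n).

Definition sseq (a : nat -> R) (n : nat) : R := match n with O => 0 | S k => a k end.

Lemma abs_conv_Cmod (a : nat -> R) (z : C) : abs_conv a z ->
  ex_series (fun n => Cmod (RtoC (a n) * z ^ n)).
Proof.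
  apply ex_series_ext. intro n. now rewrite Cmod_mult, Cmod_R, Cmod_pow.
Qed.

Lemma psum_ext (a b : nat -> R) (z : C) : (forall n, a n = b n) -> psum a z = psum b z.
Proof. intro H. apply csum_ext. intro n. now rewrite H. Qed.

Lemma psum_plus (a b : nat -> R) (z : C) : abs_conv a z -> abs_conv b z ->
  psum (fun n => a n + b n) z = (psum a z + psum b z)%C.
Proof.
  intros Ha Hb. unfold psum. rewrite <- csum_plus by now apply abs_conv_Cmod.
  apply csum_ext. intro n. rewrite RtoC_plus. ring.
Qed.

Lemma psum_scal (k : R) (a : nat -> R) (z : C) : abs_conv a z ->
  psum (fun n => k * a n) z = (RtoC k * psum a z)%C.
Proof.
  intros Ha. unfold psum. rewrite <- csum_scal by now apply abs_conv_Cmod.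
  apply csum_ext. intro n. rewrite RtoC_mult. ring.
Qed.

Lemma abs_conv_plus (a b : nat -> R) (z : C) : abs_conv a z -> abs_conv b z ->
  abs_conv (fun n => a n + b n) z.
Proof.
  intros Ha Hb. assert (H := @ex_series_plus R_AbsRing R_NormedModule _ _ Ha Hb).
  apply (@ex_series_le R_AbsRing R_CompleteNormedModule) with (2 := H). intro n.
  change norm with Rabs. simpl. change plus with Rplus. simpl.
  assert (P := pow_le (Cmod z) n (Cmod_ge_0 z)).
  rewrite Rabs_mult, Rabs_Rabsolu, (Rabs_pos_eq (Cmod z ^ n)) by exact P.
  assert (T := Rabs_triang (a n) (b n)). nra.
Qed.

Lemma abs_conv_scal (k : R) (a : nat -> R) (z : C) : abs_conv a z -> abs_conv (fun n => k * a n) z.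
Proof.
  intros Ha. assert (H := @ex_series_scal R_AbsRing R_NormedModule (Rabs k) _ Ha).
  revert H. apply ex_series_ext. intro n. change scal with Rmult. simpl.
  rewrite Rabs_mult. ring.
Qed.

Lemma abs_conv_sseq (a : nat -> R) (z : C) : abs_conv a z -> abs_conv (sseq a) z.
Proof.
  intros Ha. unfold abs_conv. apply ex_series_incr_1.
  assert (H := @ex_series_scal R_AbsRing R_NormedModule (Cmod z) _ Ha).
  revert H. apply ex_series_ext. intro n. change scal with Rmult. simpl. ring.
Qed.

Lemma csum_incr (u : nat -> C) : ex_series (fun n => Cmod (u n)) ->
  csum u = (u 0%nat + csum (fun n => u (S n)))%C.
Proof.
  intro Hu. destruct (ex_series_Re_Im u Hu) as [U1 U2].
  apply injective_projections; simpl; apply Series_incr_1; now apply ex_series_Rabs.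
Qed.

Lemma psum_sseq (a : nat -> R) (z : C) : abs_conv a z -> psum (sseq a) z = (z * psum a z)%C.
Proof.
  intro Ha. unfold psum. rewrite csum_incr by (now apply abs_conv_Cmod, abs_conv_sseq).
  rewrite <- csum_scal by now apply abs_conv_Cmod. simpl sseq.
  rewrite Cmult_0_l, Cplus_0_l. apply csum_ext. intro n. simpl. ring.
Qed.

(** Bernoulli's inequality for (sigma/rho)^n. It lets a slightly larger radius absorb a factor n, so
    formal differentiation keeps the disc of convergence. *)
Lemma nat_mul_pow_le (rho sigma : R) (n : nat) : 0 < rho < sigma ->
  INR n * rho ^ n <= rho / (sigma - rho) * sigma ^ n.
Proof.
  intro H. set (x := (sigma - rho) / rho).
  assert (Hx : 0 < x) by (apply Rdiv_lt_0_compat; lra).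
  assert (B := poly n x Hx).
  replace (sigma ^ n) with ((1 + x) ^ n * rho ^ n)
    by (rewrite <- Rpow_mult_distr; f_equal; unfold x; field; lra).
  assert (P : 0 < rho ^ n) by (apply pow_lt; lra).
  replace (rho / (sigma - rho) * ((1 + x) ^ n * rho ^ n)) with ((1 + x) ^ n * / x * rho ^ n)
    by (unfold x; field; lra).
  apply Rmult_le_compat_r; [lra|].
  apply Rmult_le_reg_r with x; [exact Hx|]. rewrite Rmult_assoc, Rinv_l by lra. lra.
Qed.

Definition summable (a : nat -> R) (R0 : R) : Prop :=
  forall rho, 0 < rho < R0 -> ex_series (fun n => Rabs (a n) * rho ^ n).

Lemma summable_abs_conv (a : nat -> R) (R0 : R) (z : C) : summable a R0 -> Cmod z < R0 -> abs_conv a z.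
Proof.
  intros Ha Hz. assert (K := Cmod_ge_0 z). set (rho := (Cmod z + R0) / 2).
  assert (Hrho : Cmod z < rho < R0) by (unfold rho; lra).
  apply (@ex_series_le R_AbsRing R_CompleteNormedModule) with (2 := Ha rho ltac:(lra)).
  intro n. change norm with Rabs. simpl. assert (P := pow_le (Cmod z) n K).
  assert (PA := Rabs_pos (a n)).
  rewrite Rabs_pos_eq by now apply Rmult_le_pos.
  apply Rmult_le_compat_l; [exact PA|]. apply pow_incr. lra.
Qed.

Lemma summable_nat_mul (a : nat -> R) (R0 : R) : summable a R0 -> summable (fun n => INR n * a n) R0.
Proof.
  intros Ha rho Hrho. set (sigma := (rho + R0) / 2). assert (Hs : rho < sigma < R0) by (unfold sigma; lra).
  assert (H := @ex_series_scal R_AbsRing R_NormedModule (rho / (sigma - rho)) _ (Ha sigma ltac:(lra))).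
  apply (@ex_series_le R_AbsRing R_CompleteNormedModule) with (2 := H). intro n.
  change norm with Rabs. change scal with Rmult. simpl.
  assert (P := pow_le rho n ltac:(lra)). assert (PA := Rabs_pos (a n)).
  rewrite !Rabs_mult, !Rabs_Rabsolu, (Rabs_pos_eq (INR n)), (Rabs_pos_eq (rho ^ n)) by (try apply pos_INR; exact P).
  assert (K := nat_mul_pow_le rho sigma n ltac:(lra)).
  apply Rmult_le_compat_l with (r := Rabs (a n)) in K; [|exact PA].
  eapply Rle_trans; [|eapply Rle_trans; [exact K|]]; apply Req_le; ring.
Qed.

Lemma summable_dseq (a : nat -> R) (R0 : R) : summable a R0 -> summable (dseq a) R0.
Proof.
  intros Ha rho Hrho. assert (H := summable_nat_mul a R0 Ha rho Hrho).
  apply ex_series_incr_1 in H.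
  assert (H' := @ex_series_scal R_AbsRing R_NormedModule (/ rho) _ H).
  revert H'. apply ex_series_ext. intro n. change scal with Rmult. unfold dseq.
  cbn [pow]. match goal with |- ?x = ?y => change (@eq R x y) end. field. lra.
Qed.

(** The derivative of z^n, by cases so that no truncated exponent n - 1 occurs. *)
Definition dpow (z : C) (n : nat) : C :=
  match n with O => RtoC 0 | S k => (RtoC (INR (S k)) * z ^ k)%C end.

Lemma mul_dpow (z : C) (n : nat) : (z * dpow z n)%C = (RtoC (INR n) * z ^ n)%C.
Proof. destruct n; [simpl; ring|cbn [dpow Cpow]; ring]. Qed.

(** Induction on n: the remainder at n + 1 is w times the remainder at n plus (w - z)^2 [dpow z n].
    The factor rho^2 on the left avoids the exponent n - 2. *)
Lemma pow_second_order (z w : C) (rho : R) (n : nat) : 0 < rho ->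
  Cmod z <= rho -> Cmod w <= rho ->
  rho ^ 2 * Cmod (w ^ n - z ^ n - (w - z) * dpow z n) <= INR n * INR n * rho ^ n * Cmod (w - z) ^ 2.
Proof.
  intros Hr Hz Hw. induction n as [|n IH].
  - simpl. replace (1 - 1 - (w - z) * 0)%C with (RtoC 0) by ring. rewrite Cmod_0. lra.
  - replace (w ^ S n - z ^ S n - (w - z) * dpow z (S n))%C
      with (w * (w ^ n - z ^ n - (w - z) * dpow z n) + (w - z) * (w - z) * dpow z n)%C.
    2:{ cbn [dpow Cpow]. rewrite S_INR, RtoC_plus.
        assert (E := mul_dpow z n).
        replace (w * (w ^ n - z ^ n - (w - z) * dpow z n) + (w - z) * (w - z) * dpow z n)%C
          with (w * w ^ n - w * z ^ n - (w - z) * (z * dpow z n))%C by ring.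
        rewrite E. ring. }
    assert (D : rho * Cmod (dpow z n) <= INR n * rho ^ n).
    { destruct n as [|n].
      - simpl. rewrite Cmod_0. lra.
      - cbn [dpow pow]. rewrite Cmod_mult, Cmod_R, Cmod_pow, Rabs_pos_eq by apply pos_INR.
        assert (P := pow_incr (Cmod z) rho n (conj (Cmod_ge_0 z) Hz)).
        assert (PI' := pos_INR (S n)).
        replace (rho * (INR (S n) * Cmod z ^ n)) with (INR (S n) * (rho * Cmod z ^ n)) by ring.
        apply Rmult_le_compat_l; [exact PI'|]. apply Rmult_le_compat_l; lra. }
    set (E := Cmod (w ^ n - z ^ n - (w - z) * dpow z n)) in *.
    assert (E0 : 0 <= E) by apply Cmod_ge_0.
    assert (T : Cmod (w * (w ^ n - z ^ n - (w - z) * dpow z n) + (w - z) * (w - z) * dpow z n) <=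
      rho * E + Cmod (w - z) ^ 2 * Cmod (dpow z n)).
    { eapply Rle_trans; [apply Cmod_triangle|]. rewrite !Cmod_mult. fold E. simpl.
      assert (Cmod w * E <= rho * E) by (apply Rmult_le_compat_r; assumption). lra. }
    set (d2 := Cmod (w - z) ^ 2) in *.
    assert (d20 : 0 <= d2) by (apply pow_le, Cmod_ge_0).
    apply Rle_trans with (rho ^ 2 * (rho * E + d2 * Cmod (dpow z n))).
    { apply Rmult_le_compat_l; [apply pow_le; lra|exact T]. }
    assert (Pn : 0 < rho ^ n) by now apply pow_lt.
    rewrite S_INR. cbn [pow] in *. rewrite Rmult_1_r in *.
    assert (Q := pos_INR n). set (N := INR n) in *.
    assert (A1 : rho * (rho * rho * E) <= rho * (N * N * rho ^ n * d2)) by (apply Rmult_le_compat_l; lra).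
    assert (A2 : rho * d2 * (rho * Cmod (dpow z n)) <= rho * d2 * (N * rho ^ n))
      by (apply Rmult_le_compat_l; [nra|lra]).
    assert (A3 : 0 <= (N + 1) * (rho * rho ^ n * d2)).
    { apply Rmult_le_pos; [lra|]. apply Rmult_le_pos; [nra|lra]. }
    nra.
Qed.

(** The termwise remainders of [pow_second_order] are summed; the series of n^2 |a_n| rho^n
    converges, so the total remainder is quadratic in w - z. *)
Lemma cderiv_psum (a : nat -> R) (R0 : R) (z : C) : summable a R0 -> Cmod z < R0 ->
  cderiv (psum a) z (psum (dseq a) z).
Proof.
  intros Ha Hz. assert (Kz := Cmod_ge_0 z). set (rho := (Cmod z + R0) / 2).
  assert (Hrho : Cmod z < rho < R0) by (unfold rho; lra).
  set (v := fun n => Rabs (INR n * (INR n * a n)) * rho ^ n).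
  assert (Hv : ex_series v).
  { apply (summable_nat_mul _ R0); [now apply summable_nat_mul|lra]. }
  set (S := Series v).
  assert (S0 : 0 <= S).
  { assert (K := csum_bound (fun _ => RtoC 0) v Hv).
    assert (K' := Cmod_ge_0 (csum (fun _ => RtoC 0))). fold S in K.
    assert (Cmod (csum (fun _ => RtoC 0)) <= 2 * S).
    { apply K. intro n. rewrite Cmod_0. apply Rmult_le_pos; [apply Rabs_pos|apply pow_le; lra]. }
    lra. }
  assert (Key : forall w, Cmod (w - z) < rho - Cmod z ->
     Cmod (psum a w - psum a z - (w - z) * psum (dseq a) z) <= 2 * (Cmod (w - z) ^ 2 / rho ^ 2 * S)).
  { intros w Hw.
    assert (Hw' : Cmod w < rho) by (assert (T := Cmod_reverse_triangle w z); lra).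
    assert (Aw := abs_conv_Cmod _ _ (summable_abs_conv a R0 w Ha ltac:(lra))).
    assert (Az := abs_conv_Cmod _ _ (summable_abs_conv a R0 z Ha ltac:(lra))).
    assert (Dz := abs_conv_Cmod _ _ (summable_abs_conv _ R0 z (summable_dseq a R0 Ha) ltac:(lra))).
    assert (Dz' : ex_series (fun n => Cmod (RtoC (a n) * dpow z n))).
    { apply ex_series_incr_1. revert Dz. apply ex_series_ext. intro n. f_equal.
      unfold dseq. cbn [dpow]. rewrite RtoC_mult. ring. }
    assert (E : psum (dseq a) z = csum (fun n => RtoC (a n) * dpow z n)%C).
    { rewrite csum_incr by exact Dz'. cbn [dpow]. rewrite Cmult_0_r, Cplus_0_l.
      apply csum_ext. intro n. unfold dseq. rewrite RtoC_mult. ring. }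
    assert (SS : forall (c : C) u, ex_series (fun n => Cmod (u n)) -> ex_series (fun n => Cmod (c * u n))).
    { intros c u Hu. assert (H := @ex_series_scal R_AbsRing R_NormedModule (Cmod c) _ Hu).
      revert H. apply ex_series_ext. intro n. now rewrite Cmod_mult. }
    replace (psum a w - psum a z - (w - z) * psum (dseq a) z)%C
      with (csum (fun n => RtoC (a n) * (w ^ n - z ^ n - (w - z) * dpow z n))%C).
    2:{ rewrite E. unfold psum.
        transitivity (csum (fun n => RtoC (a n) * w ^ n + (- (1) * (RtoC (a n) * z ^ n)
           + (- (w - z)) * (RtoC (a n) * dpow z n)))%C).
        { apply csum_ext. intro n. ring. }
        rewrite csum_plus; [rewrite csum_plus; [rewrite !csum_scal|..]|..]; auto.
        - ring.
        - apply (@ex_series_le R_AbsRing R_CompleteNormedModule) with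
            (b := fun n => plus (Cmod (- (1) * (RtoC (a n) * z ^ n))) (Cmod (- (w - z) * (RtoC (a n) * dpow z n)))).
          + intro n. change norm with Rabs. rewrite Rabs_pos_eq by apply Cmod_ge_0. apply Cmod_triangle.
          + apply (@ex_series_plus R_AbsRing R_NormedModule); auto. }
    unfold S. rewrite <- Series_scal_l. apply csum_bound.
    - apply (@ex_series_scal R_AbsRing R_NormedModule). exact Hv.
    - intro n. rewrite Cmod_mult, Cmod_R. unfold v.
      assert (B := pow_second_order z w rho n ltac:(lra) ltac:(lra) ltac:(lra)).
      rewrite !Rabs_mult, (Rabs_pos_eq (INR n)) by apply pos_INR.
      assert (R2 : 0 < rho ^ 2) by (apply pow_lt; lra).
      apply Rmult_le_reg_l with (rho ^ 2); [exact R2|].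
      replace (rho ^ 2 * (Cmod (w - z) ^ 2 / rho ^ 2 * (INR n * (INR n * Rabs (a n)) * rho ^ n)))
        with (Rabs (a n) * (INR n * INR n * rho ^ n * Cmod (w - z) ^ 2)) by (field; lra).
      assert (PA := Rabs_pos (a n)). 
      rewrite <- Rmult_assoc, (Rmult_comm (rho ^ 2)), Rmult_assoc.
      now apply Rmult_le_compat_l. }
  apply cderiv_eps. intros eps He.
  set (c := 2 * S / rho ^ 2).
  assert (R2 : 0 < rho ^ 2) by (apply pow_lt; lra).
  assert (c0 : 0 <= c).
  { unfold c, Rdiv. apply Rmult_le_pos; [lra|left; now apply Rinv_0_lt_compat]. }
  exists (Rmin (rho - Cmod z) (eps / (c + 1))).
  assert (Hd : 0 < eps / (c + 1)) by (apply Rdiv_lt_0_compat; lra).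
  split; [apply Rmin_glb_lt; lra|]. intros w Hw.
  assert (M1 := Rmin_l (rho - Cmod z) (eps / (c + 1))).
  assert (M2 := Rmin_r (rho - Cmod z) (eps / (c + 1))).
  eapply Rle_trans; [apply Key; lra|].
  assert (K := Cmod_ge_0 (w - z)). set (x := Cmod (w - z)) in *.
  replace (2 * (x ^ 2 / rho ^ 2 * S)) with (c * x * x) by (unfold c; field; lra).
  apply Rmult_le_compat_r; [exact K|].
  assert (Hx : x < eps / (c + 1)) by lra.
  apply Rmult_lt_compat_l with (r := c + 1) in Hx; [|lra].
  replace ((c + 1) * (eps / (c + 1))) with eps in Hx by (field; lra). lra.
Qed.

(** * Sine, cosine and the hypergeometric function *)

Lemma psum_at_0 (a : nat -> R) (R0 : R) : 0 < R0 -> summable a R0 -> psum a 0 = RtoC (a 0%nat).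
Proof.
  intros HR Ha. unfold psum. rewrite csum_incr.
  - replace (csum (fun n => RtoC (a (S n)) * 0 ^ S n)%C) with (RtoC 0); [simpl; ring|].
    assert (Z : Series (fun _ : nat => 0 * 0) = 0) by (rewrite Series_scal_l; ring).
    symmetry. transitivity (csum (fun _ => RtoC 0)).
    + apply csum_ext. intro n. simpl. ring.
    + apply injective_projections; simpl; (transitivity (Series (fun _ : nat => 0 * 0));
        [apply Series_ext; intro n; unfold Re, Im; simpl; ring|exact Z]).
  - apply abs_conv_Cmod, (summable_abs_conv a R0); [exact Ha|now rewrite Cmod_0].
Qed.

Lemma psum_lin (k : R) (a b : nat -> R) (z : C) : abs_conv a z -> abs_conv b z ->
  psum (fun n => a n + k * b n) z = (psum a z + RtoC k * psum b z)%C.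
Proof.
  intros Ha Hb. rewrite (psum_plus a (fun n => k * b n)), psum_scal; trivial.
  now apply abs_conv_scal.
Qed.

Lemma abs_conv_lin (k : R) (a b : nat -> R) (z : C) : abs_conv a z -> abs_conv b z ->
  abs_conv (fun n => a n + k * b n) z.
Proof. intros Ha Hb. apply (abs_conv_plus a (fun n => k * b n)); [|apply abs_conv_scal]; trivial. Qed.

Lemma sseq_dseq (a : nat -> R) (n : nat) : sseq (dseq a) n = INR n * a n.
Proof. destruct n; [simpl; ring|reflexivity]. Qed.

(** * Sine and cosine as series in the square of the variable *)

Definition sin_coef (n : nat) : R := (-1) ^ n / INR (Factorial.fact (2 * n + 1)).
Definition cos_coef (n : nat) : R := (-1) ^ n / INR (Factorial.fact (2 * n)).

Lemma summable_sign_div_fact (k : nat -> nat) (R0 : R) : (forall n, (n <= k n)%nat) ->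
  summable (fun n => (-1) ^ n / INR (Factorial.fact (k n))) R0.
Proof.
  intros Hk rho Hrho.
  apply (@ex_series_le R_AbsRing R_CompleteNormedModule) with (b := fun n => / INR (Factorial.fact n) * rho ^ n).
  - intro n. change norm with Rabs. simpl.
    assert (P : 0 < rho ^ n) by (apply pow_lt; lra).
    assert (F : 0 < INR (Factorial.fact n)) by apply INR_fact_lt_0.
    assert (F' : INR (Factorial.fact n) <= INR (Factorial.fact (k n))) by (apply le_INR, Factorial.fact_le, Hk).
    rewrite Rabs_pos_eq by (apply Rmult_le_pos; [apply Rabs_pos|lra]).
    unfold Rdiv. rewrite Rabs_mult, pow_1_abs, Rmult_1_l, Rabs_pos_eq by (left; apply Rinv_0_lt_compat; lra).
    apply Rmult_le_compat_r; [lra|]. now apply Rinv_le_contravar.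
  - exists (exp rho). apply is_pseries_R, is_exp_Reals.
Qed.

Lemma summable_sin_coef (R0 : R) : summable sin_coef R0.
Proof. apply (summable_sign_div_fact (fun n => 2 * n + 1)%nat). lia. Qed.

Lemma summable_cos_coef (R0 : R) : summable cos_coef R0.
Proof. apply (summable_sign_div_fact (fun n => 2 * n)%nat). lia. Qed.

Lemma Cpow_even (z : C) (n : nat) : (z ^ (2 * n))%C = ((z * z) ^ n)%C.
Proof.
  induction n as [|n IH]; [reflexivity|].
  replace (2 * S n)%nat with (S (S (2 * n))) by lia. simpl Cpow in *. rewrite <- IH. simpl. ring.
Qed.

Lemma csin_psum (z : C) : csin z = (z * psum sin_coef (z * z))%C.
Proof.
  unfold psum. rewrite <- csum_scal.
  - apply csum_ext. intro n. rewrite Nat.add_1_r. change (z ^ S (2 * n))%C with (z * z ^ (2 * n))%C.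
    rewrite Cpow_even. unfold sin_coef. rewrite Nat.add_1_r. ring.
  - apply abs_conv_Cmod, (summable_abs_conv _ (Cmod (z * z) + 1)); [apply summable_sin_coef|lra].
Qed.

Lemma ccos_psum (z : C) : ccos z = psum cos_coef (z * z).
Proof. apply csum_ext. intro n. now rewrite Cpow_even. Qed.

#[local] Opaque csin ccos csum.

(** Write cos z = C(y) and sin z = z S(y) with y = z^2. Then cos' = -sin reads C' = -S/2, and sin' =
    cos reads S + 2 y S' = C, which is the next lemma. *)
Lemma dseq_cos_coef (n : nat) : dseq cos_coef n = - (1/2) * sin_coef n.
Proof.
  unfold dseq, cos_coef, sin_coef.
  replace (2 * S n)%nat with (S (2 * n + 1)) by lia.
  rewrite fact_simpl, mult_INR, (S_INR (2 * n + 1)), plus_INR, mult_INR, S_INR.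
  assert (F := INR_fact_neq_0 (2 * n + 1)). assert (P := pos_INR n). simpl. field. split; [exact F|lra].
Qed.

Lemma sin_coef_cos_coef (n : nat) : sin_coef n + 2 * sseq (dseq sin_coef) n = cos_coef n.
Proof.
  rewrite sseq_dseq. unfold cos_coef, sin_coef. rewrite Nat.add_1_r.
  rewrite fact_simpl, mult_INR, S_INR, mult_INR.
  assert (F := INR_fact_neq_0 (2 * n)). assert (P := pos_INR n). simpl (INR 2). field. split; [exact F|lra].
Qed.

Lemma cderiv_psum_comp (a : nat -> R) (R0 : R) (f : C -> C) (z l : C) : summable a R0 ->
  Cmod (f z) < R0 -> cderiv f z l -> cderiv (fun w => psum a (f w)) z (psum (dseq a) (f z) * l).
Proof. intros Ha Hz Hf. apply (cderiv_comp (psum a)); [now apply (cderiv_psum a R0)|exact Hf]. Qed.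

Lemma cderiv_square (f : C -> C) (z l : C) : cderiv f z l -> cderiv (fun w => f w * f w)%C z (2 * f z * l).
Proof. intro H. eapply cderiv_eq; [apply cderiv_mult; exact H|]. ring. Qed.

Lemma cderiv_csin (z : C) : cderiv csin z (ccos z).
Proof.
  set (R0 := Cmod (z * z) + 1). assert (HR : Cmod (z * z) < R0) by (unfold R0; lra).
  apply (cderiv_ext_loc (fun w => w * psum sin_coef (w * w))%C _ _ _ 1); [lra| |].
  - intros w _. symmetry. apply csin_psum.
  - eapply cderiv_eq.
    + apply cderiv_mult; [apply cderiv_id|].
      apply (cderiv_psum_comp sin_coef R0 (fun w => w * w)%C); [apply summable_sin_coef|exact HR|].
      apply cderiv_square, cderiv_id.
    + cbv beta. rewrite ccos_psum.
      assert (A1 := summable_abs_conv _ R0 (z * z)%C (summable_sin_coef R0) HR).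
      assert (A2 := summable_abs_conv _ R0 (z * z)%C (summable_dseq _ _ (summable_sin_coef R0)) HR).
      rewrite <- (psum_ext _ _ _ sin_coef_cos_coef), psum_lin, psum_sseq; trivial; [ring|now apply abs_conv_sseq].
Qed.

Lemma cderiv_ccos (z : C) : cderiv ccos z (- csin z).
Proof.
  set (R0 := Cmod (z * z) + 1). assert (HR : Cmod (z * z) < R0) by (unfold R0; lra).
  apply (cderiv_ext_loc (fun w => psum cos_coef (w * w))%C _ _ _ 1); [lra| |].
  - intros w _. symmetry. apply ccos_psum.
  - eapply cderiv_eq.
    + apply (cderiv_psum_comp cos_coef R0 (fun w => w * w)%C); [apply summable_cos_coef|exact HR|].
      apply cderiv_square, cderiv_id.
    + cbv beta. rewrite csin_psum.
      assert (A1 := summable_abs_conv _ R0 (z * z)%C (summable_sin_coef R0) HR).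
      rewrite (psum_ext _ _ _ dseq_cos_coef), psum_scal by exact A1.
      rewrite RtoC_opp. replace (RtoC (1/2)) with (/ 2)%C by (unfold Rdiv; rewrite Rmult_1_l, RtoC_inv; trivial; lra).
      field.
Qed.

Lemma cderiv_csin_comp (f : C -> C) (z l : C) : cderiv f z l ->
  cderiv (fun w => csin (f w)) z (ccos (f z) * l).
Proof. apply cderiv_comp, cderiv_csin. Qed.

Lemma cderiv_ccos_comp (f : C -> C) (z l : C) : cderiv f z l ->
  cderiv (fun w => ccos (f w)) z (- csin (f z) * l).
Proof. apply cderiv_comp, cderiv_ccos. Qed.

Lemma csin_0 : csin 0 = 0%C.
Proof. rewrite csin_psum. ring. Qed.

Lemma ccos_0 : ccos 0 = 1%C.
Proof.
  rewrite ccos_psum, Cmult_0_l, (psum_at_0 _ 1); [|lra|apply summable_cos_coef].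
  unfold cos_coef. simpl. f_equal. field.
Qed.

Lemma csin_opp (z : C) : csin (- z) = (- csin z)%C.
Proof. rewrite !csin_psum. replace (- z * - z)%C with (z * z)%C by ring. ring. Qed.

Lemma ccos_opp (z : C) : ccos (- z) = ccos z.
Proof. rewrite !ccos_psum. now replace (- z * - z)%C with (z * z)%C by ring. Qed.

(** With z + w held fixed, cos v cos(z + w - v) - sin v sin(z + w - v) has derivative 0 in v; the
    values at v = 0 and v = z are compared. The sine is treated alike. *)
Lemma ccos_plus (z w : C) : ccos (z + w) = (ccos z * ccos w - csin z * csin w)%C.
Proof.
  assert (K := cderiv_zero_const (fun v => ccos v * ccos (z + w - v) - csin v * csin (z + w - v))%C 0 z).
  cbv beta in K. rewrite csin_0, ccos_0 in K.
  replace (z + w - 0)%C with (z + w)%C in K by ring. replace (z + w - z)%C with w in K by ring.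
  rewrite K; [ring|]. intros t _. set (v0 := (0 + RtoC t * (z - 0))%C). clearbody v0.
  assert (dl : cderiv (fun v => z + w - v)%C v0 (0 - 1)) by (apply cderiv_minus; [apply cderiv_const|apply cderiv_id]).
  eapply cderiv_eq.
  - apply cderiv_minus; apply cderiv_mult;
      [ apply cderiv_ccos | apply (cderiv_ccos_comp (fun v => z + w - v)%C), dl
      | apply cderiv_csin | apply (cderiv_csin_comp (fun v => z + w - v)%C), dl ].
  - cbv beta. ring.
Qed.

Lemma csin_plus (z w : C) : csin (z + w) = (csin z * ccos w + ccos z * csin w)%C.
Proof.
  assert (K := cderiv_zero_const (fun v => csin v * ccos (z + w - v) + ccos v * csin (z + w - v))%C 0 z).
  cbv beta in K. rewrite csin_0, ccos_0 in K.
  replace (z + w - 0)%C with (z + w)%C in K by ring. replace (z + w - z)%C with w in K by ring.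
  rewrite K; [ring|]. intros t _. set (v0 := (0 + RtoC t * (z - 0))%C). clearbody v0.
  assert (dl : cderiv (fun v => z + w - v)%C v0 (0 - 1)) by (apply cderiv_minus; [apply cderiv_const|apply cderiv_id]).
  eapply cderiv_eq.
  - apply cderiv_plus; apply cderiv_mult;
      [ apply cderiv_csin | apply (cderiv_ccos_comp (fun v => z + w - v)%C), dl
      | apply cderiv_ccos | apply (cderiv_csin_comp (fun v => z + w - v)%C), dl ].
  - cbv beta. ring.
Qed.

Lemma ccos2_csin2 (z : C) : (ccos z * ccos z + csin z * csin z = 1)%C.
Proof.
  assert (K := ccos_plus z (- z)). rewrite ccos_opp, csin_opp in K.
  replace (z + - z)%C with (RtoC 0) in K by ring. rewrite ccos_0 in K. rewrite K. ring.
Qed.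

(** * The Gauss series F(1/6, 5/6; 1/2; x) and its trigonometric form *)

Definition hyp_coef (n : nat) : R :=
  poch (1/6) n * poch (5/6) n / (poch (1/2) n * INR (Factorial.fact n)).

Lemma poch_pos (a : R) (n : nat) : 0 < a -> 0 < poch a n.
Proof.
  intro Ha. induction n as [|n IH]; simpl; [lra|]. assert (P := pos_INR n). nra.
Qed.

Lemma hyp_coef_S (n : nat) :
  (INR n + 1) * (INR n + 1/2) * hyp_coef (S n) = (INR n * INR n + INR n + 5/36) * hyp_coef n.
Proof.
  unfold hyp_coef. rewrite fact_simpl, mult_INR, S_INR. simpl poch.
  assert (F := INR_fact_neq_0 n). assert (P := pos_INR n). assert (Q := poch_pos (1/2) n ltac:(lra)).
  field. repeat split; lra.
Qed.

Lemma hyp_coef_bound (n : nat) : 0 <= hyp_coef n <= 1.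
Proof.
  induction n as [|n IH].
  - unfold hyp_coef. simpl. lra.
  - assert (K := hyp_coef_S n). assert (P := pos_INR n). split; apply Rnot_lt_le; intro; nra.
Qed.

Lemma summable_hyp_coef : summable hyp_coef 1.
Proof.
  intros rho Hrho.
  apply (@ex_series_le R_AbsRing R_CompleteNormedModule) with (b := fun n => rho ^ n).
  - intro n. change norm with Rabs. simpl. assert (K := hyp_coef_bound n).
    assert (P : 0 < rho ^ n) by (apply pow_lt; lra).
    rewrite Rabs_mult, Rabs_Rabsolu, !Rabs_pos_eq by lra. nra.
  - apply ex_series_geom. rewrite Rabs_pos_eq; lra.
Qed.

(** Gauss's equation with c = 1/2, a + b + 1 = 2 and ab = 5/36; coefficientwise it is the recurrence
    [hyp_coef_S]. *)
Lemma hypergeometric_equation (x : C) : Cmod x < 1 ->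
  (x * (1 - x) * psum (dseq (dseq hyp_coef)) x + (RtoC (1/2) - 2 * x) * psum (dseq hyp_coef) x
   - RtoC (5/36) * psum hyp_coef x = 0)%C.
Proof.
  intro Hx.
  set (a := hyp_coef). set (a1 := dseq a). set (a2 := dseq a1).
  assert (C0 : abs_conv a x) by (apply (summable_abs_conv _ 1); [apply summable_hyp_coef|exact Hx]).
  assert (C1 : abs_conv a1 x) by (apply (summable_abs_conv _ 1); [apply summable_dseq, summable_hyp_coef|exact Hx]).
  assert (C2 : abs_conv a2 x) by (apply (summable_abs_conv _ 1); [do 2 apply summable_dseq; apply summable_hyp_coef|exact Hx]).
  assert (D1 := abs_conv_sseq _ _ C1). assert (D2 := abs_conv_sseq _ _ C2).
  assert (D3 := abs_conv_sseq _ _ D2).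
  (* The left-hand side is built up one summand at a time in the shape required by [psum_lin], which
     later peels the summands off again. *)
  pose (u1 := fun n => sseq a2 n + (-1) * sseq (sseq a2) n).
  pose (u2 := fun n => u1 n + (1/2) * a1 n).
  pose (u3 := fun n => u2 n + (-2) * sseq a1 n).
  pose (u4 := fun n => u3 n + - (5/36) * a n).
  assert (U1 : abs_conv u1 x) by now apply abs_conv_lin.
  assert (U2 : abs_conv u2 x) by now apply abs_conv_lin.
  assert (U3 : abs_conv u3 x) by now apply abs_conv_lin.
  assert (Z : psum u4 x = 0%C).
  { transitivity (psum (fun n => 0 * a n) x).
    - apply psum_ext. intro n. unfold u4, u3, u2, u1.
      assert (E2 : sseq a2 n = INR n * a1 n) by apply sseq_dseq.
      assert (E1 : sseq a1 n = INR n * a n) by apply sseq_dseq.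
      assert (E0 : a1 n = (INR n + 1) * a (S n)) by (unfold a1, dseq; now rewrite S_INR).
      assert (E3 : sseq (sseq a2) n = INR n * (INR n - 1) * a n).
      { destruct n as [|n]; [simpl; ring|]. simpl sseq at 1. unfold a2. rewrite sseq_dseq.
        unfold a1, dseq. rewrite S_INR. ring. }
      rewrite E2, E1, E3, E0. assert (K := hyp_coef_S n). fold a in K. lra.
    - rewrite psum_scal by exact C0. ring. }
  unfold u4 in Z. rewrite psum_lin in Z by trivial.
  unfold u3 in Z. rewrite psum_lin in Z by trivial.
  unfold u2 in Z. rewrite psum_lin in Z by trivial.
  unfold u1 in Z. rewrite psum_lin in Z by trivial.
  rewrite !psum_sseq in Z by trivial. rewrite <- Z, !RtoC_opp. ring.
Qed.

Lemma RtoC_neq_0 (x : R) : x <> 0 -> RtoC x <> 0%C.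
Proof. intros N E. now apply RtoC_inj in E. Qed.

(* With G(v) = cos v F(sin^2 v), the hypergeometric equation becomes G'' = -(4/9) G. *)
Lemma hyp_trig : exists d, 0 < d /\ forall v, Cmod v < d -> Cmod (csin v) < 1 /\
  (hyp2F1 (1/6) (5/6) (1/2) (csin v * csin v) * ccos v = ccos (RtoC (2/3) * v))%C.
Proof.
  destruct (proj1 (cont_C csin 0) (cderiv_cont _ _ _ (cderiv_csin 0)) 1) as (d & Hd & Hs); [lra|].
  exists d. split; [exact Hd|].
  assert (Hs' : forall v, Cmod v < d -> Cmod (csin v) < 1).
  { intros v Hv. specialize (Hs v). rewrite csin_0 in Hs.
    replace (csin v - 0)%C with (csin v) in Hs by ring. apply Hs. now replace (v - 0)%C with v by ring. }
  intros v Hv. split; [now apply Hs'|].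
  pose (x := fun v => (csin v * csin v)%C).
  assert (Hx : forall v, Cmod v < d -> Cmod (x v) < 1).
  { intros u Hu. unfold x. rewrite Cmod_mult. specialize (Hs' u Hu). assert (K := Cmod_ge_0 (csin u)). nra. }
  pose (F0 := psum hyp_coef). pose (F1 := psum (dseq hyp_coef)). pose (F2 := psum (dseq (dseq hyp_coef))).
  pose (G0 := fun v => (ccos v * F0 (x v))%C).
  pose (G1 := fun v => (- csin v * F0 (x v) + 2 * (csin v * (ccos v * ccos v)) * F1 (x v))%C).
  assert (dx : forall u, cderiv x u (2 * csin u * ccos u)) by (intro u; apply cderiv_square, cderiv_csin).
  assert (dF0 : forall u, Cmod u < d -> cderiv (fun u => F0 (x u)) u (F1 (x u) * (2 * csin u * ccos u))).
  { intros u Hu. apply (cderiv_psum_comp _ 1); [apply summable_hyp_coef|now apply Hx|apply dx]. }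
  assert (dF1 : forall u, Cmod u < d -> cderiv (fun u => F1 (x u)) u (F2 (x u) * (2 * csin u * ccos u))).
  { intros u Hu. apply (cderiv_psum_comp _ 1); [apply summable_dseq, summable_hyp_coef|now apply Hx|apply dx]. }
  assert (dG0 : forall u, Cmod u < d -> cderiv G0 u (G1 u)).
  { intros u Hu. eapply cderiv_eq.
    - apply cderiv_mult; [apply cderiv_ccos|now apply dF0].
    - unfold G1. ring. }
  assert (dG1 : forall u, Cmod u < d -> cderiv G1 u (- RtoC (4/9) * G0 u)).
  { intros u Hu. eapply cderiv_eq.
    - apply cderiv_plus; apply cderiv_mult.
      + apply cderiv_opp, cderiv_csin.
      + now apply dF0.
      + apply cderiv_mult; [apply cderiv_const|]. apply cderiv_mult; [apply cderiv_csin|].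
        apply cderiv_mult; apply cderiv_ccos.
      + now apply dF1.
    - cbv beta. assert (K := hypergeometric_equation (x u) (Hx u Hu)).
      fold F0 in K. fold F1 in K. fold F2 in K. unfold G0.
      assert (T := ccos2_csin2 u).
      assert (Ec : (1 - x u = ccos u * ccos u)%C) by (unfold x; rewrite <- T; ring).
      rewrite Ec in K. unfold x in K.
      assert (E1 : (RtoC (4/9) + 4 * RtoC (5/36) - 1 = 0)%C)
        by (rewrite <- RtoC_mult, <- RtoC_plus, <- RtoC_minus; f_equal; field).
      assert (E2 : (1 - 2 * RtoC (1/2) = 0)%C) by (rewrite <- RtoC_mult, <- RtoC_minus; f_equal; field).
      change (F0 (csin u * csin u)%C) with (F0 (x u)) in K.
      change (F1 (csin u * csin u)%C) with (F1 (x u)) in K.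
      change (F2 (csin u * csin u)%C) with (F2 (x u)) in K.
      set (c := ccos u) in *. set (s := csin u) in *.
      set (f0 := F0 (x u)) in *. set (f1 := F1 (x u)) in *. set (f2 := F2 (x u)) in *.
      set (lhs := (s * s * (c * c) * f2 + (RtoC (1/2) - 2 * (s * s)) * f1 - RtoC (5/36) * f0)%C) in K.
      (* The derivative of [G1] is written as -(4/9) [G0] plus multiples of four vanishing
         quantities: the hypergeometric equation, the Pythagorean identity and two numerical
         identities, whose constants are opaque to [ring]. *)
      transitivity (- RtoC (4/9) * (c * f0) + 4 * (c * lhs) + 2 * c * f1 * (c * c + s * s - 1)
        + c * f0 * (RtoC (4/9) + 4 * RtoC (5/36) - 1) + 2 * c * f1 * (1 - 2 * RtoC (1/2)))%C.
      + unfold lhs. ring.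
      + rewrite K, T, E1, E2. ring. }
  pose (k := RtoC (2/3)).
  assert (kk : (k * k)%C = RtoC (4/9)) by (unfold k; rewrite <- RtoC_mult; f_equal; field).
  assert (k0 : k <> 0%C) by (apply RtoC_neq_0; lra).
  assert (dk : forall u, cderiv (fun u => k * u)%C u k).
  { intro u. eapply cderiv_eq; [apply (cderiv_mult (fun _ => k) (fun u => u)); [apply cderiv_const|apply cderiv_id]|]. ring. }
  assert (Hseg : forall t, 0 <= t <= 1 -> Cmod (0 + RtoC t * (v - 0)) < d).
  { intros t Ht. replace (0 + RtoC t * (v - 0))%C with (RtoC t * v)%C by ring.
    rewrite Cmod_mult, Cmod_R, Rabs_pos_eq by lra. assert (K := Cmod_ge_0 v). nra. }
  (* Uniqueness for G'' = -k^2 G by two first integrals, k G cos(kv) - G' sin(kv) and k G sin(kv) +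
     G' cos(kv). Their values at 0 are k and 0, and eliminating G' leaves G = cos(kv). *)
  assert (H1 := cderiv_zero_const (fun u => k * (G0 u * ccos (k * u)) - G1 u * csin (k * u))%C 0 v).
  assert (H2 := cderiv_zero_const (fun u => k * (G0 u * csin (k * u)) + G1 u * ccos (k * u))%C 0 v).
  cbv beta in H1, H2. rewrite Cmult_0_r, csin_0, ccos_0 in H1, H2.
  assert (G00 : G0 0%C = 1%C).
  { unfold G0, x. rewrite csin_0, ccos_0, Cmult_0_l. unfold F0.
    rewrite (psum_at_0 _ 1); [|lra|apply summable_hyp_coef].
    replace (hyp_coef 0) with 1 by (unfold hyp_coef; simpl; field). ring. }
  assert (G10 : G1 0%C = 0%C) by (unfold G1; rewrite csin_0; ring).
  rewrite G00, G10 in H1, H2.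
  assert (E1 : (k * (G0 v * ccos (k * v)) - G1 v * csin (k * v))%C = k).
  { rewrite H1; [ring|]. intros t Ht. specialize (Hseg t Ht).
    set (u := (0 + RtoC t * (v - 0))%C) in *. clearbody u.
    eapply cderiv_eq.
    - apply cderiv_minus; [apply cderiv_mult; [apply cderiv_const|]|]; apply cderiv_mult;
        [now apply dG0|apply cderiv_ccos_comp, dk|now apply dG1|apply cderiv_csin_comp, dk].
    - cbv beta. rewrite <- kk. ring. }
  assert (E2 : (k * (G0 v * csin (k * v)) + G1 v * ccos (k * v))%C = 0%C).
  { rewrite H2; [ring|]. intros t Ht. specialize (Hseg t Ht).
    set (u := (0 + RtoC t * (v - 0))%C) in *. clearbody u.
    eapply cderiv_eq.
    - apply cderiv_plus; [apply cderiv_mult; [apply cderiv_const|]|]; apply cderiv_mult;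
        [now apply dG0|apply cderiv_csin_comp, dk|now apply dG1|apply cderiv_ccos_comp, dk].
    - cbv beta. rewrite <- kk. ring. }
  transitivity (G0 v); [unfold G0, F0, x; rewrite Cmult_comm; reflexivity|].
  assert (T := ccos2_csin2 (k * v)).
  assert (E3 : (k * G0 v = k * ccos (k * v))%C).
  { replace (k * G0 v)%C with ((k * (G0 v * ccos (k * v)) - G1 v * csin (k * v)) * ccos (k * v)
      + (k * (G0 v * csin (k * v)) + G1 v * ccos (k * v)) * csin (k * v)
      + k * G0 v * (1 - (ccos (k * v) * ccos (k * v) + csin (k * v) * csin (k * v))))%C by ring.
    rewrite E1, E2, T. ring. }
  fold k. rewrite <- (Cmult_1_l (G0 v)), <- (Cmult_1_l (ccos (k * v))), <- (Cinv_l k k0).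
  rewrite <- !Cmult_assoc, E3. reflexivity.
Qed.

(** * The differential equation *)

Lemma csqrt_square (v : C) : (csqrt v * csqrt v)%C = v.
Proof.
  assert (K1 := re_le_Cmod v). apply Rabs_le_between in K1.
  assert (E2 := Cmod2_alt v).
  set (m := Cmod v) in *.
  assert (P1 : 0 <= (m + Re v) / 2) by lra. assert (P2 : 0 <= (m - Re v) / 2) by lra.
  assert (S1 := sqrt_sqrt _ P1). assert (S2 := sqrt_sqrt _ P2).
  assert (S3 : sqrt ((m + Re v) / 2) * sqrt ((m - Re v) / 2) = Rabs (Im v) / 2).
  { rewrite <- sqrt_mult by assumption.
    rewrite <- (sqrt_Rsqr (Rabs (Im v) / 2)) by (assert (K := Rabs_pos (Im v)); lra).
    f_equal. unfold Rsqr.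
    replace (Rabs (Im v) / 2 * (Rabs (Im v) / 2)) with (Rabs (Im v) * Rabs (Im v) / 4) by field.
    rewrite <- Rabs_mult, Rabs_pos_eq by apply Rle_0_sqr. nra. }
  unfold csqrt. fold m. set (a := sqrt ((m + Re v) / 2)) in *. set (b := sqrt ((m - Re v) / 2)) in *.
  apply injective_projections; simpl.
  - change (fst v) with (Re v). destruct (Rle_dec 0 (Im v)); nra.
  - change (snd v) with (Im v). destruct (Rle_dec 0 (Im v)) as [L|L].
    + rewrite Rabs_pos_eq in S3 by exact L. lra.
    + rewrite Rabs_left in S3 by lra. lra.
Qed.

Lemma Re_csqrt_ge_0 (v : C) : 0 <= Re (csqrt v).
Proof. apply sqrt_pos. Qed.

Lemma Re_csqrt_gt_0 (v : C) : 0 < Re v -> 0 < Re (csqrt v).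
Proof. intro H. apply sqrt_lt_R0. assert (K := Cmod_ge_0 v). lra. Qed.

(** The difference quotient is 1/(sqrt w + sqrt v). Since every value of [csqrt] has nonnegative
    real part, the denominator has modulus at least Re sqrt v for all w, on the branch cut as
    well. *)
Lemma cderiv_csqrt (v : C) : 0 < Re v -> cderiv csqrt v (/ (2 * csqrt v)).
Proof.
  intro H. assert (P := Re_csqrt_gt_0 v H). set (a := Re (csqrt v)) in *.
  assert (Sum : forall w, a <= Cmod (csqrt w + csqrt v)).
  { intro w. assert (K := re_le_Cmod (csqrt w + csqrt v)). apply Rabs_le_between in K.
    change (Re (csqrt w + csqrt v)) with (Re (csqrt w) + a) in K.
    assert (Q := Re_csqrt_ge_0 w). lra. }
  assert (N : forall w, (csqrt w + csqrt v)%C <> 0%C).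
  { intro w. apply Cmod_gt_0. specialize (Sum w). lra. }
  assert (E : forall w, csqrt w = (csqrt v + (w - v) * / (csqrt w + csqrt v))%C).
  { intro w. assert (E1 := csqrt_square w). assert (E2 := csqrt_square v).
    replace (w - v)%C with (csqrt w * csqrt w - csqrt v * csqrt v)%C by (now rewrite E1, E2).
    field. apply N. }
  assert (Cc : @cont C_UniformSpace csqrt v).
  { apply cont_C. intros eps He. exists (eps * a). split; [now apply Rmult_lt_0_compat|].
    intros w Hw. rewrite (E w). replace (csqrt v + (w - v) * / (csqrt w + csqrt v) - csqrt v)%C
      with ((w - v) / (csqrt w + csqrt v))%C by (unfold Cdiv; ring).
    rewrite Cmod_div by apply N. specialize (Sum w).
    apply Rmult_lt_reg_r with (Cmod (csqrt w + csqrt v)); [lra|].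
    unfold Rdiv. rewrite Rmult_assoc, Rinv_l by lra. nra. }
  exists (fun w => / (csqrt w + csqrt v))%C. split; [|split].
  - apply cont_inv; [|apply N]. apply cont_plus; [exact Cc|apply cont_const].
  - f_equal. ring.
  - exact E.
Qed.

(** * Primitives by integration along segments from 0 *)

Lemma CInt_FTC (f f1 : C -> C) :
  (forall t, 0 <= t <= 1 -> cderiv f (RtoC t) (f1 (RtoC t))) ->
  (forall t, 0 <= t <= 1 -> @cont C_UniformSpace f1 (RtoC t)) ->
  CInt (fun t => f1 (RtoC t)) 0 1 = (f 1 - f 0)%C.
Proof.
  intros Hd Hc.
  assert (Dt : forall t, 0 <= t <= 1 ->
    is_derive (fun s : R => Re (f (RtoC s))) t (Re (f1 (RtoC t))) /\
    is_derive (fun s : R => Im (f (RtoC s))) t (Im (f1 (RtoC t)))).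
  { intros t Ht. assert (K := cderiv_along_segment f 0 1 (f1 (RtoC t)) t).
    rewrite Cmult_1_r, Cplus_0_l, Cmult_1_l in K. destruct (K (Hd t Ht)) as [K1 K2].
    split; [apply (is_derive_ext (fun s : R => Re (f (0 + RtoC s * 1)%C))); [|exact K1]
           |apply (is_derive_ext (fun s : R => Im (f (0 + RtoC s * 1)%C))); [|exact K2]];
      intro s; now rewrite Cmult_1_r, Cplus_0_l. }
  assert (Ct : forall t, 0 <= t <= 1 -> cont (fun t : R => f1 (RtoC t)) t).
  { intros t Ht. apply (cont_comp (fun t : R => RtoC t)); [apply cont_RtoC, continuous_id|now apply Hc]. }
  apply injective_projections; simpl.
  - apply is_RInt_unique. apply (@is_RInt_derive R_CompleteNormedModule (fun t => Re (f (RtoC t))));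
      rewrite Rmin_left, Rmax_right by lra; intros t Ht; [now apply Dt|apply cont_iff, (Ct t Ht)].
  - apply is_RInt_unique. apply (@is_RInt_derive R_CompleteNormedModule (fun t => Im (f (RtoC t))));
      rewrite Rmin_left, Rmax_right by lra; intros t Ht; [now apply Dt|apply cont_iff, (Ct t Ht)].
Qed.

(** With V(s) the integral of g(ts) over [0,1], the uniform quadratic bound permits differentiation
    under the integral sign. The derivative V(s) + s V'(s) of s V(s) is then the integral of the
    t-derivative of t g(ts), which is g(s). The radius R0/4 is that of [holo_second_order_bound]. *)
Lemma cderiv_seg_int (g g1 : C -> C) (R0 : R) : 0 < R0 ->
  (forall z, Cmod z < R0 -> cderiv g z (g1 z)) ->
  forall s, Cmod s < R0 / 4 -> cderiv (seg_int g) s (g s).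
Proof.
  intros HR Hg s Hs.
  assert (Hg' : forall z, Cmod (z - 0) < R0 -> cderiv g z (g1 z)).
  { intros z Hz. apply Hg. now replace z with (z - 0)%C by ring. }
  destruct (holo_second_order_bound g g1 0 R0 HR Hg') as (L & L0 & _ & HL).
  assert (Cg : forall z, Cmod z < R0 -> @cont C_UniformSpace g z)
    by (intros z Hz; exact (cderiv_cont _ _ _ (Hg z Hz))).
  assert (Cg1 : forall z, Cmod z < R0 -> @cont C_UniformSpace g1 z).
  { intros z Hz. destruct (holo_derivative g g1 z (R0 - Cmod z)) as [m Hm]; [lra| |].
    - intros w Hw. apply Hg. assert (T := Cmod_reverse_triangle w z). lra.
    - exact (cderiv_cont _ _ _ Hm). }
  assert (Scale : forall t z, 0 <= t <= 1 -> Cmod (RtoC t * z) <= Cmod z).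
  { intros t z Ht. rewrite Cmod_mult, Cmod_R, Rabs_pos_eq by lra. assert (K := Cmod_ge_0 z). nra. }
  assert (Clin : forall z t, cont (fun t : R => RtoC t * z)%C t).
  { intros z t. apply cont_mult; [apply cont_RtoC, continuous_id|apply cont_const]. }
  assert (CV : forall z, Cmod z < R0 -> cont_on (fun t => g (RtoC t * z)%C) 0 1).
  { intros z Hz t Ht. apply (cont_comp (fun t : R => RtoC t * z)%C); [apply Clin|].
    apply Cg. specialize (Scale t z Ht). lra. }
  assert (CW : forall z, Cmod z < R0 -> cont_on (fun t => RtoC t * g1 (RtoC t * z))%C 0 1).
  { intros z Hz t Ht. apply cont_mult; [apply cont_RtoC, continuous_id|].
    apply (cont_comp (fun t : R => RtoC t * z)%C); [apply Clin|].
    apply Cg1. specialize (Scale t z Ht). lra. }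
  pose (V := fun z => CInt (fun t => g (RtoC t * z)%C) 0 1).
  pose (W := CInt (fun t => RtoC t * g1 (RtoC t * s))%C 0 1).
  assert (dV : cderiv V s W).
  { apply cderiv_eps. intros eps He. exists (Rmin (R0 / 4 - Cmod s) (eps / (2 * L + 1))).
    assert (Hd : 0 < eps / (2 * L + 1)) by (apply Rdiv_lt_0_compat; lra).
    split; [apply Rmin_glb_lt; lra|]. intros w Hw.
    assert (M1 := Rmin_l (R0 / 4 - Cmod s) (eps / (2 * L + 1))).
    assert (M2 := Rmin_r (R0 / 4 - Cmod s) (eps / (2 * L + 1))).
    assert (T := Cmod_reverse_triangle w s). assert (Kd := Cmod_ge_0 (w - s)).
    set (x := Cmod (w - s)) in *.
    assert (B : Cmod (V w - V s - (w - s) * W) <= 2 * (L * x ^ 2) * (1 - 0)).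
    { unfold V, W.
      rewrite <- CInt_scal, <- CInt_minus, <- CInt_minus; try lra; try (apply CV; lra); try (apply CW; lra).
      - apply CInt_bound; [lra| |].
        + intros t Ht. apply cont_minus; [apply cont_minus; apply CV; trivial; lra|].
          apply cont_mult; [apply cont_const|apply CW; trivial; lra].
        + intros t Ht.
          assert (Q := HL (RtoC t * s)%C (RtoC t * w)%C).
          assert (Sw := Scale t w Ht). assert (Ss := Scale t s Ht).
          replace (RtoC t * s - 0)%C with (RtoC t * s)%C in Q by ring.
          replace (RtoC t * w - 0)%C with (RtoC t * w)%C in Q by ring.
          replace (RtoC t * w - RtoC t * s)%C with (RtoC t * (w - s))%C in Q by ring.
          replace ((w - s) * (RtoC t * g1 (RtoC t * s)%C))%C with (RtoC t * (w - s) * g1 (RtoC t * s)%C)%C by ring.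
          eapply Rle_trans; [apply Q; lra|]. apply Rmult_le_compat_l; [exact L0|].
          apply pow_incr. split; [apply Cmod_ge_0|]. now apply Scale.
      - intros t Ht. apply cont_minus; apply CV; trivial; lra.
      - intros t Ht. apply cont_mult; [apply cont_const|apply CW; trivial; lra]. }
    eapply Rle_trans; [exact B|].
    assert (Hx : x < eps / (2 * L + 1)) by lra.
    apply Rmult_lt_compat_l with (r := 2 * L + 1) in Hx; [|lra].
    replace ((2 * L + 1) * (eps / (2 * L + 1))) with eps in Hx by (field; lra). nra. }
  apply (cderiv_ext_loc (fun z => z * V z)%C _ _ _ 1); [lra|intros w _; reflexivity|].
  eapply cderiv_eq; [apply cderiv_mult; [apply cderiv_id|exact dV]|].
  unfold V, W. rewrite Cmult_1_l, <- CInt_scal, <- CInt_plus; try lra; try (apply CV; lra); try (apply CW; lra).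
  - transitivity (1 * g (1 * s) - 0 * g (0 * s))%C; [|rewrite Cmult_1_l; rewrite Cmult_1_l; ring].
    rewrite <- (CInt_FTC (fun z => z * g (z * s))%C (fun z => g (z * s) + s * (z * g1 (z * s)))%C).
    + reflexivity.
    + intros t Ht. assert (Q := Scale t s Ht). eapply cderiv_eq.
      * apply cderiv_mult; [apply cderiv_id|]. apply (cderiv_comp g (fun z => z * s)%C).
        -- apply Hg. lra.
        -- apply cderiv_mult; [apply cderiv_id|apply cderiv_const].
      * cbv beta. ring.
    + intros t Ht. assert (Q := Scale t s Ht).
      assert (Cl : @cont C_UniformSpace (fun z => z * s)%C (RtoC t))
        by (apply cont_mult; [apply cont_id|apply cont_const]).
      apply cont_plus; [|apply cont_mult; [apply cont_const|apply cont_mult; [apply cont_id|]]].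
      * apply (cont_comp (fun z => z * s)%C g); [exact Cl|apply Cg; lra].
      * apply (cont_comp (fun z => z * s)%C g1); [exact Cl|apply Cg1; lra].
  - intros t Ht. apply cont_mult; [apply cont_const|apply CW; trivial; lra].
Qed.

(** * The second-order equation for cos^2(2 psi/3) *)

Definition odeA (kappa : R) : C := RtoC (8/9 * (2 * kappa ^ 2 - 1)).

Definition odeQ (x : C) : C :=
  (RtoC (4/3) * (1 - x) * (4 * x - 1) - RtoC (8/9) * (4 * x - 3) * x)%C.

Lemma cderiv_pow2 (f : C -> C) (z l : C) : cderiv f z l -> cderiv (fun w => f w ^ 2)%C z (2 * f z * l).
Proof.
  intro H. apply (cderiv_ext_loc (fun w => f w * f w)%C _ _ _ 1); [lra| |now apply cderiv_square].
  intros w _. simpl. ring.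
Qed.

Lemma near_0 (f : C -> C) (r eps : R) : 0 < r ->
  (forall w, Cmod w < r -> holo_at f w) -> f 0%C = 0%C -> 0 < eps ->
  exists d, 0 < d /\ forall w, Cmod w < d -> Cmod (f w) < eps.
Proof.
  intros Hr Hf H0 He. destruct (proj1 (holo_at_cderiv f 0) (Hf 0%C ltac:(now rewrite Cmod_0))) as [l Hl].
  destruct (proj1 (cont_C f 0) (cderiv_cont _ _ _ Hl) eps He) as (d & Hd & K).
  exists d. split; [exact Hd|]. intros w Hw. specialize (K w). rewrite H0 in K.
  replace (f w - 0)%C with (f w) in K by ring. apply K. now replace (w - 0)%C with w by ring.
Qed.

Lemma near_nonzero (f : C -> C) (l : C) : cderiv f 0 l -> f 0%C <> 0%C ->
  exists d, 0 < d /\ forall w, Cmod w < d -> f w <> 0%C.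
Proof.
  intros Hl H0. assert (P := proj1 (Cmod_gt_0 _) H0).
  destruct (proj1 (cont_C f 0) (cderiv_cont _ _ _ Hl) _ P) as (d & Hd & K).
  exists d. split; [exact Hd|]. intros w Hw E. specialize (K w).
  replace (w - 0)%C with w in K by ring. specialize (K Hw). rewrite E in K.
  replace (0 - f 0%C)%C with (- f 0%C)%C in K by ring. rewrite Cmod_opp in K. lra.
Qed.

(** [Y] and [Y2] are the first two derivatives, given as functions so that those of an extension can
    be compared with them on a disc. *)
Lemma nabla_equation (kappa r : R) (phi psi : C -> C) :
  0 < kappa < 1 -> 0 < r ->
  (forall w, Cmod w < r -> holo_at phi w) -> phi 0%C = 0%C ->
  (forall w, Cmod w < r -> u_of kappa (phi w) = w) ->
  (forall w, Cmod w < r -> holo_at psi w) -> psi 0%C = 0%C ->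
  (forall w, Cmod w < r -> csin (psi w) = (RtoC kappa * csin (phi w))%C) ->
  exists rho (Y Y2 : C -> C), 0 < rho /\ forall w, Cmod w < rho ->
    cderiv (fun w => ccos (RtoC (2/3) * psi w) ^ 2)%C w (Y w) /\ cderiv Y w (Y2 w) /\
    ((2 * Y2 w + odeA kappa) * (2 * Y2 w + odeA kappa) * ccos (RtoC (2/3) * psi w) ^ 2 =
     odeQ (ccos (RtoC (2/3) * psi w) ^ 2) * odeQ (ccos (RtoC (2/3) * psi w) ^ 2))%C.
Proof.
  intros Hk Hr Hphi phi0 Hu Hpsi psi0 Hsin.
  (* [u_of] depends on [phi] only through its sine; thus [s] replaces [phi] as the variable, and the
     root [q] at [s] replaces cos phi. *)
  pose (s := fun w => csin (phi w)).
  pose (th := fun w => (RtoC (2/3) * psi w)%C).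
  pose (F := fun t => hyp2F1 (1/6) (5/6) (1/2) (RtoC (kappa ^ 2) * (t * t))%C).
  pose (q := fun t => csqrt (1 - t * t)%C).
  pose (g := fun t => (F t / q t)%C).
  assert (Hsq : forall t, Cmod t < 1 -> Cmod (t * t) < 1).
  { intros t Ht. rewrite Cmod_mult. assert (K := Cmod_ge_0 t). nra. }
  assert (Hre : forall t, Cmod t < 1 -> 0 < Re (1 - t * t)).
  { intros t Ht. assert (K := re_le_Cmod (t * t)). apply Rabs_le_between in K.
    specialize (Hsq t Ht). change (Re (1 - t * t)) with (1 + - Re (t * t)). lra. }
  assert (dq : forall t, Cmod t < 1 -> cderiv q t (- t / q t)).
  { intros t Ht. eapply cderiv_eq.
    - apply (cderiv_comp csqrt (fun t => 1 - t * t)%C); [now apply cderiv_csqrt, Hre|].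
      apply cderiv_minus; [apply cderiv_const|apply cderiv_square, cderiv_id].
    - unfold q. field. intro E. assert (P := Re_csqrt_gt_0 _ (Hre t Ht)). rewrite E in P. simpl in P. lra. }
  assert (q0 : forall t, Cmod t < 1 -> q t <> 0%C).
  { intros t Ht E. assert (P := Re_csqrt_gt_0 _ (Hre t Ht)). unfold q in E. rewrite E in P. simpl in P. lra. }
  assert (dg : forall t, Cmod t < 1 -> exists l, cderiv g t l).
  { intros t Ht. eexists. apply cderiv_mult.
    - apply (cderiv_psum_comp hyp_coef 1 (fun t => RtoC (kappa ^ 2) * (t * t))%C).
      + apply summable_hyp_coef.
      + rewrite Cmod_mult, Cmod_R. specialize (Hsq t Ht). assert (K := Cmod_ge_0 (t * t)).
        rewrite Rabs_pos_eq by nra. nra.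
      + apply cderiv_mult; [apply cderiv_const|apply cderiv_square, cderiv_id].
    - apply cderiv_inv; [now apply dq|now apply q0]. }
  (* The integrand is holomorphic on the unit disc, so [cderiv_seg_int] applies on a quarter of
     it. *)
  assert (dU : forall t, Cmod t < 1 / 4 -> cderiv (seg_int g) t (g t)).
  { intros t Ht. apply (cderiv_seg_int g (C_derive g) 1); [lra| |lra].
    intros z Hz. destruct (dg z Hz) as [l Hl].
    apply is_derive_cderiv, C_derive_correct; [exact z|]. exists l. now apply is_derive_cderiv. }
  destruct hyp_trig as (d1 & Hd1 & Htrig).
  destruct (near_0 psi r d1 Hr Hpsi psi0 Hd1) as (e1 & He1 & Hpsi1).
  assert (holo_s : forall w, Cmod w < r -> holo_at s w).
  { intros w Hw. apply holo_at_cderiv. destruct (proj1 (holo_at_cderiv _ _) (Hphi w Hw)) as [l Hl].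
    eexists. apply cderiv_csin_comp, Hl. }
  destruct (near_0 s r (1/4) Hr holo_s) as (e2 & He2 & Hs4).
  { unfold s. now rewrite phi0, csin_0. } { lra. }
  destruct (proj1 (holo_at_cderiv _ _) (Hpsi 0%C ltac:(now rewrite Cmod_0))) as [lpsi Hlpsi].
  assert (dth : forall w l, cderiv psi w l -> cderiv th w (RtoC (2/3) * l)).
  { intros w l Hl. eapply cderiv_eq; [apply cderiv_mult; [apply cderiv_const|exact Hl]|]. cbv beta. ring. }
  assert (th0 : th 0%C = 0%C) by (unfold th; rewrite psi0; ring).
  destruct (near_nonzero (fun w => ccos (th w)) (- csin (th 0%C) * (RtoC (2/3) * lpsi))) as (e3 & He3 & Hd).
  { apply cderiv_ccos_comp, dth, Hlpsi. }
  { rewrite th0, ccos_0. apply RtoC_neq_0. lra. }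
  destruct (near_nonzero (fun w => ccos (psi w)) (- csin (psi 0%C) * lpsi)) as (e4 & He4 & Hc).
  { apply cderiv_ccos_comp, Hlpsi. }
  { rewrite psi0, ccos_0. apply RtoC_neq_0. lra. }
  set (rho := Rmin r (Rmin (Rmin e1 e2) (Rmin e3 e4))).
  assert (Hrho : 0 < rho) by (unfold rho; repeat apply Rmin_glb_lt; assumption).
  assert (Hrho' : forall w, Cmod w < rho ->
     Cmod w < r /\ Cmod w < e1 /\ Cmod w < e2 /\ Cmod w < e3 /\ Cmod w < e4).
  { intros w Hw. unfold rho in Hw.
    assert (M1 := Rmin_l r (Rmin (Rmin e1 e2) (Rmin e3 e4))).
    assert (M2 := Rmin_r r (Rmin (Rmin e1 e2) (Rmin e3 e4))).
    assert (M3 := Rmin_l (Rmin e1 e2) (Rmin e3 e4)). assert (M4 := Rmin_r (Rmin e1 e2) (Rmin e3 e4)).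
    assert (M5 := Rmin_l e1 e2). assert (M6 := Rmin_r e1 e2).
    assert (M7 := Rmin_l e3 e4). assert (M8 := Rmin_r e3 e4). lra. }
  (* The two defining relations are differentiated, and F cos psi = cos theta from [hyp_trig] then
     removes the hypergeometric function from the result. *)
  assert (Main : forall w, Cmod w < rho -> exists lp ls, cderiv psi w lp /\ cderiv s w ls /\
     (ccos (th w) * lp = RtoC kappa * q (s w))%C /\ (ccos (th w) * ls = q (s w) * ccos (psi w))%C).
  { intros w Hw. destruct (Hrho' w Hw) as (W0 & W1 & W2 & W3 & W4).
    destruct (proj1 (holo_at_cderiv _ _) (Hpsi w W0)) as [lp Hlp].
    destruct (proj1 (holo_at_cderiv _ _) (holo_s w W0)) as [ls Hls].
    exists lp, ls. split; [exact Hlp|]. split; [exact Hls|].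
    assert (Near : 0 < r - Cmod w) by lra.
    assert (Near' : forall v, Cmod (v - w) < r - Cmod w -> Cmod v < r).
    { intros v Hv. assert (T := Cmod_reverse_triangle v w). lra. }
    assert (E1 : (g (s w) * ls = 1)%C).
    { apply (cderiv_unique (fun v => v) w); [|apply cderiv_id].
      apply (cderiv_ext_loc (fun v => seg_int g (s v)) _ _ _ (r - Cmod w) Near).
      - intros v Hv. exact (Hu v (Near' v Hv)).
      - apply cderiv_comp; [apply dU, Hs4, W2|exact Hls]. }
    assert (E2 : (ccos (psi w) * lp = RtoC kappa * ls)%C).
    { apply (cderiv_unique (fun v => csin (psi v)) w); [now apply cderiv_csin_comp|].
      apply (cderiv_ext_loc (fun v => RtoC kappa * s v)%C _ _ _ (r - Cmod w) Near).
      - intros v Hv. symmetry. exact (Hsin v (Near' v Hv)).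
      - eapply cderiv_eq; [apply cderiv_mult; [apply cderiv_const|exact Hls]|]. cbv beta. ring. }
    destruct (Htrig (psi w) (Hpsi1 w W1)) as [_ E3].
    assert (E4 : F (s w) = hyp2F1 (1/6) (5/6) (1/2) (csin (psi w) * csin (psi w))%C).
    { unfold F. f_equal. rewrite (Hsin w W0). change (kappa ^ 2) with (kappa * (kappa * 1)).
      rewrite Rmult_1_r, RtoC_mult. fold (s w). ring. }
    rewrite <- E4 in E3. fold (th w) in E3.
    assert (Q0 : q (s w) <> 0%C) by (apply q0; specialize (Hs4 w W2); lra).
    assert (C0 := Hc w W4). cbv beta in C0.
    assert (E5 : (F (s w) * ls = q (s w))%C).
    { replace (F (s w) * ls)%C with (g (s w) * ls * q (s w))%C by (unfold g; field; exact Q0).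
      rewrite E1. ring. }
    assert (E6 : (ccos (th w) * ls = q (s w) * ccos (psi w))%C).
    { rewrite <- E3, <- E5. ring. }
    split; [|exact E6].
    rewrite <- (Cmult_1_l (ccos (th w) * lp)), <- (Cmult_1_l (RtoC kappa * q (s w))), <- (Cinv_l _ C0).
    rewrite <- !Cmult_assoc. f_equal.
    replace (ccos (psi w) * (ccos (th w) * lp))%C with (ccos (th w) * (ccos (psi w) * lp))%C by ring.
    rewrite E2. replace (ccos (th w) * (RtoC kappa * ls))%C with (RtoC kappa * (ccos (th w) * ls))%C by ring.
    rewrite E6. ring. }
  (* The derivative of cos^2 theta is -(4/3) sin theta cos theta psi'. Since cos theta psi' = kappa
     q, it can be written without psi' and so be differentiated again. *)
  pose (Y := fun w => (- RtoC (4/3) * RtoC kappa * (csin (th w) * q (s w)))%C).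
  exists rho, Y, (C_derive Y). split; [exact Hrho|]. intros w Hw.
  destruct (Main w Hw) as (lp & ls & Hlp & Hls & E1 & E2).
  destruct (Hrho' w Hw) as (W0 & W1 & W2 & W3 & W4).
  assert (D0 := Hd w W3). cbv beta in D0.
  assert (S1 : Cmod (s w) < 1) by (specialize (Hs4 w W2); lra).
  assert (Q0 := q0 _ S1).
  assert (Q2 : (q (s w) * q (s w) = 1 - s w * s w)%C) by apply csqrt_square.
  split.
  { eapply cderiv_eq; [apply cderiv_pow2, cderiv_ccos_comp, dth, Hlp|].
    unfold Y.
    replace (RtoC (4/3)) with (2 * RtoC (2/3))%C by (rewrite <- RtoC_mult; f_equal; field).
    transitivity (- (2 * RtoC (2/3)) * csin (th w) * (ccos (th w) * lp))%C; [unfold th; ring|].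
    rewrite E1. ring. }
  assert (dY : cderiv Y w (- RtoC (4/3) * RtoC kappa *
     (ccos (th w) * (RtoC (2/3) * lp) * q (s w) + csin (th w) * (- s w / q (s w) * ls)))).
  { eapply cderiv_eq.
    - apply cderiv_mult; [apply cderiv_const|]. apply cderiv_mult.
      + apply cderiv_csin_comp, dth, Hlp.
      + apply (cderiv_comp q s); [now apply dq|exact Hls].
    - cbv beta. ring. }
  assert (EY : C_derive Y w = (- RtoC (4/3) * RtoC kappa *
     (ccos (th w) * (RtoC (2/3) * lp) * q (s w) + csin (th w) * (- s w / q (s w) * ls)))%C).
  { apply is_C_derive_unique, is_derive_cderiv, dY. }
  rewrite EY. split; [exact dY|]. clear EY dY. change (RtoC (2/3) * psi w)%C with (th w).
  (* The relation before squaring, linear in cos theta. Multiplying by cos theta is what makes psi'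
     and s' eliminable through [E1] and [E2]. *)
  assert (Elin : ((2 * (- RtoC (4/3) * RtoC kappa *
     (ccos (th w) * (RtoC (2/3) * lp) * q (s w) + csin (th w) * (- s w / q (s w) * ls))) + odeA kappa)
     * ccos (th w) = odeQ (ccos (th w) ^ 2))%C).
  { assert (P1 := Hsin w W0). fold (s w) in P1.
    set (d := ccos (th w)) in *. set (sg := csin (th w)) in *.
    assert (Esg : (sg * sg = 1 - d * d)%C) by (unfold sg, d; rewrite <- (ccos2_csin2 (th w)); ring).
    (* The arithmetic of the factor 2/3: 2 psi = 3 theta. Double and triple angle formulas then
       express 2 sin^2 psi ([X1]) and 2 sin psi cos psi ([X2]) through theta. *)
    assert (Eth : (psi w + psi w = th w + th w + th w)%C).
    { unfold th. replace (RtoC (2/3)) with (2 / 3)%C by (rewrite RtoC_div; trivial; lra).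
      field. }
    assert (T1 := f_equal ccos Eth). assert (T2 := f_equal csin Eth).
    rewrite !ccos_plus in T1. rewrite !csin_plus in T2. rewrite !ccos_plus in T2.
    rewrite !csin_plus in T1. fold d in T1, T2. fold sg in T1, T2.
    assert (T3 := ccos2_csin2 (psi w)).
    set (p := csin (psi w)) in *. set (c := ccos (psi w)) in *.
    assert (X1 : (2 * (p * p) = 1 - (4 * (d * d * d) - 3 * d))%C).
    { replace (2 * (p * p))%C with ((c * c + p * p) - (c * c - p * p))%C by ring.
      rewrite T1, T3.
      replace ((d * d - sg * sg) * d - (sg * d + d * sg) * sg)%C with (d * d * d - 3 * (sg * sg) * d)%C by ring.
      rewrite Esg. ring. }
    assert (X2 : (2 * (p * c) = sg * (4 * (d * d) - 1))%C).
    { replace (2 * (p * c))%C with (p * c + c * p)%C by ring. rewrite T2.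
      replace ((sg * d + d * sg) * d + (d * d - sg * sg) * sg)%C with (sg * (3 * (d * d) - sg * sg))%C by ring.
      rewrite Esg. ring. }
    assert (X3 : (RtoC kappa * RtoC kappa * (q (s w) * q (s w)) = RtoC kappa * RtoC kappa - p * p)%C).
    { rewrite Q2, P1. ring. }
    assert (X4 : (RtoC kappa * (s w * c) = p * c)%C) by (rewrite P1; ring).
    unfold odeA, odeQ.
    replace (RtoC (8/9 * (2 * kappa ^ 2 - 1))) with (RtoC (8/9) * (2 * (RtoC kappa * RtoC kappa) - 1))%C.
    2:{ rewrite <- !RtoC_mult, <- RtoC_minus, <- RtoC_mult. f_equal. ring. }
    replace (RtoC (8/9)) with (2 * RtoC (2/3) * RtoC (2/3))%C by (rewrite <- !RtoC_mult; f_equal; field).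
    replace (RtoC (4/3)) with (2 * RtoC (2/3))%C by (rewrite <- !RtoC_mult; f_equal; field).
    set (h := RtoC (2/3)).
    transitivity (- (4 * h * h) * (RtoC kappa * (d * lp) * q (s w)) * d
       + 4 * h * RtoC kappa * sg * (s w * (d * ls) / q (s w))
       + 2 * h * h * (2 * (RtoC kappa * RtoC kappa) - 1) * d)%C.
    { field. exact Q0. }
    rewrite E1, E2.
    transitivity (- (4 * h * h) * (RtoC kappa * RtoC kappa * (q (s w) * q (s w))) * d
       + 4 * h * sg * (RtoC kappa * (s w * c))
       + 2 * h * h * (2 * (RtoC kappa * RtoC kappa) - 1) * d)%C.
    { field. exact Q0. }
    rewrite X3, X4.
    transitivity (2 * h * h * (2 * (p * p) - 1) * d + 2 * h * sg * (2 * (p * c)))%C; [ring|].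
    rewrite X1, X2.
    transitivity (2 * h * h * (1 - (4 * (d * d * d) - 3 * d) - 1) * d
       + 2 * h * (sg * sg) * (4 * (d * d) - 1))%C; [ring|].
    rewrite Esg. simpl. ring. }
  rewrite <- Elin. simpl. ring.
Qed.

(** * Continuation of the equation to an elliptic extension *)

Lemma cderiv_C_derive (f : C -> C) (z : C) : (exists l, cderiv f z l) -> cderiv f z (C_derive f z).
Proof.
  intros [l Hl]. apply is_derive_cderiv, C_derive_correct; [exact z|].
  exists l. now apply is_derive_cderiv.
Qed.

Lemma C_derive_cderiv (f : C -> C) (z l : C) : cderiv f z l -> C_derive f z = l.
Proof. intro H. now apply is_C_derive_unique, is_derive_cderiv. Qed.

Theorem theorem10 (kappa r : R) (phi psi : C -> C) :
  0 < kappa < 1 -> 0 < r ->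
  (* phi : u |-> phi(u), the holomorphic inverse of phi |-> u near 0, phi(0)=0 *)
  (forall w, Cmod w < r -> holo_at phi w) ->
  phi (RtoC 0) = RtoC 0 ->
  (forall w, Cmod w < r -> u_of kappa (phi w) = w) ->
  (* psi holomorphic near 0, psi(0)=0, sin psi = kappa sin phi *)
  (forall w, Cmod w < r -> holo_at psi w) ->
  psi (RtoC 0) = RtoC 0 ->
  (forall w, Cmod w < r -> csin (psi w) = Cmult (RtoC kappa) (csin (phi w))) ->
  (* nabla = cos^2 (2/3 psi) does not extend to an elliptic function *)
  ~ exists f : C -> C, elliptic f /\
      exists r', 0 < r' /\ forall w, Cmod w < r' ->
        f w = Cpow (ccos (Cmult (RtoC (2/3)) (psi w))) 2.
Proof.
  intros Hk Hr Hphi phi0 Hu Hpsi psi0 Hsin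
    (f & (P & w1 & w2 & HP & Hf & Hpole & Hind & HPper & Hfper) & r' & Hr' & Hext).
  destruct (nabla_equation kappa r phi psi Hk Hr Hphi phi0 Hu Hpsi psi0 Hsin)
    as (rho & Y & Y2 & Hrho & Hode).
  set (e := Rmin rho r'). assert (He : 0 < e) by now apply Rmin_glb_lt.
  assert (He1 : e <= rho) by apply Rmin_l. assert (He2 : e <= r') by apply Rmin_r.
  set (f1 := C_derive f). set (f2 := C_derive f1).
  assert (near : forall w v, Cmod (v - w) < e - Cmod w -> Cmod v < e).
  { intros w v Hv. assert (T := Cmod_reverse_triangle v w). lra. }
  assert (Ef1 : forall w, Cmod w < e -> f1 w = Y w).
  { intros w Hw. apply C_derive_cderiv.
    apply (cderiv_ext_loc (fun w => ccos (RtoC (2/3) * psi w) ^ 2)%C _ _ _ (e - Cmod w)); [lra| |].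
    - intros v Hv. symmetry. apply Hext. specialize (near w v Hv). lra.
    - apply Hode. lra. }
  assert (Ef2 : forall w, Cmod w < e -> f2 w = Y2 w).
  { intros w Hw. apply C_derive_cderiv.
    apply (cderiv_ext_loc Y _ _ _ (e - Cmod w)); [lra| |].
    - intros v Hv. symmetry. now apply Ef1, (near w).
    - apply Hode. lra. }
  (* The defect of the squared equation. It involves f'', so its holomorphy off the poles takes
     [holo_derivative] twice. *)
  pose (G := fun z => ((2 * f2 z + odeA kappa) * (2 * f2 z + odeA kappa) * f z
                        - odeQ (f z) * odeQ (f z))%C).
  assert (G0 : forall w, Cmod w < e -> G w = 0%C).
  { intros w Hw. unfold G. rewrite (Ef2 w Hw), (Hext w) by lra.
    destruct (Hode w) as (_ & _ & ->); [lra|]. ring. }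
  assert (Open : forall z, ~ P z -> exists d, 0 < d /\ forall w, Cmod (w - z) < d -> ~ P w).
  { intros z Hz. destruct (HP z) as (d & Hd & K). exists d. split; [exact Hd|].
    intros w Hw Pw. apply Hz. now rewrite <- (K w Hw Pw). }
  assert (D0 : forall z, ~ P z -> cderiv f z (f1 z)).
  { intros z Hz. now apply cderiv_C_derive, holo_at_cderiv, Hf. }
  assert (D1 : forall z, ~ P z -> cderiv f1 z (f2 z)).
  { intros z Hz. apply cderiv_C_derive. destruct (Open z Hz) as (d & Hd & K).
    apply (holo_derivative f f1 z d Hd). auto. }
  assert (D2 : forall z, ~ P z -> exists l, cderiv f2 z l).
  { intros z Hz. destruct (Open z Hz) as (d & Hd & K).
    apply (holo_derivative f1 f2 z d Hd). auto. }
  assert (DQ : forall z, exists l, cderiv odeQ z l).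
  { intro z. eexists. apply cderiv_minus; repeat apply cderiv_mult; try apply cderiv_const;
      try apply cderiv_id; apply cderiv_minus; try apply cderiv_const; try apply cderiv_id;
      apply cderiv_mult; (apply cderiv_const || apply cderiv_id). }
  assert (GP : forall z, ~ P z -> G z = 0%C).
  { apply (identity_theorem P G HP) with (a := RtoC 0) (e := e); [|exact He|].
    - intros z Hz. destruct (D2 z Hz) as [l Hl]. destruct (DQ (f z)) as [m Hm].
      assert (B1 : cderiv (fun z => 2 * f2 z + odeA kappa)%C z (0 * f2 z + 2 * l + 0)%C).
      { apply cderiv_plus; [|apply cderiv_const]. apply cderiv_mult; [apply cderiv_const|exact Hl]. }
      assert (B2 := cderiv_comp odeQ f z m (f1 z) Hm (D0 z Hz)).
      eexists. unfold G. apply cderiv_minus; [|exact (cderiv_mult _ _ _ _ _ B2 B2)].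
      apply cderiv_mult; [exact (cderiv_mult _ _ _ _ _ B1 B1)|now apply D0].
    - intros w Hw _. apply G0. now replace w with (w - 0)%C by ring. }
  assert (Hnz : forall z, ~ P z -> f z <> 0%C).
  (* At a zero of [f] the term with f'' drops out and the defect equals -Q(0)^2 = -(4/3)^2. *)
  { intros z Hz E. specialize (GP z Hz). unfold G, odeQ in GP. rewrite E in GP.
    assert (GP' : RtoC (4/3 * (4/3)) = 0%C).
    { rewrite RtoC_mult. match type of GP with ?lhs = _ => transitivity (- lhs)%C end.
      - ring.
      - rewrite GP. ring. }
    apply RtoC_inj in GP'. lra. }
  destruct (nonvanishing_elliptic_constant f P w1 w2 HP Hf Hpole Hind HPper Hfper Hnz) as [v Hv].
  assert (Z0 : Cmod 0 < e) by now rewrite Cmod_0.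
  assert (f0 : f 0%C = 1%C).
  { rewrite Hext by lra. rewrite psi0, Cmult_0_r, ccos_0. simpl. ring. }
  assert (Cst : forall (g : C -> C) c, (forall z, g z = c) -> forall z, C_derive g z = 0%C).
  { intros g c Hg z. apply C_derive_cderiv. apply (cderiv_ext_loc (fun _ => c) _ _ _ 1); [lra| |apply cderiv_const].
    intros w _. now rewrite Hg. }
  assert (F2 : f2 0%C = 0%C) by (apply (Cst f1 0%C), (Cst f v), Hv).
  (* For the constant 1 the second derivative is 0 and Q(1) = -8/9, which matches the factor 8/9 in
     [odeA]. *)
  assert (K := G0 0%C Z0). unfold G, odeQ, odeA in K. rewrite F2, f0 in K.
  assert (K' : RtoC (8/9 * (2 * kappa ^ 2 - 1) * (8/9 * (2 * kappa ^ 2 - 1)) - 8/9 * (8/9)) = 0%C).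
  { match type of K with ?lhs = _ => transitivity lhs end; [|exact K].
    rewrite RtoC_minus, !(RtoC_mult (8/9 * _) (8/9 * _)), (RtoC_mult (8/9) (8/9)). ring. }
  apply RtoC_inj in K'.
  assert (H1 : 0 < kappa ^ 2 < 1) by (simpl; nra). nra.
Qed.
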